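(* Let $\Omega\subseteq\mathbb{R}^n$ be open and bounded, let $\mathcal{A}$ be the class of all open subsets of $\Omega$, let $(X^h)_h\in\mathcal{S}_1\cup\mathcal{S}_2$ with limit $X$-gradient $X$ (coefficient matrices $\mathcal{C}^h$, $\mathcal{C}$), and let $0<\lambda\le\Lambda$. Let $A^h\in E^h(\Omega;\lambda,\Lambda)$ for every $h\in\mathbb{N}$ and $A^\infty\in E^\infty(\Omega;\lambda,\Lambda)$, and let $$F_h(u,U)=\begin{cases}\int_U\langle A^hX^hu,X^hu\rangle_{\mathbb{R}^m}\,dx&\text{if }u\in W^{1,2}_{X^h}(U),\\ \infty&\text{otherwise,}\end{cases}\qquad F(u,U)=\begin{cases}\int_U\langle A^\infty Xu,Xu\rangle_{\mathbb{R}^m}\,dx&\text{if }u\in W^{1,2}_{X}(U),\\ \infty&\text{otherwise,}\end{cases}$$ for $u\in L^2(\Omega)$, $U\in\mathcal{A}$. Assume that $F(\cdot,U)=\Gamma(L^2)\text{-}\lim_{h\to\infty}F_h(\cdot,U)$ for every $U\in\mathcal{A}$. Then, up to subsequences, $$\int_U\langle A^\infty Xu,\mathcal{C}\Phi\rangle_{\mathbb{R}^m}\,dx=\lim_{h\to\infty}\int_U\langle A^hX^hu_h,\mathcal{C}^h\Phi_h\rangle_{\mathbb{R}^m}\,dx$$ for any $U\in\mathcal{A}$, any $u\in L^2(\Omega)$ with $u\in W^{1,2}_X(U)$, any recovery sequence $(u_h)_h$ for $u$ relative to $F(\cdot,U)$, any $\Phi\in L^2(\Omega;\mathbb{R}^n)$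 and any $(\Phi_h)_h\subseteq L^2(\Omega;\mathbb{R}^n)$ such that $\mathcal{C}^h\Phi_h\to\mathcal{C}\Phi$ strongly in $L^2(\Omega;\mathbb{R}^m)$.
   Context: Integers $0<m\le n$ are fixed. An $X$-gradient (anisotropy) on $\Omega$ with $m$ components is a family $X=(X_1,\dots,X_m)$ of Lipschitz vector fields $X_j=\sum_{i=1}^n c_{j,i}\frac{\partial}{\partial x_i}$, $c_{j,i}\in \mathrm{Lip}(\Omega)$; it is identified with its $m\times n$ coefficient matrix $\mathcal{C}(x)=[c_{j,i}(x)]$ (row index $j$, column index $i$). For $U\subseteq\Omega$ open and $u\in L^2(U)$ the $X$-gradient $Xu$ is the $m$-dimensional distribution $Xu(\varphi)=-\int_U u\,\mathrm{div}(\mathcal{C}^T\varphi)\,dx$, $\varphi\in\mathbf{C}^\infty_c(U;\mathbb{R}^m)$, and $W^{1,2}_X(U)=\{u\in L^2(U): Xu\in L^2(U;\mathbb{R}^m)\}$. For $u\in L^2(\Omega)$, ''$u\in W^{1,2}_X(U)$'' means that the restriction of $u$ to $U$ belongs to $W^{1,2}_X(U)$. The same objects for $X^h$ are defined from its coefficient matrix $\mathcal{C}^h$. Classes $\mathcal{S}_1,\mathcal{S}_2$: let $(X^h)_h$ be a sequence of $X$-gradients on $\Omega$ with $m$ components and Lipschitz coefficient matrices $\mathcal{C}^h$, and let $X$ be a limit $X$-gradient with $m\times n$ Lipschitz coefficient matrix $\mathcal{C}$ such that $\mathcal{C}^h\to\mathcal{C}$ uniformly on $\Omega$. Then: $(X^h)_h\in\mathcal{S}_1$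 if there is an integer $1\le k\le m$ such that for every $h$ the first $k$ rows of $\mathcal{C}^h$ coincide with those of $\mathcal{C}$, and the last $m-k$ rows of $\mathcal{C}$ are zero; $(X^h)_h\in\mathcal{S}_2$ if $(\mathcal{C}^h)_h$ is bounded in the space of Lipschitz $m\times n$ matrix-valued functions $\mathrm{Lip}(\Omega,M(m,n))$. The index $\infty$ refers to the limit: $X^\infty=X$, $\mathcal{C}^\infty=\mathcal{C}$. For $h\in\mathbb{N}\cup\{\infty\}$, $E^h(\Omega;\lambda,\Lambda)$ is the class of symmetric, measurable matrix-valued functions $A^h:\Omega\to\mathbb{R}^{m\times m}$ such that $\lambda|\mathcal{C}^h(x)\xi|^2\le\langle A^h(x)\mathcal{C}^h(x)\xi,\mathcal{C}^h(x)\xi\rangle_{\mathbb{R}^m}\le\Lambda|\mathcal{C}^h(x)\xi|^2$ for a.e. $x\in\Omega$ and every $\xi\in\mathbb{R}^n$. $\Gamma(L^2)$-convergence of $F_h:L^2(\Omega)\to[0,\infty]$ to $F$ means: for every $u$ and every $u_h\to u$ strongly in $L^2(\Omega)$, $F(u)\le\liminf_hF_h(u_h)$; and for every $u$ there is $u_h\to u$ strongly in $L^2(\Omega)$ with $F(u)\ge\limsup_hF_h(u_h)$. A sequence $(u_h)_h$ as in the second condition is called a recovery sequence for $u$ (here, for $F(\cdot,U)$, $F_h(\cdot,U)$). *)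

(* Defs.v *)
From HB Require Import structures.
From mathcomp Require Import all_boot all_order all_algebra.
From mathcomp Require Import all_classical all_reals all_analysis.

Set Implicit Arguments.
Unset Strict Implicit.
Unset Printing Implicit Defensive.
Import Order.TTheory GRing.Theory Num.Theory.
Import numFieldNormedType.Exports.

Local Open Scope classical_set_scope.
Local Open Scope ring_scope.

(* Lebesgue measure on R^n, the space of column vectors: the n-fold product of
   the Lebesgue measure of R is built on the Borel sigma-algebra of n-tuples,
   then its outer measure is transported to 'cV[R]_n and restricted to its
   Caratheodory sigma-algebra, which is the complete sigma-algebra of
   Lebesgue measurable sets. *)

Section cons_measure.
Context {R : realType} {n : nat}.
Local Notation rT := (measurableTypeR R).
Variable mu : {sigma_finite_measure set (n.-tuple rT) -> \bar R}.

Definition tcons (p : rT * n.-tuple rT) : n.+1.-tuple rT :=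
  [tuple of p.1 :: p.2].

Lemma measurable_tcons : measurable_fun [set: rT * n.-tuple rT] tcons.
Proof. exact: measurable_cons. Qed.

Definition cons_measure : set (n.+1.-tuple rT) -> \bar R :=
  pushforward (@lebesgue_measure R \x mu)%E tcons.

Let cons_measure0 : cons_measure set0 = 0%E.
Proof. by rewrite /cons_measure /pushforward preimage_set0 measure0. Qed.

Let cons_measure_ge0 A : (0 <= cons_measure A)%E.
Proof. exact: (measure_ge0 (@lebesgue_measure R \x mu)%E). Qed.

Let cons_measure_sigma_additive : semi_sigma_additive cons_measure.
Proof.
exact: (@measure_semi_sigma_additive _ _ _
  (measure_function_pushforward__canonical__measure_function_Measure
    (@lebesgue_measure R \x mu)%E measurable_tcons)).
Qed.

HB.instance Definition _ := isMeasure.Build _ _ _ cons_measure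
  cons_measure0 cons_measure_ge0 cons_measure_sigma_additive.

Let cons_measure_sigma_finite : sigma_finite setT cons_measure.
Proof.
have /sigma_finiteP[F [TF ndF Foo]] := sigma_finiteT (@lebesgue_measure R).
have /sigma_finiteP[G [TG ndG Goo]] := sigma_finiteT mu.
pose hd (t : n.+1.-tuple rT) : (rT * n.-tuple rT)%type :=
  (tnth t ord0, [tuple of behead t]).
have mhd : measurable_fun setT hd.
  apply/measurable_fun_pair; first exact: measurable_tnth.
  exact: measurable_behead.
have hdK : cancel tcons hd by move=> [x t]; congr pair; exact/val_inj.
exists (fun k => hd @^-1` (F k `*` G k)).
  apply/esym; rewrite -subTset => t _.
  have [i _ Fi] : (\bigcup_k F k) (hd t).1 by rewrite -TF.
  have [j _ Gj] : (\bigcup_k G k) (hd t).2 by rewrite -TG.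
  exists (maxn i j) => //; split.
    by move: Fi; exact/subsetPset/ndF/leq_maxl.
  by move: Gj; exact/subsetPset/ndG/leq_maxr.
move=> k; have [mF Fk] := Foo k; have [mG Gk] := Goo k; split.
  by rewrite -[X in measurable X]setTI; apply: mhd => //; exact: measurableX.
rewrite /cons_measure /pushforward -comp_preimage.
rewrite (_ : hd \o tcons = id); last exact/funext.
by rewrite preimage_id product_measure1E// lte_mul_pinfty// ge0_fin_numE.
Qed.

HB.instance Definition _ := Measure_isSigmaFinite.Build _ _ _ cons_measure
  cons_measure_sigma_finite.

End cons_measure.

Fixpoint tuple_lebesgue (R : realType) (n : nat) :
    {sigma_finite_measure set (n.-tuple (measurableTypeR R)) -> \bar R} :=
  if n is n'.+1 then cons_measure (tuple_lebesgue R n')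
  else dirac [tuple of [::]].

Lemma tuple_lebesgue_box (R : realType) (n : nat)
    (A : 'I_n -> set (measurableTypeR R)) :
  (forall i, measurable (A i)) ->
  tuple_lebesgue R n [set t | forall i, A i (tnth t i)] =
  (\prod_(i < n) @lebesgue_measure R (A i))%E.
Proof.
elim: n A => [|n IHn] A mA.
  rewrite big_ord0 /= (_ : [set t | _] = setT) ?diracT//.
  by rewrite -subTset => t _ [].
rewrite big_ord_recl -(IHn (fun i => A (lift ord0 i)))//.
rewrite -product_measure1E//; first last.
  rewrite (_ : [set t | _] = \bigcap_(i in [set: 'I_n])
      (fun t : n.-tuple (measurableTypeR R) => tnth t i) @^-1`
        A (lift ord0 i)).
    apply: fin_bigcap_measurable => // i _.
    by rewrite -[X in measurable X]setTI; exact: measurable_tnth.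
  by apply/seteqP; split => t /= Ht i => [_|]; exact: Ht.
rewrite /= /cons_measure /pushforward; congr (_ _).
apply/seteqP; split => [[x t]/= Ht|[x t]/= [xA Ht] i].
  split; first exact: (Ht ord0).
  by move=> i; have := Ht (lift ord0 i); rewrite tnthS.
have [j ->|->//] := unliftP ord0 i.
by rewrite tnthS; exact: Ht.
Qed.

Section lebesgue_cV.
Context (R : realType) (n : nat).

Definition col_of_tuple (t : n.-tuple R) : 'cV[R]_n := \col_i tnth t i.

Definition leb_outer (A : set 'cV[R]_n) : \bar R :=
  ((tuple_lebesgue R n)^*)%mu (col_of_tuple @^-1` A).

Let leb_outer0 : leb_outer set0 = 0%E.
Proof. by rewrite /leb_outer preimage_set0 outer_measure0. Qed.

Let leb_outer_ge0 A : (0 <= leb_outer A)%E.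
Proof. exact: outer_measure_ge0. Qed.

Let le_leb_outer : {homo leb_outer : A B / A `<=` B >-> (A <= B)%E}.
Proof. by move=> A B AB; apply: le_outer_measure => t; exact: AB. Qed.

Let leb_outer_sigma_subadditive : sigma_subadditive leb_outer.
Proof.
move=> F; rewrite /leb_outer preimage_bigcup.
exact: outer_measure_sigma_subadditive.
Qed.

HB.instance Definition _ := isOuterMeasure.Build R 'cV[R]_n leb_outer
  leb_outer0 leb_outer_ge0 le_leb_outer leb_outer_sigma_subadditive.

End lebesgue_cV.

(* R^n with the Lebesgue sigma-algebra *)
Notation eucl R n := (caratheodory_type (@leb_outer R n)).

Section leb.
Context (R : realType) (n : nat).

Definition leb : set (eucl R n) -> \bar R := @leb_outer R n.

Let leb0 : leb set0 = 0%E.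
Proof. exact: outer_measure0. Qed.

Let leb_ge0 A : (0 <= leb A)%E.
Proof. exact: outer_measure_ge0. Qed.

Let leb_sigma_additive : semi_sigma_additive leb.
Proof. exact: caratheodory_measure_sigma_additive. Qed.

HB.instance Definition _ := isMeasure.Build _ _ _ leb
  leb0 leb_ge0 leb_sigma_additive.

Lemma leb_box (a b : 'cV[R]_n) : (forall i, a i 0 <= b i 0) ->
  leb [set x | forall i, a i 0 <= x i 0 <= b i 0] =
  (\prod_i (b i 0 - a i 0))%:E.
Proof.
move=> ab; rewrite /leb /leb_outer.
rewrite (_ : _ @^-1` _ =
    [set t | forall i, [set` `[a i 0, b i 0]] (tnth t i)]); last first.
  apply/seteqP; split => t /= H i; have := H i;
    by rewrite mxE in_itv.
rewrite measurable_mu_extE; first last.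
  rewrite (_ : [set t | _] = \bigcap_(i in [set: 'I_n])
      (fun t : n.-tuple (measurableTypeR R) => tnth t i) @^-1`
        [set` `[a i 0, b i 0]]).
    apply: fin_bigcap_measurable => // i _.
    by rewrite -[X in measurable X]setTI; apply: measurable_tnth.
  by apply/seteqP; split => t /= H i => [_|]; exact: H.
apply: (etrans (@tuple_lebesgue_box R n (fun i => [set` `[a i 0, b i 0]]) _)).
  by move=> i; exact: measurable_itv.
rewrite -prodEFin; apply: eq_bigr => i _.
rewrite lebesgue_measure_itv/= lte_fin; case: ltP => //.
by move=> ba; rewrite (_ : b i 0 = a i 0) ?subrr//; apply/eqP; rewrite eq_le ba ab.
Qed.

End leb.

Section anisotropies.
Context (R : realType) (m n : nat).
Implicit Types (Omega U : set 'cV[R]_n) (C : 'cV[R]_n -> 'M[R]_(m, n)).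

Definition dot k (v w : 'cV[R]_k) : R := \sum_i v i 0 * w i 0.

(* A function on an open set is represented by a total function, of which only
   the values in that set matter.  An element of L^2 is represented by any
   function in its class: the notions below do not distinguish functions that
   are equal a.e. *)
Definition L2 U (u : 'cV[R]_n -> R) : Prop :=
  ((u \_ U : eucl R n -> R) \in Lfun (@leb R n) 2%:E).

Definition L2v k U (g : 'cV[R]_n -> 'cV[R]_k) : Prop :=
  forall i, L2 U (fun x => g x i 0).

Definition L2_cvg U (uh : nat -> 'cV[R]_n -> R) (u : 'cV[R]_n -> R) : Prop :=
  Lnorm (@leb R n) 2%:E (EFin \o ((uh h \- u) \_ U)) @[h --> \oo] --> 0%E.

Definition L2v_cvg k U (gh : nat -> 'cV[R]_n -> 'cV[R]_k)
    (g : 'cV[R]_n -> 'cV[R]_k) : Prop :=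
  forall i, L2_cvg U (fun h x => gh h x i 0) (fun x => g x i 0).

Definition lipschitz_in Omega C : Prop := exists K : R, K.-lipschitz_Omega C.

Definition partial (i : 'I_n) (f : 'cV[R]_n -> R) : 'cV[R]_n -> R :=
  'D_(delta_mx i 0) f.

Definition smooth (f : 'cV[R]_n -> R) : Prop :=
  forall s : seq 'I_n, continuous (foldr partial f s) /\
    forall i x, derivable (foldr partial f s) x (delta_mx i 0).

Definition test_function k U (phi : 'cV[R]_n -> 'cV[R]_k) : Prop :=
  (forall i, smooth (fun x => phi x i 0)) /\
  exists K, [/\ compact K, K `<=` U & forall x, ~ K x -> phi x = 0].

Definition divergence (V : 'cV[R]_n -> 'cV[R]_n) (x : 'cV[R]_n) : R :=
  \sum_i partial i (fun y => V y i 0) x.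

(* Xu(phi); the classical derivatives in the divergence of the Lipschitz field
   C^T phi exist a.e. *)
Definition Xdistr C U (u : 'cV[R]_n -> R) (phi : 'cV[R]_n -> 'cV[R]_m) : R :=
  - \int[@leb R n]_(x in U) (u x * divergence (fun y => (C y)^T *m phi y) x).

(* g represents the distribution Xu on U and belongs to L^2(U; R^m) *)
Definition is_Xgrad C U (u : 'cV[R]_n -> R) (g : 'cV[R]_n -> 'cV[R]_m) : Prop :=
  L2v U g /\ forall phi, test_function U phi ->
    Xdistr C U u phi = \int[@leb R n]_(x in U) dot (g x) (phi x).

Definition W12 C U (u : 'cV[R]_n -> R) : Prop :=
  L2 U u /\ exists g, is_Xgrad C U u g.

(* a representative of the X-gradient of u, for u in W12 C U *)
Definition Xgrad C U (u : 'cV[R]_n -> R) : 'cV[R]_n -> 'cV[R]_m :=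
  xget (fun=> 0) [set g | is_Xgrad C U u g].

Definition classE Omega (lambda Lambda : R) C
    (A : 'cV[R]_n -> 'M[R]_m) : Prop :=
  [/\ forall x, Omega x -> (A x)^T = A x,
      forall i j, measurable_fun (Omega : set (eucl R n)) (fun x => A x i j)
    & {ae @leb R n, forall x, Omega x -> forall xi : 'cV[R]_n,
        let v := C x *m xi in
        lambda * dot v v <= dot (A x *m v) v <= Lambda * dot v v}].

Definition classS1 Omega (Ch : nat -> 'cV[R]_n -> 'M[R]_(m, n)) C : Prop :=
  exists k : nat, [/\ (1 <= k <= m)%N,
    forall h (j : 'I_m) x, (j < k)%N -> Omega x ->
      row j (Ch h x) = row j (C x)
  & forall (j : 'I_m) x, (k <= j)%N -> Omega x -> row j (C x) = 0].

(* the norm of Lip(Omega, M(m, n)) is the sup norm plus the best Lipschitz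
   constant *)
Definition classS2 Omega (Ch : nat -> 'cV[R]_n -> 'M[R]_(m, n)) : Prop :=
  exists M : R, forall h,
    (forall x, Omega x -> `|Ch h x| <= M) /\ M.-lipschitz_Omega (Ch h).

Definition energy C (A : 'cV[R]_n -> 'M[R]_m) U (u : 'cV[R]_n -> R) : \bar R :=
  if `[< W12 C U u >] then
    (\int[@leb R n]_(x in U) (dot (A x *m Xgrad C U u x) (Xgrad C U u x))%:E)%E
  else +oo%E.

Definition recovery_sequence Omega (Fh : nat -> ('cV[R]_n -> R) -> \bar R)
    (F : ('cV[R]_n -> R) -> \bar R) u (uh : nat -> 'cV[R]_n -> R) : Prop :=
  [/\ forall h, L2 Omega (uh h), L2_cvg Omega uh u
    & (limn_esup (fun h => Fh h (uh h)) <= F u)%E].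

Definition Gamma_cvg Omega (Fh : nat -> ('cV[R]_n -> R) -> \bar R)
    (F : ('cV[R]_n -> R) -> \bar R) : Prop :=
  (forall u uh, L2 Omega u -> (forall h, L2 Omega (uh h)) ->
     L2_cvg Omega uh u -> (F u <= limn_einf (fun h => Fh h (uh h)))%E) /\
  (forall u, L2 Omega u -> exists uh, recovery_sequence Omega Fh F u uh).

End anisotropies.

(* Main.v *)
From HB Require Import structures.
Require Import Defs.
From mathcomp Require Import all_boot all_order all_algebra.
From mathcomp Require Import all_classical all_reals all_analysis.
From mathcomp Require Import measurable_realfun.
From mathcomp Require Import ring lra.
Import Order.TTheory GRing.Theory Num.Theory.
Import numFieldNormedType.Exports.
Set Implicit Arguments. Unset Strict Implicit. Unset Printing Implicit Defensive.
Local Open Scope classical_set_scope.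
Local Open Scope ring_scope.

(** The vector fields A^h X^h u_h are the momenta of the recovery sequence, and
    the theorem states that their pairings with fields in the ranges of the C^h
    converge. The idea is that the momentum is the first variation of the energy and
    that Gamma-convergence, as it holds on all open subsets, controls first
    variations.

    Fix an open box Q and a vector xi. The linear function w(x) = <xi, x> has
    the X^h-gradient C^h xi (is_Xgrad_linear). The liminf inequality for u_h + t w
    on the intersection of U with Q, the liminf inequality for u_h on U minus the
    closed box, and the limsup inequality for u_h on U give, up to errors that
    tend to zero,

      2 t <A^h X^h u_h, C^h xi> + O(t^2) >= 2 t <A X u, C xi>

    for the integrals over U and Q (energy_perturbed, first_variation_bound). As
    t has either sign and is arbitrarily small, the integrals over boxes of
    <A^h X^h u_h, C^h xi> converge (box_flux_cvg). These functions are bounded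
    in L^2, hence convergence on boxes is weak convergence in L^2
    (weak_cvg_boxes), and taking basis vectors for xi gives the theorem for the
    test fields C^h Phi with Phi fixed (flux_weak_cvg). For varying test
    fields, C^h (Phi_h - Phi) tends to zero strongly because C^h tends to C
    uniformly (flux_cvg).

    The ellipticity of A^h holds on the range of C^h only. All these estimates
    therefore rest on the fact that an X-gradient takes its values almost
    everywhere in the range of the coefficient matrix (is_Xgrad_range), which is
    not obvious since the rank of C may jump. It is proved by testing the
    distribution Xu against Lipschitz fields built from the regularized
    projections (I + T^2 C C^T)^-1; the key estimate is that the fields
    C^T (I + T^2 C C^T)^-1 e_j are Lipschitz uniformly in T, while they tend
    uniformly to zero (regT_close, regT_entry).

    Testing with Lipschitz instead of smooth fields (Xgrad_lip_test) takes the
    first parts: almost everywhere differentiability of Lipschitz functions on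
    lines, integration by parts, the weak convergence of the derivatives of
    uniformly Lipschitz functions that tend to zero (partial_weak_cvg0), and an
    explicit smooth approximation by interpolation on a grid. *)

(** * Differentiability of Lipschitz functions of one variable *)

Section lipschitz_line.
Context {R : realType}.
Local Notation mu := (@lebesgue_measure R).

Lemma stieltjes_ocitv (h : cumulative R R) (a b : R) : a <= b ->
  lebesgue_stieltjes_measure h `]a, b]%classic = (h b - h a)%:E.
Proof.
move=> ab; rewrite /lebesgue_stieltjes_measure /measure_extension.
rewrite measurable_mu_extE/=; last exact: is_ocitv.
by rewrite wlength_itv_bnd// EFinB.
Qed.

Lemma stieltjes_add (h1 h2 : cumulative R R) :
  (forall x, h1 x + h2 x = x) ->
  forall A, measurable A ->
    (lebesgue_stieltjes_measure h1 A <= mu A)%E.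
Proof.
move=> h12 A mA.
pose nu : {measure set (measurableTypeR R) -> \bar R} :=
  measure_add (lebesgue_stieltjes_measure h1) (lebesgue_stieltjes_measure h2).
have -> : mu A = nu A.
  apply: lebesgue_measure_unique => // X.
  move=> /ocitvP[->|[[a b] /= ab ->]]; first by rewrite !measure0.
  rewrite [LHS](stieltjes_ocitv idfun (ltW ab)).
  rewrite [RHS](_ : _ = lebesgue_stieltjes_measure h1 `]a, b]%classic +
    lebesgue_stieltjes_measure h2 `]a, b]%classic)%E; last exact: measure_addE.
  rewrite [X in (X + _)%E](stieltjes_ocitv h1 (ltW ab)) [X in (_ + X)%E](stieltjes_ocitv h2 (ltW ab)).
  rewrite -EFinD; congr EFin.
  by rewrite /= -[in LHS](h12 b) -[in LHS](h12 a); ring.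
rewrite [leRHS](_ : _ = lebesgue_stieltjes_measure h1 A +
  lebesgue_stieltjes_measure h2 A)%E; last exact: measure_addE.
by rewrite leeDl.
Qed.

(** The functions x/2 + f x and x/2 - f x are nondecreasing with sum x, so the
    Stieltjes measure of the first one is dominated by the Lebesgue measure. By
    the Radon-Nikodym theorem x/2 + f x is then an indefinite integral, to which
    the fundamental theorem of calculus applies. *)
Lemma half_lipschitz_derivable_itv (f : R -> R) (a b : R) :
  (forall x y, `|f x - f y| <= 2^-1 * `|x - y|) ->
  {ae mu, forall x, a < x < b -> derivable f x 1}.
Proof.
move=> fL.
have [ba|ab] := leP b a.
  by apply: aeW => x /andP[ax xb]; have := lt_trans ax xb; rewrite ltNge ba.
have ct (s : R) : continuous (fun x : R => 2^-1 * x + s * f x).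
  move=> x; apply: cvgD; first by apply: cvgM; [exact: cvg_cst|exact: cvg_id].
  apply: cvgM; first exact: cvg_cst.
  apply/cvgrPdist_le => e e0; near=> y.
  apply: le_trans (fL _ _) _.
  apply: (@le_trans _ _ `|x - y|); first by rewrite ler_piMl// invf_le1// ler1n.
  near: y; apply/nbhs_ballP; exists e => //= y.
  by rewrite /ball/= => /ltW.
have nd (s : R) : `|s| <= 1 -> {homo (fun x : R => 2^-1 * x + s * f x) : x y / x <= y}.
  move=> s1 x y xy; rewrite -subr_ge0.
  have -> : 2^-1 * y + s * f y - (2^-1 * x + s * f x) = 2^-1 * (y - x) + s * (f y - f x) by ring.
  have H : `|s * (f y - f x)| <= 2^-1 * (y - x).
    rewrite normrM; apply: le_trans (_ : `|f y - f x| <= _).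
      by rewrite ler_piMl.
    by apply: le_trans (fL _ _) _; rewrite ger0_norm// subr_ge0.
  by have := ler_norm (- (s * (f y - f x))); rewrite normrN => H'; lra.
pose h1 : cumulative R R := HB.pack (fun x : R => 2^-1 * x + 1 * f x)
  (isCumulative.Build R _ R (fun x : R => 2^-1 * x + 1 * f x)
    (nd 1 (eq_ind_r (fun z => z <= 1) (lexx 1) (normr1 R)))
    (right_continuousW (ct 1))).
pose h2 : cumulative R R := HB.pack (fun x : R => 2^-1 * x + -1 * f x)
  (isCumulative.Build R _ R (fun x : R => 2^-1 * x + -1 * f x)
    (nd (-1) (eq_ind_r (fun z => z <= 1) (lexx 1) (normrN1 R)))
    (right_continuousW (ct (-1)))).
have h12 x : h1 x + h2 x = x by rewrite /h1 /h2 /=; field.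
have mab : measurable (`]a, b]%classic : set (measurableTypeR R)) by exact: measurable_itv.
have fin1 : (lebesgue_stieltjes_measure h1 `]a, b]%classic < +oo)%E.
  by rewrite stieltjes_ocitv ?ltry// ltW.
(* restricted to a bounded interval, the Stieltjes measure is finite *)
pose nu : {finite_measure set (measurableTypeR R) -> \bar R} := mfrestr mab fin1.
have numu : nu `<< mu.
  apply/null_content_dominatesP => A mA A0.
  apply/eqP; rewrite eq_le measure_ge0 andbT -A0.
  rewrite /nu /= /mfrestr /mrestr.
  apply: le_trans (stieltjes_add h12 mA).
  by apply: le_measure; rewrite ?inE//; exact: measurableI.
have [g [g0 gfin gint gE]] := radon_nikodym_sigma_finite numu.
pose G x := fine (g x).
have GE : EFin \o G = g by apply/funext => x /=; rewrite /G fineK.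
have Gint : mu.-integrable setT (EFin \o G) by rewrite GE.
have Gi (A : set R) : measurable A -> mu.-integrable A (EFin \o G).
  by move=> mA; apply: integrableS Gint.
have := @FTC1 R G (BRight a) (fun y => Gi _ (measurable_itv _)) _.
have Gloc : locally_integrable [set: R] G.
  by have := integrable_locally measurableT Gint; rewrite patch_setT.
move=> /(_ Gloc); apply: filterS; first exact: (ae_filter_ringOfSetsType mu).
move=> x /= + /andP[ax xb].
have axE : (BRight a < BRight x)%O by rewrite bnd_simp.
move=> /(_ axE)[dF _].
set F := (X in derivable X x 1) in dF.
have FE : \forall y \near x, f y = F y + (h1 a - 2^-1 * y).
  near=> y.
  have ay : a < y by near: y; exact: lt_nbhsr.
  have yb : y < b by near: y; exact: lt_nbhsl.
  have -> : F y = h1 y - h1 a.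
    apply: EFin_inj; rewrite -(stieltjes_ocitv h1 (ltW ay)).
  rewrite /F /Rintegral fineK; last first.
      by apply: integrable_fin_num; [exact: measurable_itv|apply: Gi; exact: measurable_itv].
    have -> : (\int[mu]_(x0 in `]a, y]) (G x0)%:E = \int[mu]_(x0 in `]a, y]) g x0)%E.
      by apply: eq_integral => z _; rewrite -GE.
    rewrite -gE//.
    rewrite /nu /= /mfrestr /mrestr; congr (lebesgue_stieltjes_measure _ _).
    apply/seteqP; split => [z [] //|z]; rewrite /= !in_itv/= => /andP[-> zy].
    by split => //=; apply: le_trans zy (ltW yb).
  by rewrite /h1/=; ring.
have FE' : {near x, (fun y => F y + (h1 a - 2^-1 * y)) =1 f}.
  by apply: filterS FE => y ->.
apply: (near_eq_derivable FE').
apply: derivableD; first exact: dF.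
apply: derivableB; first exact: derivable_cst.
by apply: derivableM; [exact: derivable_cst|exact: derivable_id].
Unshelve. all: by end_near. Qed.

(** The Lipschitz constant 1/2 is reached by scaling, the whole line by a
    countable union of intervals. *)
Lemma lipschitz_derivable_ae (f : R -> R) (K : R) :
  (forall x y, `|f x - f y| <= K * `|x - y|) ->
  {ae mu, forall x, derivable f x 1}.
Proof.
move=> fL.
pose K' := (2 * (`|K| + 1)).
have K'0 : 0 < K' by rewrite /K' mulr_gt0// ltr_pwDr.
pose g x := K'^-1 * f x.
have gL x y : `|g x - g y| <= 2^-1 * `|x - y|.
  rewrite /g -mulrBr normrM gtr0_norm ?invr_gt0//.
  rewrite ler_pdivrMl//; apply: le_trans (fL _ _) _.
  rewrite mulrA ler_wpM2r//.
  by have := ler_norm K; rewrite /K'; lra.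
have H : {ae mu, forall x n, - n%:R < x < n%:R -> derivable g x 1}.
  by apply: ae_foralln => n; exact: half_lipschitz_derivable_itv.
apply: filterS H; first exact: (ae_filter_ringOfSetsType mu).
move=> x /= H.
have dg : derivable g x 1.
  apply: (H (Num.bound `|x|)); rewrite -ltr_norml.
  by rewrite (archi_boundP (normr_ge0 x)).
have -> : f = (fun y => K' * g y).
  by apply/funext => y; rewrite /g mulrA divff ?mul1r// gt_eqF.
by apply: derivableM => //; exact: derivable_cst.
Qed.

End lipschitz_line.

(** * Borel sets of columns *)

Lemma sigma_algebra_preim T1 T2 (f : T1 -> T2) (S : set (set T1)) :
  sigma_algebra setT S -> sigma_algebra setT [set C | S (f @^-1` C)].
Proof.
move=> [s0 sC sU]; split => /=.
- by rewrite preimage_set0.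
- by move=> B; rewrite !setTD => /sC; rewrite setTD preimage_setC.
- by move=> F HF; rewrite preimage_bigcup; exact: sU.
Qed.

Lemma entry_le_norm (R : realType) (p q : nat) (M : 'M[R]_(p, q)) i j :
  `|M i j| <= `|M|.
Proof.
rewrite [leRHS]mx_normrE.
exact: (le_bigmax_cond _ (fun ij : 'I_p * 'I_q => `|M ij.1 ij.2|) (j := (i, j))).
Qed.

Lemma norm_le_entries (R : realType) (p q : nat) (M : 'M[R]_(p, q)) (c : R) :
  0 <= c -> (forall i j, `|M i j| <= c) -> `|M| <= c.
Proof.
by move=> c0 Mc; rewrite [leLHS]mx_normrE; apply/bigmax_leP; split => // -[i j] _; exact: Mc.
Qed.

Section borel_columns.
Context {R : realType} {n : nat}.
Local Notation rT := (measurableTypeR R).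
Implicit Types (A U : set 'cV[R]_n).

(** Borel sets are described by tuples of coordinates, on which the Lebesgue
    measure of columns is defined before its completion. *)
Definition borel_col A : Prop :=
  measurable (@col_of_tuple R n @^-1` A : set (n.-tuple rT)).

Definition tuple_of_col (x : 'cV[R]_n) : n.-tuple R := [tuple x i 0 | i < n].

Lemma tuple_of_colK : cancel tuple_of_col (@col_of_tuple R n).
Proof. by move=> x; apply/colP => i; rewrite mxE tnth_mktuple. Qed.

Lemma col_of_tupleK : cancel (@col_of_tuple R n) tuple_of_col.
Proof. by move=> t; apply: eq_from_tnth => i; rewrite tnth_mktuple mxE. Qed.

Lemma borel_col_measurable A : borel_col A -> measurable (A : set (eucl R n)).
Proof.
move=> bA; suff : caratheodory_measurable (@leb_outer R n) A by [].
move=> X.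
refine (@sub_caratheodory _ (n.-tuple rT) R (tuple_lebesgue R n)
  (@col_of_tuple R n @^-1` A) _ (@col_of_tuple R n @^-1` X)).
by apply: sub_sigma_algebra; exact: bA.
Qed.

Lemma borel_col_leb A : borel_col A ->
  leb (A : set (eucl R n)) = tuple_lebesgue R n (@col_of_tuple R n @^-1` A).
Proof. by move=> bA; exact: measurable_mu_extE. Qed.

Lemma borel_colT : borel_col setT.
Proof. by rewrite /borel_col preimage_setT. Qed.

Lemma borel_col0 : borel_col set0.
Proof. by rewrite /borel_col preimage_set0. Qed.

Lemma borel_colC A : borel_col A -> borel_col (~` A).
Proof. by move=> bA; rewrite /borel_col preimage_setC; exact: measurableC. Qed.

Lemma borel_col_bigcup (F : nat -> set 'cV[R]_n) :
  (forall k, borel_col (F k)) -> borel_col (\bigcup_k F k).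
Proof.
by move=> bF; rewrite /borel_col preimage_bigcup; exact: bigcupT_measurable.
Qed.

Lemma borel_col_bigcap (F : nat -> set 'cV[R]_n) :
  (forall k, borel_col (F k)) -> borel_col (\bigcap_k F k).
Proof.
by move=> bF; rewrite /borel_col preimage_bigcap; exact: bigcapT_measurable.
Qed.

Lemma borel_colI A U : borel_col A -> borel_col U -> borel_col (A `&` U).
Proof. by move=> bA bU; rewrite /borel_col preimage_setI; exact: measurableI. Qed.

Lemma borel_colD A U : borel_col A -> borel_col U -> borel_col (A `\` U).
Proof. by move=> bA bU; rewrite setDE; apply: borel_colI => //; exact: borel_colC. Qed.

Lemma borel_col_coord (i : 'I_n) (B : set rT) : measurable B ->
  borel_col [set x | B (x i 0)].
Proof.
move=> mB; rewrite /borel_col (_ : _ @^-1` _ =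
    (fun t : n.-tuple rT => tnth t i) @^-1` B); last first.
  by apply/seteqP; split => t; rewrite /= mxE.
by have := @measurable_tnth _ rT n i measurableT B mB; rewrite setTI.
Qed.

Lemma borel_col_all (B : 'I_n -> set rT) : (forall i, measurable (B i)) ->
  borel_col [set x | forall i, B i (x i 0)].
Proof.
move=> mB; rewrite /borel_col.
rewrite (_ : _ @^-1` _ = \bigcap_(i in [set: 'I_n])
    (@col_of_tuple R n @^-1` [set x | B i (x i 0)])).
  by apply: fin_bigcap_measurable => // i _; exact: borel_col_coord.
by apply/seteqP; split => t H i => [_|]; apply: H.
Qed.

Definition obox (a b : 'cV[R]_n) : set 'cV[R]_n :=
  [set x | forall i, a i 0 < x i 0 < b i 0].

Lemma borel_col_obox a b : borel_col (obox a b).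
Proof.
have -> : obox a b = [set x | forall i, [set` `]a i 0, b i 0[] (x i 0)].
  by apply/seteqP; split => x /= H i; have := H i; rewrite in_itv.
apply: (@borel_col_all (fun i => [set` `]a i 0, b i 0[])) => i.
exact: measurable_itv.
Qed.

Lemma ball_obox (x : 'cV[R]_n) (e : R) :
  0 < e -> ball x e = obox (\col_i (x i 0 - e)) (\col_i (x i 0 + e)).
Proof.
move=> e0; apply/seteqP; split => y.
  move=> [_ H] i; have := H i 0; rewrite /ball/= !mxE ltr_distlC => /andP[H1 H2].
  by apply/andP; split; lra.
move=> H; split => // i j; rewrite (ord1 j); have /andP := H i; rewrite !mxE /ball/= ltr_distlC => -[H1 H2].
by apply/andP; split; lra.
Qed.

Lemma borel_col_open U : open U -> borel_col U.
Proof.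
move=> oU.
pose F (p : {ffun 'I_n -> rat} * nat) : set 'cV[R]_n :=
  let: q := \col_i (ratr (p.1 i) : R) in let: e := p.2.+1%:R^-1 in
  if `[< ball q e `<=` U >] then ball q e else set0.
have -> : U = \bigcup_k (if unpickle k is Some p then F p else set0).
  apply/seteqP; split => [x Ux|x [k _]]; last first.
    case: (unpickle k) => // p; rewrite /F; case: ifPn => // /asboolP; exact.
  have /nbhs_ballP[e /= e0 eU] : nbhs x U by apply: open_nbhs_nbhs.
  have [k ke] : exists k, k.+1%:R^-1 < e / 2.
    have [k _ /(_ k (leqnn k))] := near_infty_natSinv_lt (PosNum (divr_gt0 e0 (ltr0n _ 2))).
    by exists k.
  have k0 : 0 < k.+1%:R^-1 :> R by rewrite invr_gt0.
  have Hq i : exists q : rat, x i 0 - k.+1%:R^-1 < ratr q < x i 0 + k.+1%:R^-1.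
    have := @rat_in_itvoo R (x i 0 - k.+1%:R^-1) (x i 0 + k.+1%:R^-1).
    case; first by rewrite ltrBlDr -addrA ltrDl addr_gt0.
    by move=> q; rewrite in_itv/=; exists q.
  have [q qP] := choice Hq.
  exists (pickle ([ffun i => q i], k)) => //; rewrite pickleK /F /=.
  have xq : ball (\col_i (ratr ([ffun i => q i] i) : R)) k.+1%:R^-1 x.
    split => // i j; rewrite (ord1 j) /ball/= mxE ffunE ltr_distlC.
    by rewrite -ltr_distlC distrC ltr_distlC; exact: qP.
  rewrite ifT//; apply/asboolP => y qy; apply: eU.
  rewrite (splitr e); apply: (@ball_triangle _ _ (\col_i (ratr ([ffun i => q i] i) : R))).
    by apply: ball_sym; apply: le_ball xq; exact: ltW.
  by apply: le_ball qy; exact: ltW.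
apply: borel_col_bigcup => k; case: (unpickle k) => [p|]; last first.
  exact: borel_col0.
rewrite /F; case: ifPn => _; last exact: borel_col0.
by rewrite ball_obox ?invr_gt0//; exact: borel_col_obox.
Qed.

Lemma open_leb_measurable U : open U -> measurable (U : set (eucl R n)).
Proof. by move=> /borel_col_open/borel_col_measurable. Qed.

(** The outer measure is an infimum over countable Borel covers, and it is
    attained by intersecting the members of a minimizing sequence. *)
Lemma borel_hull A : (leb (A : set (eucl R n)) < +oo)%E ->
  exists G, [/\ borel_col G, A `<=` G & leb (G : set (eucl R n)) = leb (A : set (eucl R n))].
Proof.
move=> Aoo.
have fA : leb (A : set (eucl R n)) \is a fin_num by rewrite ge0_fin_numE.
have cov (k : nat) : exists G, [/\ borel_col G, A `<=` G &
    (leb (G : set (eucl R n)) <= leb (A : set (eucl R n)) + k.+1%:R^-1%:E)%E].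
  have k0 : (0 < k.+1%:R^-1 :> R)%R by rewrite invr_gt0.
  have := lb_ereal_inf_adherent k0 fA.
  move=> [_ [/= B [mB AB] <-] Bk].
  exists (@tuple_of_col @^-1` (\bigcup_k B k)); split.
  - rewrite /borel_col -comp_preimage (_ : _ \o _ = id); last first.
      by apply/funext => t /=; rewrite col_of_tupleK.
    by rewrite preimage_id; exact: bigcupT_measurable.
  - move=> x Ax; apply: AB; by rewrite /= tuple_of_colK.
  - apply: le_trans (ltW Bk).
    rewrite /leb /leb_outer -comp_preimage (_ : _ \o _ = id); last first.
      by apply/funext => t /=; rewrite col_of_tupleK.
    rewrite preimage_id.
    apply: le_trans (outer_measure_sigma_subadditive _ _) _.
    by apply: lee_nneseries => // i _;
      rewrite [leLHS](@measurable_mu_extE _ _ _ (tuple_lebesgue R n) _ (mB i)).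
have [G GP] := choice cov.
exists (\bigcap_k G k); split.
- by apply: borel_col_bigcap => k; have [] := GP k.
- by move=> x Ax k _; have [_ + _] := GP k; apply.
- apply/eqP; rewrite eq_le; apply/andP; split; last first.
    by apply: le_outer_measure => x Ax k _; have [_ + _] := GP k; apply.
  apply/lee_addgt0Pr => e e0.
  have [k _ /(_ k (leqnn k)) ke] := near_infty_natSinv_lt (PosNum e0).
  have [_ _ H] := GP k.
  apply: le_trans (le_trans H _).
    by apply: le_outer_measure; exact: bigcap_inf.
  by rewrite leeD2l// lee_fin ltW.
Qed.

Lemma bounded_leb_lty A : bounded_set A -> (leb (A : set (eucl R n)) < +oo)%E.
Proof.
move=> [M [_ MA]].
have {}MA := MA (`|M| + 1); set N := `|M| + 1 in MA.
have N0 : 0 <= N by rewrite /N addr_ge0.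
have AN x : A x -> forall i, (const_mx (- N) : 'cV[R]_n) i 0 <= x i 0 <= (const_mx N : 'cV[R]_n) i 0.
  move=> Ax i; rewrite !mxE -ler_norml.
  apply: le_trans (MA _ x Ax); last by rewrite /N ltr_pwDr// ler_norm.
  exact: entry_le_norm.
apply: (@le_lt_trans _ _ (leb ([set x | forall i, (const_mx (- N) : 'cV[R]_n) i 0 <= x i 0 <= (const_mx N : 'cV[R]_n) i 0] : set (eucl R n)))).
  by apply: le_outer_measure => x Ax; exact: AN.
by rewrite leb_box ?ltry// => i; rewrite !mxE ge0_cp.
Qed.

(** Dynkin's theorem: boxes are closed under intersection and generate the
    Borel sets. *)
Lemma borel_col_induction (H : set (set 'cV[R]_n)) :
  lambda_system setT H -> (forall a b, H (obox a b)) ->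
  forall A, borel_col A -> H A.
Proof.
move=> lH Hb.
pose G := [set B : set 'cV[R]_n | exists a b, B = obox a b].
have GI : setI_closed G.
  move=> _ _ [a [b ->]] [c [d ->]].
  exists (\col_i Num.max (a i 0) (c i 0)), (\col_i Num.min (b i 0) (d i 0)).
  apply/seteqP; split => x.
    move=> [H1 H2] i; have /andP[? ?] := H1 i; have /andP[? ?] := H2 i.
    by rewrite !mxE gt_max lt_min; apply/andP; split; apply/andP.
  move=> H1; split=> i; have := H1 i; rewrite !mxE gt_max lt_min;
    by move=> /andP[/andP[? ?] /andP[? ?]]; apply/andP.
have sub : <<s G >> `<=` H.
  apply: (lambda_system_subset GI lH); first by move=> _ [a [b ->]].
  by move=> X _ x.
move=> A bA; apply: sub.
suff : forall B : set (n.-tuple rT), measurable B -> <<s G >> (@tuple_of_col @^-1` B).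
  move=> /(_ _ bA); rewrite -comp_preimage (_ : _ \o _ = id) ?preimage_id//.
  by apply/funext => x /=; rewrite tuple_of_colK.
have sG : sigma_algebra setT (<<s G >>) by exact: smallest_sigma_algebra.
move=> B mB; move: B mB.
apply: smallest_sub; first exact: (sigma_algebra_preim tuple_of_col sG).
move=> B; rewrite -bigcup_seq/= => -[i _ [C mC <-]].
rewrite setTI; move: C mC; apply: smallest_sub.
  exact: (sigma_algebra_preim (fun x => tnth (tuple_of_col x) i) sG).
move=> C [[a b] _ <-] /=.
(* a half-open slab is the intersection of the unions of the boxes that
   exceed it by 1/(k+1) in the direction i and exhaust the others *)
pose al (N : nat) : 'cV[R]_n := \col_j (if j == i then a else - N%:R).
pose be (N k : nat) : 'cV[R]_n := \col_j (if j == i then b + k.+1%:R^-1 else N%:R).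
have -> : tuple_of_col @^-1` ((@tnth n R)^~ i @^-1` `]a, b]) =
    \bigcap_k (\bigcup_N obox (al N) (be N k)).
  apply/seteqP; split => x.
    rewrite /= tnth_mktuple in_itv/= => /andP[ax xb] k _.
    exists (Num.bound `|x|) => // j; rewrite !mxE; case: eqP => [->|_].
      by rewrite ax (le_lt_trans xb)// ltrDl invr_gt0.
    rewrite -ltr_norml; apply: le_lt_trans (archi_boundP (normr_ge0 x)).
    exact: entry_le_norm.
  move=> Hx; rewrite /= tnth_mktuple in_itv/=; apply/andP; split.
    by have [N _ /(_ i)] := Hx 0%N I; rewrite !mxE eqxx => /andP[].
  apply/ler_addgt0Pr => e e0.
  have [k _ /(_ k (leqnn k)) ke] := near_infty_natSinv_lt (PosNum e0).
  have [N _ /(_ i)] := Hx k I; rewrite !mxE eqxx => /andP[_ /ltW/le_trans]; apply.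
  by rewrite lerD2l ltW.
have [s0 sC sU] := sG.
have sM : forall F : nat -> set 'cV[R]_n, (forall k, <<s G >> (F k)) -> <<s G >> (\bigcap_k F k).
  move=> F HF; rewrite -[X in <<s _ >> X]setCK setC_bigcap -setTD.
  by apply: (sC); apply: (sU) => k; rewrite -setTD; exact: sC.
apply: sM => k; apply: (sU) => N; apply: sub_sigma_algebra.
by exists (al N), (be N k).
Qed.

End borel_columns.

(** * Translations and lines *)

Section lebesgue_line_translation.
Context {R : realType}.
Local Notation mu := (@lebesgue_measure R).

Lemma measurable_shift (a : R) :
  measurable_fun [set: measurableTypeR R] ((fun x => x + a) : _ -> measurableTypeR R).
Proof.
by apply: measurable_funD; [exact: measurable_id|exact: measurable_cst].
Qed.

Lemma lebesgue_measure_shift (a : R) (A : set (measurableTypeR R)) :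
  measurable A -> mu ((fun x => x + a) @^-1` A) = mu A.
Proof.
move=> mA.
pose nu : {measure set (measurableTypeR R) -> \bar R} :=
  measure_function_pushforward__canonical__measure_function_Measure
    mu (measurable_shift a).
rewrite [RHS](_ : _ = nu A)//.
apply: lebesgue_measure_unique => // X /ocitvP[->|[[b c] /= bc ->]].
  by rewrite !measure0.
rewrite [RHS](_ : _ = mu `]b - a, c - a]%classic).
  rewrite !lebesgue_measure_itv/= !lte_fin ltrD2r bc -!EFinB.
  by congr EFin; ring.
rewrite /nu/= /pushforward; congr (mu _).
by apply/seteqP; split => x; rewrite /= !in_itv/= ltrBlDr lerBrDr.
Qed.

Lemma integral_shift (a : R) (f : measurableTypeR R -> \bar R) :
  measurable_fun setT f -> (forall x, 0 <= f x)%E ->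
  (\int[mu]_x f (x + a)%R = \int[mu]_x f x)%E.
Proof.
move=> mf f0.
pose nu : {measure set (measurableTypeR R) -> \bar R} :=
  measure_function_pushforward__canonical__measure_function_Measure
    mu (measurable_shift a).
transitivity (\int[nu]_x f x)%E.
  by apply/esym; apply: (ge0_integral_pushforward (measurable_shift a)).
by apply: eq_measure_integral => A mA _; exact: lebesgue_measure_shift.
Qed.

End lebesgue_line_translation.

Section tuple_lebesgue_theory.
Context {R : realType}.
Local Notation rT := (measurableTypeR R).

Definition tshift n (a : 'I_n -> R) (t : n.-tuple rT) : n.-tuple rT :=
  [tuple tnth t i + a i | i < n].

Lemma measurable_tshift n (a : 'I_n -> R) : measurable_fun setT (tshift a).
Proof.
apply/measurable_fun_tnthP => i.
have -> : (tnth (T:=rT))^~ i \o tshift a = (fun x => x + a i) \o (fun t => tnth t i).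
  by apply/funext => t /=; rewrite tnth_mktuple.
apply: (measurableT_comp (measurable_shift (a i))); exact: measurable_tnth.
Qed.

Lemma tuple_lebesgueS n (B : set (n.+1.-tuple rT)) :
  tuple_lebesgue R n.+1 B =
  (\int[@lebesgue_measure R]_x tuple_lebesgue R n (xsection (@tcons R n @^-1` B) x))%E.
Proof. by []. Qed.

Lemma measurable_tcons_preimage n (B : set (n.+1.-tuple rT)) :
  measurable B -> measurable (@tcons R n @^-1` B).
Proof. by move=> mB; have := @measurable_tcons R n measurableT B mB; rewrite setTI. Qed.

Lemma tuple_lebesgue_shift n (a : 'I_n -> R) (B : set (n.-tuple rT)) :
  measurable B -> tuple_lebesgue R n (tshift a @^-1` B) = tuple_lebesgue R n B.
Proof.
elim: n a B => [|n IHn] a B mB.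
  congr (tuple_lebesgue R 0 _); apply/seteqP; split => t; rewrite /=;
    by rewrite (tuple0 t) (tuple0 (tshift _ _)).
rewrite !tuple_lebesgueS.
pose a' i := a (lift ord0 i).
have mB' := measurable_tcons_preimage mB.
transitivity (\int[@lebesgue_measure R]_x
    tuple_lebesgue R n (xsection (@tcons R n @^-1` B) (x + a ord0)%R))%E; last first.
  apply: (@integral_shift R (a ord0) (fun x => tuple_lebesgue R n (xsection (@tcons R n @^-1` B) x))) => //.
  exact: (measurable_fun_xsection (tuple_lebesgue R n) mB').
apply: eq_integral => x _.
rewrite -[RHS](IHn a'); last exact: measurable_xsection.
congr (tuple_lebesgue R n _); apply/seteqP; split => t;
  rewrite /= /xsection/= !inE/=.
  suff -> : tshift a (tcons (x, t)) = tcons (x + a ord0, tshift a' t) by [].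
  apply: eq_from_tnth => i; rewrite tnth_mktuple.
  by have [j ->|->//] := unliftP ord0 i; rewrite !tnthS tnth_mktuple.
suff -> : tshift a (tcons (x, t)) = tcons (x + a ord0, tshift a' t) by [].
apply: eq_from_tnth => i; rewrite tnth_mktuple.
by have [j ->|->//] := unliftP ord0 i; rewrite !tnthS tnth_mktuple.
Qed.

Definition tupd n (i : 'I_n) (t : n.-tuple rT) (s : rT) : n.-tuple rT :=
  [tuple if j == i then s else tnth t j | j < n].

Lemma tupd_tcons n (i : 'I_n.+1) (j : 'I_n) x (t : n.-tuple rT) s :
  i = lift ord0 j -> tcons (x, tupd j t s) = tupd i (tcons (x, t)) s.
Proof.
move=> ->; apply: eq_from_tnth => k; rewrite tnth_mktuple.
have [l ->|->] := unliftP ord0 k.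
  by rewrite !tnthS tnth_mktuple (inj_eq lift_inj).
by rewrite (negbTE (neq_lift _ _)).
Qed.

(** Fubini's theorem, applied to the coordinate i; the induction brings i to the
    head of the tuple. *)
Lemma tuple_lebesgue_lines n (i : 'I_n) (B : set (n.-tuple rT)) :
  measurable B ->
  (forall t, lebesgue_measure [set s | B (tupd i t s)] = 0%E) ->
  tuple_lebesgue R n B = 0%E.
Proof.
elim: n i B => [[]//|n IHn] i B mB B0.
have mB' := measurable_tcons_preimage mB.
have [j ij|i0] := unliftP ord0 i.
  rewrite tuple_lebesgueS; apply: integral0_eq => x _.
  apply: (IHn j); first exact: measurable_xsection.
  move=> t; rewrite -[RHS](B0 (tcons (x, t))); congr (lebesgue_measure _).
  apply/seteqP; split => s; rewrite /= /xsection/= inE/=.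
    suff -> : tcons (x, tupd j t s) = tupd i (tcons (x, t)) s by [].
    exact: tupd_tcons.
  suff -> : tcons (x, tupd j t s) = tupd i (tcons (x, t)) s by [].
  exact: tupd_tcons.
have -> : tuple_lebesgue R n.+1 B =
    (\int[tuple_lebesgue R n]_y lebesgue_measure (ysection (@tcons R n @^-1` B) y))%E.
  rewrite tuple_lebesgueS.
  have := indic_fubini_tonelli (@lebesgue_measure R) (tuple_lebesgue R n) mB'.
  by rewrite indic_fubini_tonelli_FE// indic_fubini_tonelli_GE.
apply: integral0_eq => y _.
rewrite -[RHS](B0 (tcons (0, y))); congr (lebesgue_measure _).
have E s : tcons (s, y) = tupd i (tcons (0, y)) s.
  apply: eq_from_tnth => k; rewrite tnth_mktuple i0.
  have [l ->|->] := unliftP ord0 k; last by rewrite eqxx.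
  by rewrite eq_sym (negbTE (neq_lift _ _)) !tnthS.
apply/seteqP; split => s; rewrite /= /ysection/= inE/=.
  by rewrite (E s).
by rewrite (E s).
Qed.

End tuple_lebesgue_theory.

Section column_lebesgue.
Context {R : realType} {n : nat}.
Local Notation rT := (measurableTypeR R).
Implicit Types (A : set 'cV[R]_n) (a : 'cV[R]_n).

(** Translation maps the covers of A to covers of its translate. *)
Let shift_le A a :
  (leb ((fun x => (x + a)%R) @^-1` A : set (eucl R n)) <= leb (A : set (eucl R n)))%E.
Proof.
apply: le_ereal_inf_tmp => _ /= [F [mF AF] <-]; pose a' i := a i 0.
apply: (@le_trans _ _ (\sum_(k <oo) tuple_lebesgue R n (tshift a' @^-1` F k))%E).
  apply: ereal_inf_lbound; exists (fun k => tshift a' @^-1` F k) => //; split.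
    by move=> k; have := measurable_tshift a' measurableT (mF k); rewrite setTI.
  move=> t /= At; apply: AF; rewrite /=.
  suff -> : col_of_tuple (tshift a' t) = col_of_tuple t + a by [].
  by apply/colP => i; rewrite !mxE tnth_mktuple.
by apply: lee_nneseries => // k _; rewrite tuple_lebesgue_shift.
Qed.

Lemma leb_shift A a :
  leb ((fun x => (x + a)%R) @^-1` A : set (eucl R n)) = leb (A : set (eucl R n)).
Proof.
apply/eqP; rewrite eq_le shift_le/=.
have := shift_le ((fun x => x + a) @^-1` A) (- a).
rewrite -comp_preimage (_ : _ \o _ = id) ?preimage_id//.
by apply/funext => x /=; rewrite subrK.
Qed.

Lemma measurable_shift_preimage A a :
  measurable (A : set (eucl R n)) ->
  measurable ((fun x => (x + a)%R) @^-1` A : set (eucl R n)).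
Proof.
move=> mA; suff : caratheodory_measurable (@leb_outer R n) ((fun x => (x + a)%R) @^-1` A) by [].
move=> X.
have mA' : caratheodory_measurable (@leb_outer R n) A by exact: mA.
pose Y := (fun x => x - a) @^-1` X.
have XY : X = (fun x => x + a) @^-1` Y.
  rewrite /Y -comp_preimage (_ : _ \o _ = id) ?preimage_id//.
  by apply/funext => x /=; rewrite addrK.
have H : forall B, leb_outer ((fun x => (x + a)%R) @^-1` B) = leb_outer B := fun B => leb_shift B a.
by rewrite XY preimage_setC -!preimage_setI !H.
Qed.

Lemma measurable_fun_shift a :
  measurable_fun setT ((fun x => x + a) : eucl R n -> eucl R n).
Proof. by move=> _ B mB; rewrite setTI; exact: measurable_shift_preimage. Qed.

Lemma leb_lines (i : 'I_n) A : borel_col A ->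
  (forall x, @lebesgue_measure R [set s | A (x + s *: delta_mx i 0)] = 0%E) ->
  leb (A : set (eucl R n)) = 0%E.
Proof.
move=> bA A0; rewrite borel_col_leb//; apply: (@tuple_lebesgue_lines _ _ i) => // t.
rewrite -[RHS](A0 (col_of_tuple (tupd i t 0))); congr (lebesgue_measure _).
have E s : col_of_tuple (tupd i t s) = col_of_tuple (tupd i t 0) + s *: delta_mx i 0.
  apply/colP => k; rewrite !mxE !tnth_mktuple eqxx andbT.
  by case: eqP => _; rewrite ?mulr1 ?add0r ?mulr0 ?addr0.
by apply/seteqP; split => s; rewrite /= (E s).
Qed.

Lemma leb_hyperplane (i : 'I_n) (c : R) :
  leb ([set x | x i 0 = c] : set (eucl R n)) = 0%E.
Proof.
apply: (@leb_lines i).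
  by apply: (@borel_col_coord _ _ i [set c]); exact: measurable_set1.
move=> x; rewrite (_ : [set s | _] = [set c - x i 0]) ?lebesgue_measure_set1//.
apply/seteqP; split => s; rewrite /= !mxE !eqxx mulr1.
  by move=> <-; rewrite addrC addrK.
by move=> ->; rewrite addrC subrK.
Qed.

End column_lebesgue.

(** * Square integrable functions *)

Lemma restrict_indicE (T : Type) (R : realType) (E : set T) (f : T -> R) x : (f \_ E) x = f x * \1_E x.
Proof.
rewrite patchE indicE; case: (_ \in _) => /=; first by rewrite mulr1.
by rewrite mulr0.
Qed.

Section square_integrable.
Context {d : measure_display} {T : measurableType d} {R : realType}.
Variable mu : {measure set T -> \bar R}.
Implicit Types (D E : set T) (f g h : T -> R).

Definition rint D f := mu.-integrable D (EFin \o f).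

Lemma rint_measurable D f : rint D f -> measurable_fun D f.
Proof. by move=> /measurable_int/measurable_EFinP. Qed.

Lemma rint_le D f g : measurable D -> measurable_fun D f ->
  (forall x, D x -> `|f x| <= g x) -> rint D g -> rint D f.
Proof.
move=> mD mf fg ig; have mf' : measurable_fun D (EFin \o f) by exact/measurable_EFinP.
apply: (le_integrable mD mf' _ ig) => x Dx /=.
by rewrite lee_fin (le_trans (fg x Dx))// ler_norm.
Qed.

Lemma eq_rint D f g : measurable D -> (forall x, D x -> f x = g x) -> rint D f -> rint D g.
Proof.
by move=> mD fg; apply: eq_integrable => // x; rewrite inE => Dx /=; rewrite fg.
Qed.

Lemma rintD D f g : measurable D -> rint D f -> rint D g ->
  rint D (fun x => f x + g x).
Proof.
by move=> mD fi gi; apply: eq_integrable (integrableD mD fi gi) => // x _; rewrite /= EFinD.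
Qed.

Lemma rintZ D c f : measurable D -> rint D f -> rint D (fun x => c * f x).
Proof.
by move=> mD fi; apply: eq_integrable (integrableZl mD c fi) => // x _; rewrite /= EFinM.
Qed.

Lemma rintB D f g : measurable D -> rint D f -> rint D g ->
  rint D (fun x => f x - g x).
Proof.
by move=> mD fi gi; apply: eq_integrable (integrableB mD fi gi) => // x _; rewrite /= EFinB.
Qed.

Lemma ae_imply (P Q : T -> Prop) :
  (forall x, P x -> Q x) -> {ae mu, forall x, P x} -> {ae mu, forall x, Q x}.
Proof.
by move=> PQ; exact: (@filterS _ _ (ae_filter_ringOfSetsType mu) _ _ PQ).
Qed.

Lemma ae_and (P Q : T -> Prop) :
  {ae mu, forall x, P x} -> {ae mu, forall x, Q x} ->
  {ae mu, forall x, P x /\ Q x}.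
Proof.
by move=> aP aQ; exact: (@filterI _ _ (ae_filter_ringOfSetsType mu) _ _ aP aQ).
Qed.

Lemma Rint_ae_eq D f g : measurable D -> measurable_fun D f ->
  measurable_fun D g -> {ae mu, forall x, D x -> f x = g x} ->
  \int[mu]_(x in D) f x = \int[mu]_(x in D) g x.
Proof.
move=> mD mf mg fg; congr fine; apply: ae_eq_integral => //;
  [exact/measurable_EFinP|exact/measurable_EFinP|].
by apply: ae_imply fg => x + Dx => ->.
Qed.

Lemma rint_ae_le D f g : measurable D -> measurable_fun D f ->
  {ae mu, forall x, D x -> `|f x| <= g x} -> rint D g -> rint D f.
Proof.
move=> mD mf fg ig.
apply/integrableP; split; first exact/measurable_EFinP.
have /integrableP[mg goo] := ig; apply: le_lt_trans goo.
apply: ae_ge0_le_integral => //.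
- by apply: measurableT_comp => //; exact/measurable_EFinP.
- exact: measurableT_comp.
- by apply: ae_imply fg => x H Dx /=; rewrite lee_fin (le_trans (H Dx))// ler_norm.
Qed.

Lemma le_Rint_ae D f g : measurable D -> rint D f -> rint D g ->
  {ae mu, forall x, D x -> f x <= g x} ->
  \int[mu]_(x in D) f x <= \int[mu]_(x in D) g x.
Proof.
move=> mD fi gi fg.
have mf := rint_measurable fi; have mg := rint_measurable gi.
have mm : measurable_fun D (fun x => Num.min (f x) (g x)) by exact: measurable_minr.
have im : rint D (fun x => Num.min (f x) (g x)).
  apply: (@rint_ae_le _ _ (fun x => `|f x|)) => //; last exact: integrable_norm.
  apply: ae_imply fg => x H Dx; have /min_idPl -> := H Dx; exact: lexx.
rewrite (@Rint_ae_eq D f (fun x => Num.min (f x) (g x)))//; last first.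
  by apply: ae_imply fg => x H Dx; have /min_idPl := H Dx.
by apply: le_Rintegral => // x _; rewrite ge_min lexx orbT.
Qed.

Lemma Rint_dct D (f_ : nat -> T -> R) f g : measurable D ->
  (forall k, measurable_fun D (f_ k)) -> measurable_fun D f -> rint D g ->
  {ae mu, forall x, D x -> f_ k x @[k --> \oo] --> f x} ->
  {ae mu, forall x, forall k, D x -> `|f_ k x| <= g x} ->
  rint D f /\
  \int[mu]_(x in D) f_ k x @[k --> \oo] --> \int[mu]_(x in D) f x.
Proof.
move=> mD mf_ mf ig cvf bf.
have mf_' k : measurable_fun D (EFin \o f_ k) by exact/measurable_EFinP.
have mf' : measurable_fun D (EFin \o f) by exact/measurable_EFinP.
have c1 : {ae mu, forall x, D x -> (EFin \o f_ k) x @[k --> \oo] --> (EFin \o f) x}.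
  by apply: ae_imply cvf => x H Dx; apply: cvg_EFin; [near=> k|exact: H].
have c2 : {ae mu, forall x, forall k, D x -> (`|(EFin \o f_ k) x| <= (EFin \o g) x)%E}.
  by apply: ae_imply bf => x H k Dx; rewrite /= lee_fin; exact: H.
have [H1 _ H2] := dominated_convergence mD mf_' mf' c1 ig c2.
split; first exact: H1.
by apply: fine_cvg; rewrite fineK; [exact: H2|exact: integrable_fin_num].
Unshelve. all: by end_near. Qed.

(** An unbundled form of the membership in L^2 of D, on which restrictions and
    products are computed without extending f by zero. *)
Definition sqint D f := measurable_fun D f /\ rint D (fun x => f x ^+ 2).

Lemma eq_sqint D f g : measurable D -> (forall x, D x -> f x = g x) -> sqint D f -> sqint D g.
Proof.
move=> mD fg [mf i2]; split.
  by apply: eq_measurable_fun mf => x; rewrite inE => Dx; rewrite fg.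
by apply: (eq_rint mD _ i2) => x Dx; rewrite fg.
Qed.

Lemma sqintS D E f : measurable D -> measurable E -> E `<=` D ->
  sqint D f -> sqint E f.
Proof.
by move=> mD mE ED [mf i2]; split; [exact: measurable_funS mf|exact: integrableS i2].
Qed.

Lemma sqint_le D f g : measurable D -> measurable_fun D f ->
  {ae mu, forall x, D x -> `|f x| <= `|g x|} -> sqint D g -> sqint D f.
Proof.
move=> mD mf fg [mg i2]; split => //.
apply: (rint_ae_le mD _ _ i2); first exact: measurable_funX.
apply: ae_imply fg => x H Dx.
by rewrite normrX -[leRHS]real_normK ?num_real// lerXn2r ?nnegrE// H.
Qed.

Lemma sqintM_rint D f g : measurable D -> sqint D f -> sqint D g ->
  rint D (fun x => f x * g x).
Proof.
move=> mD [mf fi] [mg gi].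
apply: (@rint_le _ _ (fun x => f x ^+ 2 + g x ^+ 2)) => //.
- exact: measurable_funM.
- move=> x _; rewrite normrM -(real_normK (num_real (f x))) -(real_normK (num_real (g x))).
  have := sqr_ge0 (`|f x| - `|g x|); have := sqr_ge0 `|f x|; have := sqr_ge0 `|g x|.
  nra.
- exact: rintD.
Qed.

Lemma sqintZ D c f : measurable D -> sqint D f -> sqint D (fun x => c * f x).
Proof.
move=> mD [mf fi]; split.
  by apply: measurable_funM => //; exact: measurable_cst.
apply: (@eq_rint _ (fun x => c ^+ 2 * f x ^+ 2)) => //; first by move=> x _; rewrite exprMn.
exact: rintZ.
Qed.

Lemma sqintD D f g : measurable D -> sqint D f -> sqint D g ->
  sqint D (fun x => f x + g x).
Proof.
move=> mD sf sg; have [mf fi] := sf; have [mg gi] := sg; split.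
  exact: measurable_funD.
apply: (@eq_rint _ (fun x => (f x ^+ 2 + 2 * (f x * g x)) + g x ^+ 2)) => //.
  by move=> x _; ring.
apply: rintD => //; apply: rintD => //; apply: rintZ => //.
exact: sqintM_rint.
Qed.

Lemma sqintB D f g : measurable D -> sqint D f -> sqint D g ->
  sqint D (fun x => f x - g x).
Proof.
move=> mD sf sg; apply: (@eq_sqint _ (fun x => f x + -1 * g x)) => //.
  by move=> x _; rewrite mulN1r.
by apply: sqintD => //; exact: sqintZ.
Qed.

Lemma sqint0 D : measurable D -> sqint D (cst 0).
Proof.
move=> mD; split; first exact: measurable_cst.
by apply: (@eq_rint _ (cst 0)); [by []|move=> x _; rewrite /= expr0n|exact: integrable0].
Qed.

Lemma sqint_sum D I (s : seq I) (F : I -> T -> R) : measurable D ->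
  (forall i, sqint D (F i)) -> sqint D (fun x => \sum_(i <- s) F i x).
Proof.
move=> mD sF; elim: s => [|i s IHs].
  by apply: (eq_sqint mD _ (sqint0 mD)) => x _; rewrite big_nil.
by apply: (eq_sqint mD _ (sqintD mD (sF i) IHs)) => x _; rewrite big_cons.
Qed.

Lemma sqint_bounded D f (M : R) : measurable D -> (mu D < +oo)%E ->
  measurable_fun D f -> (forall x, D x -> `|f x| <= M) -> sqint D f.
Proof.
move=> mD Doo mf fM; split => //.
apply: measurable_bounded_integrable => //; first exact: measurable_funX.
exists (M ^+ 2); split; first exact: num_real.
move=> r Mr x Dx; apply: le_trans (ltW Mr).
by rewrite normrX lerXn2r ?nnegrE ?fM// (le_trans _ (fM x Dx)).
Qed.

Lemma sqint_ae_bounded D f (M : R) : measurable D -> (mu D < +oo)%E ->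
  measurable_fun D f -> {ae mu, forall x, D x -> `|f x| <= M} -> sqint D f.
Proof.
move=> mD Doo mf fM.
apply: (@sqint_le _ _ (cst M)) => //; last first.
  by apply: (@sqint_bounded _ _ `|M|) => //; exact: measurable_cst.
by apply: ae_imply fM => x H Dx; rewrite (le_trans (H Dx))// ler_norm.
Qed.

Lemma sqintM_bounded D f g (M : R) : measurable D -> measurable_fun D g ->
  {ae mu, forall x, D x -> `|g x| <= M} -> sqint D f ->
  sqint D (fun x => g x * f x).
Proof.
move=> mD mg gM sf; have [mf _] := sf.
apply: (@sqint_le _ _ (fun x => M * f x)) => //; last exact: sqintZ.
  exact: measurable_funM.
apply: ae_imply gM => x H Dx; rewrite !normrM ler_wpM2r//.
by rewrite (le_trans (H Dx))// ler_norm.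
Qed.

Lemma sqint_rint D f : measurable D -> (mu D < +oo)%E -> sqint D f -> rint D f.
Proof.
move=> mD Doo sf; apply: (@eq_rint _ (fun x => f x * cst 1 x)) => //.
  by move=> x _; rewrite /= mulr1.
apply: sqintM_rint => //; apply: (@sqint_bounded _ _ 1) => //.
by move=> x _; rewrite normr1.
Qed.

(** The free constant c replaces the square roots of the Cauchy-Schwarz
    inequality, which is recovered by optimizing it. *)
Lemma young_Rint D f g (c : R) : measurable D -> 0 < c ->
  sqint D f -> sqint D g ->
  `|\int[mu]_(x in D) (f x * g x)| <=
    c * \int[mu]_(x in D) (f x ^+ 2) + c^-1 * \int[mu]_(x in D) (g x ^+ 2).
Proof.
move=> mD c0 sf sg; have [_ fi] := sf; have [_ gi] := sg.
apply: le_trans (le_normr_Rintegral mD (sqintM_rint mD sf sg)) _.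
rewrite -!RintegralZl// -RintegralD//; [|exact: rintZ|exact: rintZ].
apply: le_Rintegral => //.
- apply: integrable_norm; exact: sqintM_rint.
- by apply: rintD => //; exact: rintZ.
move=> x _; rewrite normrM -(real_normK (num_real (f x))) -(real_normK (num_real (g x))).
have c1 : c * c^-1 = 1 by rewrite divff// gt_eqF.
have ci : 0 < c^-1 by rewrite invr_gt0.
have := sqr_ge0 (`|f x| * c - `|g x|).
set a := `|f x|; set b := `|g x| => H.
have a0 : 0 <= a by exact: normr_ge0.
have b0 : 0 <= b by exact: normr_ge0.
have : 0 <= c^-1 * (a * c - b) ^+ 2 by rewrite mulr_ge0// ltW.
have -> : c^-1 * (a * c - b) ^+ 2 =
  (c * c^-1) * c * a ^+ 2 - (c * c^-1) * (2 * a * b) + c^-1 * b ^+ 2 by ring.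
rewrite c1 !mul1r; have := mulr_ge0 a0 b0; lra.
Qed.

End square_integrable.

Section sqint_norm.
Context d (T : measurableType d) (R : realType) (nu : {measure set T -> \bar R}).

Lemma sqint_norm (D : set T) (f : T -> R) : measurable D -> sqint nu D f ->
  sqint nu D (fun x => `|f x|).
Proof.
move=> mD [mf fi]; split; first exact: (measurableT_comp (@normr_measurable R setT) mf).
by apply: (@eq_rint _ _ _ nu D _ _ mD _ fi) => x _; rewrite real_normK// num_real.
Qed.

End sqint_norm.

(** * Weak convergence in L^2 *)

Section weak_convergence.
Context {d : measure_display} {T : measurableType d} {R : realType}.
Variable mu : {measure set T -> \bar R}.
Implicit Types (D E : set T) (f g h : T -> R).

(** Optimizing c bounds the distance from u to v j by a multiple of the square root
    of w j, uniformly in k: the limits in j and k can be exchanged. *)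
Lemma cvg0_approx (u : nat -> R) (v : nat -> nat -> R) (B : R) (w : nat -> R) :
  0 <= B ->
  (forall c, 0 < c -> forall j k, `|u k - v j k| <= c * B + c^-1 * w j) ->
  w j @[j --> \oo] --> 0 -> (forall j, v j k @[k --> \oo] --> 0) ->
  u k @[k --> \oo] --> 0.
Proof.
move=> B0 uv w0 v0; apply/cvgr0Pnorm_le => e e0.
pose c := e / 3 / (B + 1).
have B1 : 0 < B + 1 by rewrite ltr_pwDr.
have c0 : 0 < c by rewrite !divr_gt0.
have cB : c * B <= e / 3.
  rewrite /c -mulrA ler_piMr//; first by rewrite divr_ge0// ltW.
  by rewrite mulrC ler_pdivrMr// mul1r lerDl.
have we : 0 < c * (e / 3) by rewrite mulr_gt0// divr_gt0.
have /cvgr0Pnorm_le/(_ _ we)[j _ /(_ j (leqnn j)) wj] := w0.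
have e3 : 0 < e / 3 by rewrite divr_gt0.
have /cvgr0Pnorm_le/(_ _ e3)[N _ HN] := v0 j.
exists N => // k /= Nk; have /= vk := HN k Nk.
rewrite -(subrK (v j k) (u k)); apply: le_trans (ler_normD _ _) _.
have : c^-1 * w j <= e / 3 by rewrite ler_pdivrMl// (le_trans (ler_norm _) wj).
have := uv c c0 j k; lra.
Qed.

Import HBSimple HBNNSimple.

Lemma sqint_simple_pos D f : measurable D -> sqint mu D f ->
  (forall x, D x -> 0 <= f x) ->
  exists g_ : nat -> {nnsfun T >-> R},
    (forall k, sqint mu D (g_ k)) /\
    \int[mu]_(x in D) ((f x - g_ k x) ^+ 2) @[k --> \oo] --> 0.
Proof.
move=> mD [mf fi] f0.
have mf' : measurable_fun D (EFin \o f) by exact/measurable_EFinP.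
have f0' x : D x -> (0 <= (EFin \o f) x)%E by move=> Dx; rewrite lee_fin f0.
pose g_ k := nnsfun_approx mD mf' k.
have mg k : measurable_fun D (g_ k) by exact: measurable_funTS.
have gf k x : D x -> 0 <= g_ k x <= f x.
  move=> Dx; apply/andP; split => //.
  by rewrite -lee_fin /g_ nnsfun_approxE; exact: le_approx.
exists g_; split.
  move=> k; apply: (@sqint_le _ _ _ mu D _ f) => //.
  apply: aeW => x Dx; have /andP[g0 gfx] := gf k x Dx.
  by rewrite !ger0_norm// f0.
have -> : 0 = \int[mu]_(x in D) (cst 0 x : R).
  by rewrite Rintegral_cst ?mul0r.
apply: (@Rint_dct _ _ _ mu D _ _ (fun x => f x ^+ 2) mD _ _ fi _ _).2.
- by move=> k; apply: measurable_funX; exact: measurable_funB.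
- exact: measurable_cst.
- apply: aeW => x Dx /=.
  have H : g_ k x @[k --> \oo] --> f x.
    by have := cvg_nnsfun_approx mD mf' f0' Dx; move/fine_cvg.
  rewrite [X in _ --> X](_ : _ = (f x - f x) ^+ 2); last by rewrite subrr expr0n.
  by rewrite expr2; apply: cvgM; apply: cvgB => //; exact: cvg_cst.
- apply: aeW => x k Dx; have /andP[g0 gfx] := gf k x Dx.
  rewrite ger0_norm ?sqr_ge0// lerXn2r ?nnegrE ?subr_ge0 ?f0//.
  by rewrite gerBl.
Qed.

(** Simple functions are dense in L^2, and the bound M makes the approximation of
    phi by simple functions uniform in k. *)
Lemma weak_cvg_sets D (f_ : nat -> T -> R) (M : R) : measurable D ->
  (mu D < +oo)%E -> (forall k, sqint mu D (f_ k)) ->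
  (forall k, \int[mu]_(x in D) (f_ k x ^+ 2) <= M) ->
  (forall E, measurable E -> E `<=` D ->
     \int[mu]_(x in E) f_ k x @[k --> \oo] --> 0) ->
  forall phi, sqint mu D phi ->
    \int[mu]_(x in D) (f_ k x * phi x) @[k --> \oo] --> 0.
Proof.
move=> mD Doo sf fM fE phi sphi.
have M0 : 0 <= M.
  by apply: le_trans (fM 0%N); apply: Rintegral_ge0 => x _; exact: sqr_ge0.
pose good g := sqint mu D g /\ \int[mu]_(x in D) (f_ k x * g x) @[k --> \oo] --> 0.
have goodB g h : good g -> good h -> good (fun x => g x - h x).
  move=> [sg cg] [sh ch]; split; first exact: sqintB.
  rewrite (_ : (fun k => _) = (fun k => \int[mu]_(x in D) (f_ k x * g x) -
     \int[mu]_(x in D) (f_ k x * h x))); last first.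
    apply/funext => k; rewrite -RintegralB//; [|exact: sqintM_rint|exact: sqintM_rint].
    by apply: eq_Rintegral => x _; rewrite mulrBr.
  by rewrite -(subr0 0); apply: cvgB.
have goodind E c : measurable E -> good (fun x => c * \1_E x).
  move=> mE.
  have s1 : sqint mu D (\1_E : T -> R).
    apply: (@sqint_bounded _ _ _ mu D _ 1) => //.
    by move=> x _; rewrite indicE; case: (_ \in _); rewrite ?normr1 ?normr0.
  split; first exact: sqintZ.
  rewrite (_ : (fun k => _) = (fun k => c * \int[mu]_(x in D `&` E) f_ k x)).
    rewrite -(mulr0 c); apply: cvgM; first exact: cvg_cst.
    by apply: fE => //; exact: measurableI.
  apply/funext => k; rewrite Rintegral_mkcondr -RintegralZl//.
    by apply: eq_Rintegral => x _; rewrite restrict_indicE; ring.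
  apply: (eq_rint mD _ (sqintM_rint mD (sf k) s1)) => x _.
  by rewrite restrict_indicE.
have good0 : good (cst 0).
  split; first exact: sqint0.
  rewrite (_ : (fun k => _) = cst 0); first exact: cvg_cst.
  apply/funext => k; rewrite (@eq_Rintegral _ _ _ _ _ (cst 0)) ?Rintegral_cst ?mul0r//.
  by move=> x _; rewrite /= mulr0.
have eq_good g h : g =1 h -> good g -> good h by move=> /funext ->.
have goodD g h : good g -> good h -> good (fun x => g x + h x).
  move=> gg gh; apply: (eq_good (fun x => g x - (0 - h x))).
    by move=> x; ring.
  by apply: (goodB) => //; apply: (goodB) => //; exact: good0.
have goods (g : {nnsfun T >-> R}) : good g.
  apply: (eq_good (fun x => \sum_(y <- finmap.enum_fset (fset_set (range g))) y * \1_(g @^-1` [set y]) x)).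
    by move=> x; rewrite [RHS]fimfunE fsbig_finite.
  elim: (finmap.enum_fset _) => [|y s IHs].
    by apply: (eq_good _ _ _ good0) => x; rewrite big_nil.
  apply: (eq_good _ _ _ (goodD _ _ (goodind (g @^-1` [set y]) y _) IHs)) => //.
  by move=> x; rewrite big_cons.
have goodlim g : sqint mu D g -> (exists g_ : nat -> {nnsfun T >-> R},
    (forall k, sqint mu D (g_ k)) /\
    \int[mu]_(x in D) ((g x - g_ k x) ^+ 2) @[k --> \oo] --> 0) -> good g.
  move=> sg [g_ [sg_ cg]]; split => //.
  apply: (@cvg0_approx _ (fun j k => \int[mu]_(x in D) (f_ k x * g_ j x)) M
     (fun j => \int[mu]_(x in D) ((g x - g_ j x) ^+ 2))) => // [c c0 j k|j].
    rewrite -RintegralB//; [|exact: sqintM_rint|exact: sqintM_rint].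
    rewrite (_ : \int[mu]_(x in D) _ = \int[mu]_(x in D) (f_ k x * (g x - g_ j x))).
      apply: le_trans (young_Rint mD c0 (sf k) (sqintB mD sg (sg_ j))) _.
      by rewrite lerD2r ler_wpM2l// ltW.
    by apply: eq_Rintegral => x _; rewrite mulrBr.
  by have [] := goods (g_ j).
have [mphi phi2] := sphi.
pose pp x := Num.max (phi x) 0; pose pn x := Num.max (- phi x) 0.
have abound x : `|pp x| <= `|phi x| /\ `|pn x| <= `|phi x|.
  rewrite /pp /pn; split; [case: (leP (phi x) 0)|case: (leP (- phi x) 0)] => _;
    by rewrite ?normr0 ?normrN ?normr_ge0 ?lexx.
have mpp : measurable_fun D pp by apply: measurable_maxr => //; exact: measurable_cst.
have mpn : measurable_fun D pn.
  by apply: measurable_maxr; [exact: measurable_funN|exact: measurable_cst].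
have spp : sqint mu D pp.
  by apply: (sqint_le mD mpp _ sphi); apply: aeW => x _; have [] := abound x.
have spn : sqint mu D pn.
  by apply: (sqint_le mD mpn _ sphi); apply: aeW => x _; have [] := abound x.
have gpp : good pp.
  by apply: goodlim => //; apply: sqint_simple_pos => // x _; rewrite le_max lexx orbT.
have gpn : good pn.
  by apply: goodlim => //; apply: sqint_simple_pos => // x _; rewrite le_max lexx orbT.
suff : good phi by case.
apply: (eq_good _ _ _ (goodB _ _ gpp gpn)) => x; rewrite /pp /pn.
by case: (leP (phi x) 0) => H1; case: (leP (- phi x) 0) => H2; lra.
Qed.

End weak_convergence.

Section weak_convergence_boxes.
Context {R : realType} {n : nat}.
Local Notation mu := (@leb R n).
Implicit Types (U : set 'cV[R]_n).

Lemma open_obox (a b : 'cV[R]_n) : open (obox a b).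
Proof.
rewrite openE => x abx.
pose e := \big[Num.min/1]_(i < n) Num.min (x i 0 - a i 0) (b i 0 - x i 0).
have e0 : 0 < e.
  apply/bigmin_gtP; split => // i _.
  by have /andP[? ?] := abx i; rewrite lt_min !subr_gt0; apply/andP.
apply/nbhs_ballP; exists e => //= y; rewrite ball_obox// => xy i.
have := xy i; rewrite !mxE.
have : e <= Num.min (x i 0 - a i 0) (b i 0 - x i 0).
  exact: (bigmin_le_cond _ (fun i : 'I_n => Num.min (x i 0 - a i 0) (b i 0 - x i 0))).
by rewrite le_min => /andP[? ?] /andP[? ?]; apply/andP; split; lra.
Qed.

Lemma bounded_sub_obox U : bounded_set U -> exists a b, U `<=` obox a b.
Proof.
move=> [M [_ MU]]; have {}MU := MU (`|M| + 1); set N := `|M| + 1 in MU.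
exists (const_mx (- (N + 1))), (const_mx (N + 1)) => x Ux i; rewrite !mxE -ltr_norml.
apply: (@le_lt_trans _ _ N); last by rewrite ltrDl.
apply: (le_trans (entry_le_norm x i 0)).
by apply: MU => //; rewrite /N ltr_pwDr// ler_norm.
Qed.

(** The Borel sets on which the integrals tend to zero form a Dynkin system: a
    monotone union is exhausted up to small measure, which the L^2 bound makes
    negligible uniformly in k. *)
Lemma weak_cvg_boxes U (f_ : nat -> 'cV[R]_n -> R) (M : R) :
  open U -> bounded_set U -> (forall k, sqint mu U (f_ k)) ->
  (forall k, \int[mu]_(x in U) (f_ k x ^+ 2) <= M) ->
  (forall a b, \int[mu]_(x in U `&` obox a b) f_ k x @[k --> \oo] --> 0) ->
  forall phi, sqint mu U phi ->
    \int[mu]_(x in U) (f_ k x * phi x) @[k --> \oo] --> 0.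
Proof.
move=> oU bU sf fM fbox.
have mU := open_leb_measurable oU; have Uoo := bounded_leb_lty bU.
have fi k : rint mu U (f_ k) by exact: sqint_rint.
have sub_rint (A : set (eucl R n)) k : measurable A -> rint mu (U `&` A) (f_ k).
  by move=> mA; apply: integrableS (fi k) => //; exact: measurableI.
pose H : set (set 'cV[R]_n) := [set A | borel_col A /\
  \int[mu]_(x in U `&` A) f_ k x @[k --> \oo] --> 0].
have M0 : 0 <= M.
  by apply: le_trans (fM 0%N); apply: Rintegral_ge0 => x _; exact: sqr_ge0.
have lH : lambda_system setT H.
  split.
  - by [].
  - split; first exact: borel_colT.
    have [a [b ab]] := bounded_sub_obox bU.
    by have := fbox a b; rewrite (setIidl ab) setIT.
  - move=> A B BA [bA cA] [bB cB]; split; first exact: borel_colD.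
    have mB := borel_col_measurable bB.
    have mAB := borel_col_measurable (borel_colD bA bB).
    rewrite (_ : (fun k => _) = (fun k => \int[mu]_(x in U `&` A) f_ k x -
      \int[mu]_(x in U `&` B) f_ k x)).
      by rewrite -(subr0 0); apply: cvgB.
    apply/funext => k.
    have E : U `&` A = (U `&` (A `\` B)) `|` (U `&` B).
      by rewrite -setIUr setDKU.
    rewrite [in RHS]E Rintegral_setU ?addrK//.
    + exact: measurableI.
    + exact: measurableI.
    + by rewrite -E; apply: sub_rint; exact: borel_col_measurable.
    + by apply/eqP/seteqP; split => // x [[_ [_ ?]] [_ ?]].
  - move=> F ndF HF.
    have bF k : borel_col (F k) by have [] := HF k.
    have bUF : borel_col (\bigcup_k F k) by exact: borel_col_bigcup.
    split => //.
    pose W j := U `&` (\bigcup_k F k) `\` (U `&` F j).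
    have mW j : measurable (W j : set (eucl R n)).
      by apply: measurableD; apply: measurableI => //; exact: borel_col_measurable.
    have WU j : W j `<=` U by move=> x [[]].
    have Wlt j : (mu (W j) < +oo)%E.
      by apply: le_lt_trans Uoo; apply: le_measure; rewrite ?inE.
    have sW j k : sqint mu (W j) (f_ k) by exact: sqintS (sf k).
    have s1 j : sqint mu (W j) (cst 1).
      apply: (@sqint_bounded _ _ _ mu _ _ 1) => //; first exact: Wlt.
      by move=> x _; rewrite /= normr1.
    apply: (@cvg0_approx _ _ (fun j k => \int[mu]_(x in U `&` F j) f_ k x) M
      (fun j => fine (mu (W j)))) => // [c c0 j k||j]; last by have [] := HF j.
      have E : U `&` \bigcup_k F k = (U `&` F j) `|` W j.
        rewrite /W setDUK//; apply: setIS; exact: bigcup_sup.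
      rewrite [in \int[mu]_(x in U `&` \bigcup_k0 F k0) _]E Rintegral_setU//; last 3 first.
      + by apply: measurableI => //; exact: borel_col_measurable.
      + by rewrite -E; apply: sub_rint; exact: borel_col_measurable.
      + by apply/eqP/seteqP; split => // x [? [_ ?]].
      rewrite addrAC subrr add0r.
      rewrite (_ : \int[mu]_(x in W j) f_ k x = \int[mu]_(x in W j) (f_ k x * cst 1 x)); last first.
        by apply: eq_Rintegral => x _; rewrite mulr1.
      apply: le_trans (young_Rint (mW j) c0 (sW j k) (s1 j)) _.
      apply: lerD.
        apply: ler_wpM2l; first exact: ltW.
        apply: le_trans (fM k).
        rewrite -(setDKU (WU j)) Rintegral_setU//; last 3 first.
        + exact: measurableD.
        + by rewrite setDKU//; have [] := sf k.
        + by apply/eqP/seteqP; split => // x [[_ ?] ?].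
        by rewrite lerDr; apply: Rintegral_ge0 => x _; exact: sqr_ge0.
      by rewrite /= expr1n Rintegral_cst// mul1r.
    have : mu (W j) @[j --> \oo] --> mu (\bigcap_j W j).
      have mcap : measurable (\bigcap_j W j : set (eucl R n)).
        exact: (@bigcapT_measurable _ (eucl R n) W mW).
      have niW : {homo W : i j / (i <= j)%N >-> (j <= i)%O}.
        move=> i j ij; apply/subsetPset => x [xU nx]; split => // -[Ux Fx]; apply: nx; split => //.
        by move: Fx; apply/subsetPset/ndF.
      exact: (@nonincreasing_cvg_mu _ (eucl R n) R mu W (Wlt 0%N) mW mcap niW).
    rewrite (_ : \bigcap_j W j = set0) ?measure0; last first.
      apply/seteqP; split => // x Wx.
      have [[Ux [j _ Fx]] _] := Wx 0%N I.
      by have [_] := Wx j I; apply.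
    by move=> /fine_cvg.
have allH : forall A, borel_col A -> H A.
  apply: borel_col_induction => // a b; split; [exact: borel_col_obox|exact: fbox].
apply: (weak_cvg_sets mU Uoo sf fM) => E mE EU.
have Eoo : (mu E < +oo)%E.
  by apply: le_lt_trans Uoo; apply: le_measure; rewrite ?inE.
(* a measurable set differs from its Borel hull by a null set *)
have [G [bG EG GE]] := borel_hull Eoo.
have [_] := allH G bG.
have mG := borel_col_measurable bG.
have mUG : measurable (U `&` G : set (eucl R n)) by exact: measurableI.
have EUG : E `<=` U `&` G by move=> x Ex; split; [exact: EU|exact: EG].
have N0 : mu ((U `&` G) `\` E) = 0%E.
  apply/eqP; rewrite eq_le measure_ge0 andbT.
  have : (mu (G `\` E) <= 0)%E.
    have Goo : (leb (G : set (eucl R n)) < +oo)%E by rewrite GE.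
    have : leb (G `\` E : set (eucl R n)) = (leb (G : set (eucl R n)) - leb (G `&` E))%E.
      exact: (measureD (mu := mu) mG mE Goo).
    by rewrite (setIidr EG) GE subee ?ge0_fin_numE// => ->.
  apply: le_trans; apply: le_measure; rewrite ?inE; [exact: measurableD|exact: measurableD|].
  by move=> x [[_ ?] ?].
suff -> : (fun k => \int[mu]_(x in E) f_ k x) = (fun k => \int[mu]_(x in U `&` G) f_ k x) by [].
apply/funext => k; congr fine.
rewrite [RHS](@negligible_integral _ _ _ mu _ ((U `&` G) `\` E))//; last 2 first.
  exact: measurableD.
  exact: sub_rint.
by rewrite setDD (setIidr EUG).
Qed.

End weak_convergence_boxes.

(** * Partial derivatives of Lipschitz functions *)

Section lipschitz_functions.
Context {R : realType} {n : nat}.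
Local Notation mu := (@leb R n).
Implicit Types (f g : 'cV[R]_n -> R) (x y : 'cV[R]_n) (D U : set 'cV[R]_n).

Definition lip (K : R) f := forall x y, `|f x - f y| <= K * `|x - y|.

Lemma lip_ge0 K f : lip K f -> lip `|K| f.
Proof. by move=> fK x y; apply: le_trans (fK x y) _; rewrite ler_wpM2r// ler_norm. Qed.

Lemma le_lip K K' f : K <= K' -> lip K f -> lip K' f.
Proof. by move=> KK fK x y; apply: le_trans (fK x y) _; rewrite ler_wpM2r. Qed.

Lemma lip_continuous K f : lip K f -> continuous f.
Proof.
move=> /lip_ge0 fK x; apply/(@cvgrPdist_le _ _ _ (nbhs x) (nbhs_filter x)) => e e0.
have K1 : 0 < `|K| + 1 by rewrite ltr_pwDr.
apply/nbhs_ballP; exists (e / (`|K| + 1)); first by rewrite /= divr_gt0.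
move=> y; rewrite -ball_normE /= => xy; apply: le_trans (fK x y) _.
move: (ltW xy); rewrite ler_pdivlMr// => H; apply: le_trans H.
by rewrite mulrC ler_wpM2l// lerDl.
Qed.

Lemma continuous_on_measurable D f : open D ->
  (forall x, D x -> {for x, continuous f}) ->
  measurable_fun (D : set (eucl R n)) f.
Proof.
move=> oD cf; apply: (measurability _ (RGenOInfty.measurableE R)) => //.
move=> _ [_ [a ->] <-]; apply: open_leb_measurable.
rewrite openE => x [Dx fx].
have nD : nbhs x D by exact: open_nbhs_nbhs.
have na : nbhs (f x) `]a, +oo[%classic.
  by apply: open_nbhs_nbhs; split => //; exact: interval_open.
have nf : nbhs x (f @^-1` `]a, +oo[%classic) := cf x Dx _ na.
exact: (@filterI _ (nbhs x) (nbhs_filter x) _ _ nD nf).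
Qed.

Lemma continuous_leb_measurable f : continuous f ->
  measurable_fun (setT : set (eucl R n)) f.
Proof. by move=> cf; apply: continuous_on_measurable; [exact: openT|move=> x _; exact: cf]. Qed.

Lemma closed_borel_col D : closed D -> borel_col D.
Proof.
by move=> cD; rewrite -(setCK D); apply: borel_colC; apply: borel_col_open; exact: closed_openC.
Qed.

Definition dquot f (i : 'I_n) (h : R) x : R :=
  h^-1 * (f (h *: delta_mx i 0 + x) - f x).

Lemma dquotE f i x :
  (fun h : R => h^-1 *: ((f \o shift x) (h *: delta_mx i 0) - f x)) =
  (fun h => dquot f i h x).
Proof. by []. Qed.

Lemma continuous_dquot f i h : continuous f -> continuous (dquot f i h).
Proof.
move=> cf.
have c1 : continuous (fun x => f (h *: delta_mx i 0 + x)).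
  move=> x; apply: (@continuous_comp _ _ _ (fun x => h *: delta_mx i 0 + x) f); last exact: cf.
  by apply: continuousD; [exact: cst_continuous|move=> ?].
have c2 : continuous (fun x => f (h *: delta_mx i 0 + x) - f x).
  by move=> x; apply: continuousB; [exact: c1|exact: cf].
move=> x; apply: (continuousM (s := fun=> h^-1) (t := fun x => f (h *: delta_mx i 0 + x) - f x)).
  exact: cst_continuous.
exact: c2.
Qed.

Lemma norm_delta (i : 'I_n) : `|delta_mx i 0 : 'cV[R]_n| = 1.
Proof.
apply/eqP; rewrite eq_le; apply/andP; split.
  apply: norm_le_entries => // j k; rewrite mxE; case: (_ && _);
  by rewrite ?normr1 ?normr0.
by have := entry_le_norm (delta_mx i 0 : 'cV[R]_n) i 0; rewrite mxE !eqxx normr1.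
Qed.

Lemma dquot_le K f i h x : lip K f -> h != 0 -> `|dquot f i h x| <= K.
Proof.
move=> fK h0; rewrite /dquot normrM normfV.
rewrite ler_pdivrMl ?normr_gt0//; apply: le_trans (fK _ _) _.
by rewrite addrK normrZ norm_delta mulr1 mulrC.
Qed.

Definition der_set f i : set 'cV[R]_n := [set x | derivable f x (delta_mx i 0)].

(** By Cauchy's criterion differentiability is a countable combination of closed
    conditions on pairs of difference quotients. *)
Lemma borel_col_der_set f i : continuous f -> borel_col (der_set f i).
Proof.
move=> cf.
pose E k m := [set x | forall p r : R, 0 < `|p| < m.+1%:R^-1 ->
  0 < `|r| < m.+1%:R^-1 -> `|dquot f i p x - dquot f i r x| <= k.+1%:R^-1].
have -> : der_set f i = \bigcap_k (\bigcup_m E k m).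
  apply/seteqP; split => x.
    rewrite /der_set /= /derivable dquotE => /cvg_ex[l lx] k _.
    have e0 : 0 < k.+1%:R^-1 / 2 :> R by rewrite divr_gt0// invr_gt0.
    have /cvgrPdist_le/(_ _ e0) := lx.
    move=> [d /= d0 dP].
    have [m _ /(_ m (leqnn m)) md] := near_infty_natSinv_lt (PosNum d0).
    exists m => // p r /andP[p0 pm] /andP[r0 rm].
    have Hp : `|l - dquot f i p x| <= k.+1%:R^-1 / 2.
      apply: dP; rewrite ?normr_gt0// ?sub0r ?normrN -?normr_gt0// /ball_ /=.
      by rewrite sub0r normrN (lt_trans pm).
    have Hr : `|l - dquot f i r x| <= k.+1%:R^-1 / 2.
      apply: dP; rewrite ?normr_gt0// ?sub0r ?normrN -?normr_gt0// /ball_ /=.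
      by rewrite sub0r normrN (lt_trans rm).
    have -> : dquot f i p x - dquot f i r x = (l - dquot f i r x) - (l - dquot f i p x) by ring.
    by apply: le_trans (ler_normB _ _) _; rewrite (splitr k.+1%:R^-1) lerD.
  move=> Hx; rewrite /der_set /= /derivable dquotE.
  apply/cauchy_cvgP/cauchy_ballP => e e0.
  have [k _ /(_ k (leqnn k)) ke] := near_infty_natSinv_lt (PosNum e0).
  have [m _ mP] := Hx k I.
  near_simpl.
  exists ([set p | 0 < `|p| < m.+1%:R^-1], [set p | 0 < `|p| < m.+1%:R^-1]) => /=.
    by split; exists m.+1%:R^-1; rewrite /= ?invr_gt0// => p /=;
      rewrite /ball_ /= sub0r normrN normr_gt0 => -> ->.
  move=> [p r] /= [Hp Hr]; rewrite /ball /=.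
  by apply: le_lt_trans ke; exact: mP.
apply: borel_col_bigcap => k; apply: borel_col_bigcup => m.
apply: closed_borel_col.
have -> : E k m = \bigcap_(pr in [set pr : R * R | 0 < `|pr.1| < m.+1%:R^-1 /\ 0 < `|pr.2| < m.+1%:R^-1])
   [set x | `|dquot f i pr.1 x - dquot f i pr.2 x| <= k.+1%:R^-1].
  apply/seteqP; split => x H; first by move=> [p r] [/= Hp Hr]; exact: H.
  by move=> p r Hp Hr; exact: (H (p, r)).
apply: closed_bigI => -[p r] _ /=.
apply: (@preimage_closed _ _ (fun x => `|dquot f i p x - dquot f i r x|) [set z | z <= k.+1%:R^-1]).
  move=> x _; apply: (@continuous_comp _ _ _ (fun x => dquot f i p x - dquot f i r x) (fun z : R => `|z|)).
    by apply: continuousB; exact: continuous_dquot.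
  exact: norm_continuous.
exact: closed_le.
Qed.

Lemma line_dquot f i x (s h : R) :
  dquot f i h (x + s *: delta_mx i 0) =
  h^-1 * (f (x + (h * 1 + s) *: delta_mx i 0) - f (x + s *: delta_mx i 0)).
Proof.
rewrite /dquot mulr1; congr (_ * (f _ - _)).
by rewrite scalerDl addrCA.
Qed.

(** On each line in the direction i the function is Lipschitz in one variable,
    so that the line meets the exceptional set in a null set. *)
Lemma lip_der_set_null K f i : lip K f ->
  leb (~` der_set f i : set (eucl R n)) = 0%E.
Proof.
move=> fK; have cf := lip_continuous fK.
apply: (@leb_lines _ _ i); first by apply: borel_colC; exact: borel_col_der_set.
move=> x; pose phi (s : R) := f (x + s *: delta_mx i 0).
have phiK s t : `|phi s - phi t| <= K * `|s - t|.
  apply: le_trans (fK _ _) _.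
  rewrite opprD addrACA subrr add0r -scalerBl normrZ norm_delta mulr1//.
have [N [mN N0 sub]] := lipschitz_derivable_ae phiK.
apply/eqP; rewrite eq_le measure_ge0 andbT -N0; apply: le_outer_measure => s /= nd.
apply: sub => /= d1; apply: nd.
rewrite /der_set /= /derivable dquotE.
rewrite (_ : (fun h => _) = (fun h : R => h^-1 *: ((phi \o shift s) (h *: (1 : R)) - phi s)))//.
by apply/funext => h; rewrite line_dquot.
Qed.

Lemma lip_derivable_ae K f i : lip K f ->
  {ae mu, forall x, derivable f x (delta_mx i 0)}.
Proof.
move=> fK; exists (~` der_set f i); split => //.
  by apply: borel_col_measurable; apply: borel_colC; apply: borel_col_der_set; exact: lip_continuous fK.
exact: lip_der_set_null fK.
Qed.

Lemma dquot_cvg f i x : derivable f x (delta_mx i 0) ->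
  dquot f i (k.+1%:R^-1) x @[k --> \oo] --> partial i f x.
Proof.
move=> dx; rewrite /partial /derive dquotE.
have /cvgrPdist_le H : (fun h => dquot f i h x) @ 0^' --> lim ((fun h => dquot f i h x) @ 0^').
  exact: dx.
apply/cvgrPdist_le => e e0; have [d /= d0 dP] := H e e0.
have [m _ mP] := near_infty_natSinv_lt (PosNum d0).
exists m => // k /= mk; apply: dP; rewrite /ball_ /= ?sub0r ?normrN.
  by rewrite gtr0_norm ?invr_gt0//; exact: mP.
by rewrite gt_eqF ?invr_gt0.
Qed.

Lemma partial_le K f i x : lip K f -> derivable f x (delta_mx i 0) ->
  `|partial i f x| <= K.
Proof.
move=> fK dx; apply/ler_addgt0Pr => e e0.
have /cvgrPdist_le/(_ e e0)[k _ /(_ k (leqnn k)) ke] := dquot_cvg dx.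
rewrite -(subrK (dquot f i k.+1%:R^-1 x) (partial i f x)) addrC.
by apply: le_trans (ler_normD _ _) _; rewrite lerD// dquot_le.
Qed.

Lemma partial_le_ae K f i : lip K f -> {ae mu, forall x, `|partial i f x| <= K}.
Proof.
move=> fK; apply: ae_imply (lip_derivable_ae i fK) => x; exact: partial_le.
Qed.

(** The Lebesgue sigma-algebra is complete. *)
Lemma measurable_fun_null (D E : set (eucl R n)) (f : 'cV[R]_n -> R) :
  measurable D -> measurable E -> mu (D `\` E) = 0%E ->
  measurable_fun (D `&` E) f -> measurable_fun D f.
Proof.
move=> mD mE DE mf _ B mB.
rewrite -(setUIDK (D `&` f @^-1` B) E).
apply: measurableU.
  rewrite setIAC; apply: mf => //; exact: measurableI.
apply: (@measure_is_complete_caratheodory R _ (@leb_outer R n)).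
by exists (D `\` E); split => //; [exact: measurableD|move=> x [[? ?] ?]].
Qed.

Lemma measurable_partial K f i : lip K f ->
  measurable_fun (setT : set (eucl R n)) (partial i f).
Proof.
move=> fK; have cf := lip_continuous fK.
have mE : measurable (der_set f i : set (eucl R n)).
  by apply: borel_col_measurable; exact: borel_col_der_set.
apply: (@measurable_fun_null _ (der_set f i)) => //.
  by rewrite setTD; exact: lip_der_set_null fK.
rewrite setTI.
apply: (@measurable_fun_cvg _ (eucl R n) R _ (fun k => dquot f i k.+1%:R^-1)).
  move=> k; apply: measurable_funTS; apply: continuous_leb_measurable.
  exact: continuous_dquot.
by move=> x dx; exact: dquot_cvg.
Qed.

Lemma leb_Rint_shift (a : 'cV[R]_n) f : rint mu setT f ->
  \int[mu]_x f (x + a) = \int[mu]_x f x.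
Proof.
move=> fi; have mf := rint_measurable fi.
have mf' : measurable_fun setT (fun x : eucl R n => f (x + a)).
  exact: (measurableT_comp mf (measurable_fun_shift a)).
pose nu : {measure set (eucl R n) -> \bar R} :=
  measure_function_pushforward__canonical__measure_function_Measure
    mu (measurable_fun_shift a).
have nuE A : measurable A -> nu A = mu A by move=> mA; exact: leb_shift.
congr fine; transitivity (\int[nu]_x (f x)%:E)%E; last first.
  by apply: eq_measure_integral => A mA _; exact: nuE.
have fi' : mu.-integrable ((fun x : eucl R n => x + a) @^-1` setT) ((EFin \o f) \o (fun x => x + a)).
  apply/integrableP; split; first exact/measurable_EFinP.
  have /integrableP[_] := fi; apply: le_lt_trans.
  have mab : measurable_fun (setT : set (eucl R n)) (fun x => `|f x|%:E).
    by apply/measurable_EFinP; exact: (measurableT_comp (@normr_measurable R setT) mf).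
  have <- : (\int[nu]_x `|f x|%:E = \int[mu]_x `|(EFin \o f) x|)%E.
    by apply: eq_measure_integral => A mA _; exact: nuE.
  by rewrite [leRHS](ge0_integral_pushforward (measurable_fun_shift a)).
have mfE : measurable_fun (setT : set (eucl R n)) (EFin \o f) by exact/measurable_EFinP.
exact: (esym (@integral_pushforward _ _ _ _ R _ (measurable_fun_shift a) mu
  setT (EFin \o f) mfE fi' measurableT)).
Qed.

End lipschitz_functions.

(** * Integration by parts *)

Section integration_by_parts.
Context {R : realType} {n : nat}.
Local Notation mu := (@leb R n).
Implicit Types (f g : 'cV[R]_n -> R) (x y : 'cV[R]_n) (S U V : set 'cV[R]_n).

Definition nball (N : R) : set 'cV[R]_n := [set x | `|x| <= N].

Lemma closed_nball N : closed (nball N).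
Proof.
apply: (@preimage_closed _ _ (fun x : 'cV[R]_n => `|x|) [set z | z <= N]).
  by move=> x _; exact: norm_continuous.
exact: closed_le.
Qed.

Lemma bounded_nball N : bounded_set (nball N).
Proof.
exists N; split; first exact: num_real.
by move=> M NM x /= xN; exact: le_trans xN (ltW NM).
Qed.

Lemma measurable_nball N : measurable (nball N : set (eucl R n)).
Proof. by apply: borel_col_measurable; apply: closed_borel_col; exact: closed_nball. Qed.

Lemma nball_lty N : (mu (nball N) < +oo)%E.
Proof. exact: bounded_leb_lty (bounded_nball N). Qed.

Lemma bounded_sub_nball S : bounded_set S -> exists2 N, 0 <= N & S `<=` nball N.
Proof.
move=> [M [_ MS]]; exists (`|M| + 1); first by rewrite addr_ge0.
by move=> x Sx; apply: MS Sx; rewrite ltr_pwDr// ler_norm.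
Qed.

Lemma lip_nball K f N x : lip K f -> nball N x -> `|f x| <= `|f 0| + `|K| * N.
Proof.
move=> /lip_ge0 fK xN; rewrite -(subrK (f 0) (f x)) addrC.
apply: le_trans (ler_normD _ _) _; rewrite lerD2l; apply: le_trans (fK _ _) _.
by rewrite subr0 ler_wpM2l.
Qed.

Definition vanish_off S f := forall x, ~ S x -> f x = 0.

Lemma vanish_off_sub S U f : S `<=` U -> vanish_off S f -> vanish_off U f.
Proof. by move=> SU fS x Ux; apply: fS => /SU. Qed.

Lemma vanish_Rint U f : vanish_off U f ->
  \int[mu]_(x in U) f x = \int[mu]_x f x.
Proof.
move=> fU; rewrite Rintegral_mkcond; apply: eq_Rintegral => x _.
rewrite restrict_indicE indicE; case: (boolP (x \in U)) => [_|/negP]; first by rewrite mulr1.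
by rewrite inE => /fU ->; rewrite mul0r.
Qed.

Lemma rint_nball N : rint mu setT (\1_(nball N) : _ -> R).
Proof.
have mN := measurable_nball N.
apply/integrableP; split; first by apply/measurable_EFinP; exact: measurable_indic.
rewrite (_ : (fun x => _) = (fun x => (\1_(nball N) x)%:E)).
  by rewrite integral_indic// setIT; exact: nball_lty.
by apply/funext => x /=; rewrite ger0_norm// indicE.
Qed.

Lemma bounded_vanish_rint f N M : measurable_fun (setT : set (eucl R n)) f ->
  vanish_off (nball N) f -> {ae mu, forall x, `|f x| <= M} -> rint mu setT f.
Proof.
move=> mf fN fM.
apply: (@rint_ae_le _ _ _ mu _ _ (fun x => M * \1_(nball N) x)) => //.
  apply: ae_imply fM => x H _; rewrite indicE.
  case: (boolP (x \in _)) => [_|/negP]; first by rewrite mulr1.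
  by rewrite inE => /fN ->; rewrite normr0 mulr0.
by apply: rintZ => //; exact: rint_nball.
Qed.

Lemma lip_vanish_rint K f S : lip K f -> bounded_set S -> vanish_off S f ->
  rint mu setT f.
Proof.
move=> fK bS fS; have [N N0 SN] := bounded_sub_nball bS.
apply: (@bounded_vanish_rint _ N (`|f 0| + `|K| * N)).
- by apply: continuous_leb_measurable; exact: lip_continuous fK.
- exact: vanish_off_sub fS.
- apply: aeW => x; have [xN|xN] := pselect (nball N x); first exact: lip_nball.
  by rewrite (vanish_off_sub SN fS)// normr0 addr_ge0// mulr_ge0.
Qed.

Lemma partial_vanish S f i : closed S -> vanish_off S f -> vanish_off S (partial i f).
Proof.
move=> cS fS x Sx; rewrite /partial.
rewrite (@near_eq_derive _ _ _ f (cst 0)); first exact: derive_cst.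
have : nbhs x (~` S) by apply: open_nbhs_nbhs; split => //; exact: closed_openC.
by apply: (@filterS _ (nbhs x) (nbhs_filter x)) => y /fS.
Qed.

(** The integrals of the difference quotients vanish by translation invariance, and
    the Lipschitz constant dominates them. *)
Lemma Rint_partial0 K f S i : lip K f -> bounded_set S -> vanish_off S f ->
  \int[mu]_x partial i f x = 0.
Proof.
move=> fK bS fS; have [N N0 SN] := bounded_sub_nball bS.
have fi := lip_vanish_rint fK bS fS.
have cf := lip_continuous fK.
have K0 : 0 <= K.
  by have := fK (delta_mx i 0) 0; rewrite subr0 norm_delta mulr1; exact: le_trans.
have i1 : rint mu setT (fun x => K * \1_(nball (N + 1)) x).
  by apply: rintZ => //; exact: rint_nball.
have H0 k : \int[mu]_x dquot f i k.+1%:R^-1 x = 0.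
  have sh : rint mu setT (fun x => f (x + k.+1%:R^-1 *: delta_mx i 0)).
    apply: (@lip_vanish_rint K _ (nball (N + 1))).
    - by move=> x y; apply: le_trans (fK _ _) _; rewrite opprD addrACA subrr addr0.
    - exact: bounded_nball.
    - move=> x xN; apply: fS => /SN xS; apply: xN.
      rewrite /nball /= -(addrK (k.+1%:R^-1 *: delta_mx i 0) x).
      apply: le_trans (ler_normB _ _) _; apply: lerD => //.
      by rewrite normrZ norm_delta mulr1 gtr0_norm ?invr_gt0// invf_le1// ler1n.
  rewrite (_ : \int[mu]_x _ = \int[mu]_x (k.+1%:R^-1^-1 * (f (x + k.+1%:R^-1 *: delta_mx i 0) - f x))).
    rewrite RintegralZl//; last exact: rintB.
    by rewrite RintegralB// leb_Rint_shift// subrr mulr0.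
  by apply: eq_Rintegral => x _; rewrite /dquot [X in f X]addrC.
have dom k x : `|dquot f i k.+1%:R^-1 x| <= K * \1_(nball (N + 1)) x.
  rewrite indicE; case: (boolP (x \in _)) => [_|/negP].
    by rewrite mulr1 dquot_le// gt_eqF// invr_gt0.
  rewrite inE => xN; rewrite mulr0 /dquot !fS ?subrr ?mulr0 ?normr0//.
    by move=> /SN xS; apply: xN; apply: le_trans xS _; rewrite lerDl.
  move=> /SN xS; apply: xN; rewrite /nball /= -(addKr (k.+1%:R^-1 *: delta_mx i 0) x).
  rewrite addrC; apply: le_trans (ler_normB _ _) _; apply: lerD => //.
  by rewrite normrZ norm_delta mulr1 gtr0_norm ?invr_gt0// invf_le1// ler1n.
have cdq k : measurable_fun (setT : set (eucl R n)) (dquot f i k.+1%:R^-1).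
  by apply: continuous_leb_measurable; exact: continuous_dquot.
have mpf := measurable_partial i fK.
have cv : {ae mu, forall x, setT x ->
    dquot f i k.+1%:R^-1 x @[k --> \oo] --> partial i f x}.
  by apply: ae_imply (lip_derivable_ae i fK) => x dx _; exact: dquot_cvg.
have dm : {ae mu, forall x, forall k, setT x ->
    `|dquot f i k.+1%:R^-1 x| <= K * \1_(nball (N + 1)) x}.
  by apply: aeW => x k _; exact: dom.
have [_] := Rint_dct measurableT cdq mpf i1 cv dm.
rewrite (_ : (fun k => _) = cst 0); last by apply/funext => k; rewrite H0.
by move=> H; apply/esym; apply: (cvg_unique _ _ H) => //; exact: cvg_cst.
Qed.

(** The factor g is controlled on S only: at a point outside S the factor f
    vanishes. *)
Lemma lip_mul S f g K L Mf Mg : lip K f -> vanish_off S f ->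
  (forall x, `|f x| <= Mf) ->
  (forall x y, S x -> S y -> `|g x - g y| <= L * `|x - y|) ->
  (forall x, S x -> `|g x| <= Mg) -> lip (Mf * `|L| + `|K| * `|Mg|) (fun x => f x * g x).
Proof.
move=> /lip_ge0 fK fS fM gL gM x y.
have gL' a b : S a -> S b -> `|g a - g b| <= `|L| * `|a - b|.
  by move=> Sa Sb; apply: le_trans (gL a b Sa Sb) _; rewrite ler_wpM2r// ler_norm.
have gM' a : S a -> `|g a| <= `|Mg|.
  by move=> Sa; apply: le_trans (gM a Sa) (ler_norm _).
have Mf0 : 0 <= Mf by apply: le_trans (fM x).
have key a b : S a -> `|f a * g a - f b * g b| <= (Mf * `|L| + `|K| * `|Mg|) * `|a - b|.
  move=> Sa; rewrite mulrDl.
  have -> : f a * g a - f b * g b = f b * (g a - g b) + (f a - f b) * g a by ring.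
  apply: le_trans (ler_normD _ _) _; rewrite !normrM; apply: lerD.
    have [Sb|Sb] := pselect (S b); last by rewrite fS// normr0 mul0r !mulr_ge0.
    by rewrite -mulrA; apply: ler_pM => //; exact: gL'.
  rewrite -mulrA [`|Mg| * _]mulrC mulrA; apply: ler_pM => //; exact: gM'.
have [Sx|Sx] := pselect (S x); first exact: key.
have [Sy|Sy] := pselect (S y); first by rewrite distrC [`|x - y|]distrC; exact: key.
by rewrite !fS// !mul0r subrr normr0 mulr_ge0// addr_ge0// mulr_ge0.
Qed.

Lemma lip_vanish_bounded K f S : lip K f -> bounded_set S -> vanish_off S f ->
  exists2 M, 0 <= M & forall x, `|f x| <= M.
Proof.
move=> fK bS fS; have [N N0 SN] := bounded_sub_nball bS.
exists (`|f 0| + `|K| * N); first by rewrite addr_ge0// mulr_ge0.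
move=> x; have [xN|xN] := pselect (nball N x); first exact: lip_nball.
by rewrite (vanish_off_sub SN fS)// normr0 addr_ge0// mulr_ge0.
Qed.

Lemma vanish_partial_rint K L f g S i : lip K f -> bounded_set S -> vanish_off S f ->
  lip L g -> rint mu setT (fun x => f x * partial i g x).
Proof.
move=> fK bS fS gL.
have [M M0 fM] := lip_vanish_bounded fK bS fS.
have [N N0 SN] := bounded_sub_nball bS.
apply: (@bounded_vanish_rint _ N (M * L)).
- apply: measurable_funM; last exact: measurable_partial gL.
  by apply: continuous_leb_measurable; exact: lip_continuous fK.
- by move=> x /(vanish_off_sub SN fS) ->; rewrite mul0r.
- apply: ae_imply (partial_le_ae i gL) => x H.
  by rewrite normrM ler_pM.
Qed.

Lemma partial_vanish_rint K L f g S i : lip K f -> bounded_set S -> vanish_off S f ->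
  lip L g -> rint mu setT (fun x => partial i f x * g x).
Proof.
move=> fK bS fS gL.
have [N N0 SN] := bounded_sub_nball bS.
have K0 : 0 <= K.
  by have := fK (delta_mx i 0) 0; rewrite subr0 norm_delta mulr1; exact: le_trans.
apply: (@bounded_vanish_rint _ N (K * (`|g 0| + `|L| * N))).
- apply: measurable_funM; first exact: measurable_partial fK.
  by apply: continuous_leb_measurable; exact: lip_continuous gL.
- move=> x xN; rewrite (partial_vanish i (@closed_nball N) (vanish_off_sub SN fS))// mul0r//.
- apply: ae_imply (partial_le_ae i fK) => x H; rewrite normrM.
  have [xN|xN] := pselect (nball N x); first by rewrite ler_pM// (lip_nball gL).
  rewrite (partial_vanish i (@closed_nball N) (vanish_off_sub SN fS))// normr0 mul0r.
  by rewrite mulr_ge0// addr_ge0// mulr_ge0.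
Qed.

Lemma Rint_by_parts K L f g S i : lip K f -> bounded_set S -> vanish_off S f ->
  lip L g ->
  \int[mu]_x (partial i f x * g x) = - \int[mu]_x (f x * partial i g x).
Proof.
move=> fK bS fS gL.
have [M M0 fM] := lip_vanish_bounded fK bS fS.
have [N N0 SN] := bounded_sub_nball bS.
have fgL : lip (M * `|L| + `|K| * `| (`|g 0| + `|L| * N) |) (fun x => f x * g x).
  apply: (lip_mul fK fS fM) => [x y _ _|x /SN xN]; first exact: gL.
  exact: lip_nball.
have fg0 : vanish_off S (fun x => f x * g x) by move=> x /fS ->; rewrite mul0r.
have i1 := vanish_partial_rint i fK bS fS gL.
have i2 := partial_vanish_rint i fK bS fS gL.
have E : \int[mu]_x partial i (fun x => f x * g x) x =
    \int[mu]_x (f x * partial i g x + partial i f x * g x).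
  have m1 := measurable_partial i fgL.
  have m2 := rint_measurable (rintD measurableT i1 i2).
  apply: (Rint_ae_eq measurableT m1 m2).
    apply: ae_imply (ae_and (lip_derivable_ae i fK) (lip_derivable_ae i gL)) => x [df dg] _.
    rewrite /partial (deriveM df dg); congr (_ + _).
    exact: mulrC.
have := Rint_partial0 i fgL bS fg0; rewrite E RintegralD//.
by move/eqP; rewrite addrC addr_eq0 => /eqP.
Qed.

End integration_by_parts.

(** * Cutoff functions *)

Section cutoff_functions.
Context {R : realType} {n : nat}.
Local Notation mu := (@leb R n).
Implicit Types (f g : 'cV[R]_n -> R) (x y : 'cV[R]_n) (S U V : set 'cV[R]_n).

Lemma bounded_setS S V : S `<=` V -> bounded_set V -> bounded_set S.
Proof.
by move=> SV [M [Mr MV]]; exists M; split => // r Mr' x /SV Vx; exact: MV Vx.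
Qed.

Lemma closed_bounded_compact S : closed S -> bounded_set S -> compact S.
Proof.
move=> cS bS.
have ct : continuous (fun v : 'rV[R]_n => v^T).
  move=> v; apply/(@cvgrPdist_le _ _ _ (nbhs v) (nbhs_filter v)) => e e0; apply/nbhs_ballP; exists e => // w.
  rewrite -ball_normE /= => vw; apply: norm_le_entries; first exact: ltW.
  move=> i j; rewrite !mxE.
  have := entry_le_norm (v - w) j i; rewrite !mxE => H; exact: le_trans H (ltW vw).
have -> : S = (fun v : 'rV[R]_n => v^T) @` ((fun v : 'rV[R]_n => v^T) @^-1` S).
  apply/seteqP; split => [x Sx|_ [v /= Sv <-]//].
  by exists x^T; rewrite /= trmxK.
apply: continuous_compact; first exact: continuous_subspaceT.
apply: bounded_closed_compact.
  have [N N0 SN] := bounded_sub_nball bS.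
  exists N; split; first exact: num_real.
  move=> M NM v /= /SN vN; apply: (le_trans _ (ltW NM)).
  apply: norm_le_entries => // i j.
  by have := entry_le_norm v^T j i; rewrite mxE => H; apply: le_trans H vN.
by apply: preimage_closed => // v _; exact: ct.
Qed.

Definition dist_compl V x : R := inf [set `|x - y| | y in ~` V].

Section dist_compl.
Variables (V : set 'cV[R]_n) (z : 'cV[R]_n).
Hypothesis Vz : ~ V z.

Let hi x : has_inf [set `|x - y| | y in ~` V].
Proof. by split; [exists `|x - z|, z|exists 0 => _ [y _ <-]]. Qed.

Lemma dist_compl_ge0 x : 0 <= dist_compl V x.
Proof. by apply: lb_le_inf; [exists `|x - z|, z|move=> _ [y _ <-]]. Qed.

Lemma dist_compl_off x : ~ V x -> dist_compl V x = 0.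
Proof.
move=> Vx; apply/eqP; rewrite eq_le dist_compl_ge0 andbT.
by have := inf_lbound (hi x).2; apply; exists x => //; rewrite subrr normr0.
Qed.

Lemma lip_dist_compl : lip 1 (dist_compl V).
Proof.
have H x y : dist_compl V x - dist_compl V y <= `|x - y|.
  rewrite lerBlDr addrC -lerBlDr; apply: lb_le_inf; first by exists `|y - z|, z.
  move=> _ [w Vw <-]; rewrite lerBlDr.
  apply: (@le_trans _ _ `|x - w|).
    by have := inf_lbound (hi x).2; apply; exists w.
  have -> : x - w = (x - y) + (y - w) by rewrite addrA subrK.
  by rewrite [leRHS]addrC; exact: ler_normD.
move=> x y; rewrite mul1r ler_norml; apply/andP; split; last exact: H.
by rewrite lerNl opprB distrC; exact: H.
Qed.

Lemma dist_compl_gt0 x : open V -> V x -> 0 < dist_compl V x.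
Proof.
move=> oV Vx; have /nbhs_ballP[e /= e0 eV] : nbhs x V by exact: open_nbhs_nbhs.
apply: (lt_le_trans e0); apply: lb_le_inf; first by exists `|x - z|, z.
move=> _ [y Vy <-]; rewrite leNgt; apply/negP => xy; apply: Vy; apply: eV.
by rewrite -ball_normE.
Qed.

Definition cutoff (j : nat) x : R :=
  Num.min 1 (Num.max 0 (j.+1%:R * dist_compl V x - 1)).

Lemma cutoff_itv j x : 0 <= cutoff j x <= 1.
Proof. by rewrite /cutoff ge_min lexx andbT le_min ler01 le_max lexx. Qed.

Lemma lip_cutoff j : lip j.+1%:R (cutoff j).
Proof.
move=> x y; rewrite /cutoff.
set a := _ * _ - 1; set b := _ * _ - 1.
have ab : `|a - b| <= j.+1%:R * `|x - y|.
  rewrite /a /b opprD opprK addrACA addNr addr0 -mulrBr normrM ger0_norm//.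
  by rewrite ler_wpM2l//; have := lip_dist_compl x y; rewrite mul1r.
apply: le_trans ab.
have [H1 H2] : a - b <= `|a - b| /\ b - a <= `|a - b|.
  by split; [exact: ler_norm|rewrite distrC; exact: ler_norm].
have H0 : 0 <= `|a - b| by [].
rewrite ler_norml; move: H1 H2 H0; move: `|a - b| => c H1 H2 H0.
by case: (leP 0 a) => ?; case: (leP 0 b) => ?; (try case: (leP 1 a) => ?);
  (try case: (leP 1 b) => ?); (try case: (leP 1 0) => ?); apply/andP; split; lra.
Qed.

(** Closed sets that exhaust V, at a positive distance from its complement: a
    function that vanishes off one of them still does, off the next ones, after a
    regularization at a small scale. *)
Definition cutoff_support (j : nat) : set 'cV[R]_n :=
  [set x | j.+1%:R^-1 <= dist_compl V x].

Lemma vanish_cutoff j : vanish_off (cutoff_support j) (cutoff j).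
Proof.
move=> x /negP; rewrite -ltNge => H; rewrite /cutoff max_l; first by rewrite min_r.
by rewrite subr_le0 mulrC -ler_pdivlMr// mul1r ltW.
Qed.

Lemma cutoff_support_sub j : cutoff_support j `<=` V.
Proof.
move=> x /= H; apply: contrapT => Vx; move: H.
by rewrite /cutoff_support /= dist_compl_off// leNgt invr_gt0 ltr0n.
Qed.

Lemma closed_cutoff_support j : closed (cutoff_support j).
Proof.
apply: (@preimage_closed _ _ (dist_compl V) [set t | j.+1%:R^-1 <= t]).
  by move=> x _; exact: lip_continuous lip_dist_compl x.
exact: closed_ge.
Qed.

Lemma cutoff_cvg x : open V -> V x -> cutoff j x @[j --> \oo] --> (1 : R).
Proof.
move=> oV Vx; have d0 := dist_compl_gt0 oV Vx.
apply: cvg_near_cst.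
have d2 : 0 < dist_compl V x / 2 by rewrite divr_gt0.
have [m _ mP] := near_infty_natSinv_lt (PosNum d2).
exists m => // j /= mj; have := mP j mj => /= H.
rewrite /cutoff; apply: min_l; rewrite le_max; apply/orP; right.
have : j.+1%:R^-1 * j.+1%:R < dist_compl V x / 2 * j.+1%:R by rewrite ltr_pM2r.
rewrite mulVf ?pnatr_eq0// => {}H; lra.
Qed.

End dist_compl.

(** It makes the infimum in the distance to the complement meaningful. *)
Lemma bounded_compl_nonempty V : (0 < n)%N -> bounded_set V -> exists z, ~ V z.
Proof.
move=> n0 bV; have [N N0 VN] := bounded_sub_nball bV.
exists (const_mx (N + 1)) => /VN /= H.
have := entry_le_norm (const_mx (N + 1) : 'cV[R]_n) (Ordinal n0) 0.
rewrite mxE ger0_norm ?addr_ge0// => H2.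
by have := le_trans H2 H; rewrite leNgt ltrDl ltr01.
Qed.

(** The partial derivatives are bounded in L^2, so that their weak convergence to
    zero can be tested on boxes. There the indicator is replaced by a cutoff
    function, on which an integration by parts throws the derivative. *)
Lemma partial_weak_cvg0 U (psi : nat -> 'cV[R]_n -> R) (e : nat -> R) (K : R) i :
  open U -> bounded_set U -> (forall k, lip K (psi k)) ->
  (forall k x, `|psi k x| <= e k) -> e k @[k --> \oo] --> 0 ->
  forall u, sqint mu U u ->
    \int[mu]_(x in U) (partial i (psi k) x * u x) @[k --> \oo] --> 0.
Proof.
move=> oU bU psiK psie e0.
have n0 : (0 < n)%N by case: (n) i => // -[].
have K0 : 0 <= K.
  by have := psiK 0%N (delta_mx i 0) 0; rewrite subr0 norm_delta mulr1; exact: le_trans.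
have sq V k : open V -> bounded_set V -> sqint mu V (partial i (psi k)).
  move=> oV bV; apply: (@sqint_ae_bounded _ _ _ mu V _ K).
  - exact: open_leb_measurable.
  - exact: bounded_leb_lty.
  - by apply: measurable_funTS; exact: measurable_partial (psiK k).
  - by apply: ae_imply (partial_le_ae i (psiK k)) => x.
have bnd V k : open V -> bounded_set V ->
    \int[mu]_(x in V) (partial i (psi k) x ^+ 2) <= K ^+ 2 * fine (mu V).
  move=> oV bV; have mV := open_leb_measurable oV.
  rewrite -Rintegral_cst//; apply: le_Rint_ae => //.
  - by have [] := sq V k oV bV.
  - apply: sqint_rint => //; first exact: bounded_leb_lty.
    by apply: (@sqint_bounded _ _ _ mu V _ (K ^+ 2)) => //;
      [exact: bounded_leb_lty|move=> x _; rewrite ger0_norm// exprn_ge0].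
  - apply: ae_imply (partial_le_ae i (psiK k)) => x H _.
    by rewrite -(real_normK (num_real _)) lerXn2r ?nnegrE.
have W := @weak_cvg_boxes R n U (fun k => partial i (psi k))
  (K ^+ 2 * fine (mu U)) oU bU (fun k => sq U k oU bU) (fun k => bnd U k oU bU).
apply: W => a b; set V := U `&` obox a b.
have oV : open V by apply: openI => //; exact: open_obox.
have bV : bounded_set V by apply: bounded_setS bU; exact: subIsetl.
have mV := open_leb_measurable oV; have Voo := bounded_leb_lty bV.
have [z Vz] := bounded_compl_nonempty n0 bV.
have mc j : measurable_fun (V : set (eucl R n)) (cutoff V j).
  by apply: continuous_on_measurable => // x _; exact: lip_continuous (lip_cutoff Vz j) x.
have sc j : sqint mu V (fun x => cst 1 x - cutoff V j x).
  apply: (@sqint_bounded _ _ _ mu V _ 1 mV Voo).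
    apply: (@measurable_funB _ (eucl R n) R V (cst 1) (cutoff V j)).
      exact: measurable_cst.
    exact: mc.
  by move=> x _; have /andP[? ?] := cutoff_itv V j x; rewrite ger0_norm/= ?subr_ge0// gerBl.
have sc' j : sqint mu V (cutoff V j).
  apply: (@sqint_bounded _ _ _ mu V _ 1 mV Voo).
    exact: mc.
  by move=> x _; have /andP[? ?] := cutoff_itv V j x; rewrite ger0_norm.
apply: (@cvg0_approx _ _ (fun j k => \int[mu]_(x in V) (partial i (psi k) x * cutoff V j x))
   (K ^+ 2 * fine (mu V)) (fun j => \int[mu]_(x in V) ((cst 1 x - cutoff V j x) ^+ 2))).
- by rewrite mulr_ge0// ?sqr_ge0// fine_ge0.
- move=> c c0 j k; rewrite -(RintegralB mV).
  + rewrite (_ : \int[mu]_(x in V) _ = \int[mu]_(x in V) (partial i (psi k) x * (cst 1 x - cutoff V j x))).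
      apply: le_trans (young_Rint mV c0 (sq V k oV bV) (sc j)) _.
      by rewrite lerD2r ler_wpM2l ?bnd// ltW.
    by apply: eq_Rintegral => x _; rewrite mulrBr mulr1.
  + exact: (sqint_rint mV Voo (sq V k oV bV)).
  + exact: (sqintM_rint mV (sq V k oV bV) (sc' j)).
- have -> : 0 = \int[mu]_(x in V) (cst 0 x : R) by rewrite Rintegral_cst ?mul0r.
  apply: (@Rint_dct _ _ _ mu V (fun j x => (cst 1 x - cutoff V j x) ^+ 2) (cst 0) (cst 1) mV _ _ _ _ _).2.
  + by move=> j; apply: measurable_funX; have [] := sc j.
  + exact: measurable_cst.
  + apply: (sqint_rint mV Voo); apply: (@sqint_bounded _ _ _ mu V _ 1 mV Voo).
      exact: measurable_cst.
    by move=> x _; rewrite /= normr1.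
  + apply: aeW => x Vx /=.
    rewrite [X in _ --> X](_ : _ = (1 - 1) * (1 - 1)); last by rewrite subrr mul0r.
    by apply: cvgM; apply: cvgB; (try exact: cvg_cst); exact: (cutoff_cvg Vz).
  + apply: aeW => x j Vx /=; have /andP[? ?] := cutoff_itv V j x.
    by rewrite ger0_norm ?sqr_ge0// expr_le1// ?subr_ge0// gerBl.
- move=> j.
  have bS : bounded_set (cutoff_support V j).
    apply: (bounded_setS _ bV); exact: (@cutoff_support_sub V z Vz j).
  have vS := @vanish_cutoff V j.
  have cK := lip_cutoff Vz j.
  pose D := \int[mu]_x `|partial i (cutoff V j) x|.
  have [N N0 SN] := bounded_sub_nball bS.
  have i1 : rint mu setT (partial i (cutoff V j)).
    apply: (@bounded_vanish_rint _ _ _ N j.+1%:R).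
    + exact: measurable_partial cK.
    + by apply: partial_vanish; [exact: closed_nball|exact: vanish_off_sub SN vS].
    + by apply: ae_imply (partial_le_ae i cK).
  have ibp k : \int[mu]_(x in V) (partial i (psi k) x * cutoff V j x) =
      - \int[mu]_x (partial i (cutoff V j) x * psi k x).
    rewrite vanish_Rint.
      rewrite (_ : \int[mu]_x _ = \int[mu]_x (cutoff V j x * partial i (psi k) x)).
        by rewrite (Rint_by_parts i cK bS vS (psiK k)) opprK.
      by apply: eq_Rintegral => x _; rewrite mulrC.
    move=> x Vx; rewrite vS ?mulr0// => Sx; apply: Vx; exact: (@cutoff_support_sub V z Vz j).
  apply/cvgr0Pnorm_le => r r0.
  have D0 : 0 <= D by apply: Rintegral_ge0.
  have rD : 0 < r / (D + 1) by rewrite divr_gt0// ltr_pwDr.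
  have /cvgr0Pnorm_le/(_ _ rD)[m _ mP] := e0.
  exists m => // k /= mk; rewrite ibp normrN.
  have i2 := partial_vanish_rint i cK bS vS (psiK k).
  apply: le_trans (le_normr_Rintegral measurableT i2) _.
  apply: (@le_trans _ _ (\int[mu]_x (r / (D + 1) * `|partial i (cutoff V j) x|))).
    apply: le_Rintegral => //.
    + exact: integrable_norm.
    + by apply: rintZ => //; exact: integrable_norm.
    + move=> x _; rewrite normrM mulrC ler_wpM2r//.
      by apply: le_trans (psie k x) _; apply: le_trans (ler_norm _) (mP k mk).
  rewrite RintegralZl//; last exact: integrable_norm.
  by rewrite -/D mulrAC ler_pdivrMr ?ltr_pwDr// ler_wpM2l ?ltW// ltrDl.
Qed.

End cutoff_functions.

(** * A smooth partition of unity of the line *)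

Section smooth_line.
Context {R : realType}.
Implicit Types (f g : R -> R).

(** N times continuous differentiability, with the derivatives as witnesses so that
    the rules of differentiation apply to them. *)
Fixpoint Ck (N : nat) f : Prop :=
  if N is N'.+1 then exists f' : R -> R, (forall x : R, is_derive x (1 : R) f (f' x)) /\ Ck N' f'
  else continuous f.

Lemma Ck_continuous N f : Ck N f -> continuous f.
Proof.
case: N => [//|N] [f' [df _]] x.
by apply: differentiable_continuous; apply/derivable1_diffP; have [] := df x.
Qed.

Lemma CkW N f : Ck N.+1 f -> Ck N f.
Proof.
elim: N f => [f cf|N IHN f [f' [df cf']]]; first exact: Ck_continuous cf.
by exists f'; split => //; exact: IHN.
Qed.

Lemma Ck_cst N (c : R) : Ck N (cst c).
Proof.
elim: N c => [c|N IHN c]; first by move=> x; exact: cst_continuous.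
by exists (cst 0); split; [move=> x; exact: is_derive_cst|exact: IHN].
Qed.

Lemma CkD N f g : Ck N f -> Ck N g -> Ck N (fun x => f x + g x).
Proof.
elim: N f g => [f g cf cg x|N IHN f g [f' [df cf]] [g' [dg cg]]].
  by apply: continuousD; [exact: cf|exact: cg].
exists (fun x => f' x + g' x); split; last exact: IHN.
by move=> x; apply: is_deriveD.
Qed.

Lemma CkM N f g : Ck N f -> Ck N g -> Ck N (fun x => f x * g x).
Proof.
elim: N f g => [f g cf cg x|N IHN f g Cf Cg].
  by apply: continuousM; [exact: cf|exact: cg].
have [f' [df cf]] := Cf; have [g' [dg cg]] := Cg.
exists (fun x => f x * g' x + g x * f' x); split.
  by move=> x; apply: is_deriveM.
by apply: CkD; apply: IHN => //; exact: CkW.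
Qed.

Lemma CkZ N c f : Ck N f -> Ck N (fun x => c * f x).
Proof. by move=> cf; apply: CkM => //; exact: Ck_cst. Qed.

Lemma CkV N f : (forall x, f x != 0) -> Ck N f -> Ck N (fun x => (f x)^-1).
Proof.
move=> f0; elim: N => [cf x|N IHN Cf].
  by apply: continuousV; [exact: f0|exact: cf].
have [f' [df cf]] := Cf.
exists (fun x => - ((f x)^-1 * (f x)^-1) * f' x); split.
  move=> x; have := is_deriveV (f0 x) (df x).
  by rewrite expr2 invfM.
have CV := IHN (CkW Cf).
apply: CkM => //.
rewrite (_ : (fun x => _) = (fun x => -1 * ((f x)^-1 * (f x)^-1))); last first.
  by apply/funext => x; rewrite mulN1r.
by apply: CkZ; exact: CkM.
Qed.

Lemma is_derive_affine (a b x : R) : is_derive x (1 : R) (fun t => a * t + b) a.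
Proof.
have -> : (fun t : R => a * t + b) = (cst a * id + cst b).
  by apply/funext => t.
apply: is_derive_eq.
by rewrite scaler0 addr0 addr0 /GRing.scale/= mulr1.
Qed.

Lemma Ck_affine N f a b : Ck N f -> Ck N (fun t => f (a * t + b)).
Proof.
elim: N f => [f cf x|N IHN f [f' [df cf]]].
  apply: (@continuous_comp _ _ _ (fun t => a * t + b) f); last exact: cf.
  apply: differentiable_continuous; apply/derivable1_diffP.
  by have [] := is_derive_affine a b x.
exists (fun t => a * f' (a * t + b)); split; last by apply: CkZ; exact: IHN.
move=> x; rewrite mulrC.
exact: (@is_derive1_comp _ f (fun t => a * t + b) x _ _ (df _) (is_derive_affine a b x)).
Qed.

(** The flat function exp(-1/t) and its products by powers of 1/t, a family that
    spans its own derivatives. *)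
Definition expinv (k : nat) (t : R) : R :=
  if 0 < t then t^-1 ^+ k * expR (- t^-1) else 0.

Lemma expX_le (m : nat) (u : R) : 0 <= u -> u ^+ m * expR (- u) <= m%:R ^+ m.
Proof.
move=> u0; case: m => [|m].
  by rewrite !expr0 mul1r -expR0 ler_expR oppr_le0.
set M := m.+1; have M0 : 0 < M%:R :> R by rewrite ltr0n.
rewrite expRN ler_pdivrMr ?expR_gt0//.
have -> : u = M%:R * (u / M%:R) by rewrite mulrC divfK// gt_eqF.
set v := u / M%:R; have v0 : 0 <= v by rewrite divr_ge0// ltW.
rewrite exprMn; apply: ler_wpM2l; first by rewrite exprn_ge0// ltW.
rewrite expRM_natl lerXn2r ?nnegrE ?expR_ge0//.
by apply: le_trans (expR_ge1Dx v); rewrite lerDr.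
Qed.

Lemma expinv_le k t : `|expinv k t| <= k.+2%:R ^+ k.+2 * t ^+ 2.
Proof.
rewrite /expinv; case: ifPn => t0; last by rewrite normr0 mulr_ge0 ?sqr_ge0// exprn_ge0.
have i0 : 0 < t^-1 by rewrite invr_gt0.
rewrite ger0_norm; last by rewrite mulr_ge0 ?expR_ge0// exprn_ge0// ltW.
rewrite -ler_pdivrMr ?exprn_gt0//.
apply: le_trans (expX_le k.+2 (ltW i0)).
rewrite -exprVn mulrAC -exprD addn2 lexx//.
Qed.

Lemma is_derive_expinv k t :
  is_derive t (1 : R) (expinv k) (expinv k.+2 t - k%:R * expinv k.+1 t).
Proof.
have [t0|t0|t0] := ltgtP t 0.
- rewrite /expinv ltNge (ltW t0)/= mulr0 subr0.
  apply: (@near_eq_is_derive _ _ _ (cst 0)).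
  near=> s; rewrite ifF//; apply/negbTE; rewrite -leNgt ltW//.
  by near: s; exact: lt_nbhsl.
- have i0 : t != 0 by rewrite gt_eqF.
  have D1 : is_derive t (1 : R) (fun s : R => s^-1) (- (t^-1 * t^-1)).
    have := @is_deriveV R id t 1 1 i0 (is_derive_id _ _).
    by rewrite /GRing.scale/= mulr1 expr2 invfM.
  have D2 : is_derive t (1 : R) (fun s : R => expR (- s^-1)) (expR (- t^-1) * (t^-1 * t^-1)).
    apply: (@is_derive1_comp _ expR (fun s : R => - s^-1)).
    by rewrite -[X in is_derive _ _ _ X]opprK; exact: is_deriveN.
  have D3 : is_derive t (1 : R) (fun s : R => s^-1 ^+ k) (k%:R * t^-1 ^+ k.-1 * - (t^-1 * t^-1)).
    have := @is_deriveX _ _ (fun s : R => s^-1) k t 1 _ D1.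
    by rewrite exprfctE.
  have D4 := is_deriveM D3 D2.
  have NE : \near t, ((fun s : R => s^-1 ^+ k) * (fun s : R => expR (- s^-1))) t = expinv k t.
    near=> s; rewrite /expinv ifT//; near: s; exact: lt_nbhsr.
  apply: (near_eq_is_derive NE).
  apply: (is_derive_eq D4); rewrite /expinv t0 /GRing.scale/=.
  case: k {D3 D4 NE} => [|k]; first by rewrite !expr0; ring.
  by rewrite /= !exprS; ring.
- rewrite t0 /expinv ltxx mulr0 subr0 -/(expinv k).
  (* near 0 the function is O(t^2) *)
  pose c : R := k.+2%:R ^+ k.+2.
  have c0 : 0 < c + 1 by rewrite ltr_pwDr// exprn_ge0.
  have H : (h^-1 *: ((expinv k \o shift 0) (h *: (1 : R)) - expinv k 0) @[h --> 0^'] --> (0 : R)).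
    apply/cvgrPdist_le => e e0.
    exists (e / (c + 1)); first by rewrite /= divr_gt0.
    move=> h /=; rewrite sub0r normrN => hd h0.
    rewrite sub0r normrN /GRing.scale/= mulr1 addr0.
    have -> : expinv k 0 = 0 by rewrite /expinv ltxx.
    rewrite subr0 normrM normfV ler_pdivrMl ?normr_gt0//.
    apply: le_trans (expinv_le k h) _.
    rewrite -(real_normK (num_real h)) expr2 mulrA [leRHS]mulrC ler_wpM2r//.
    move: (ltW hd); rewrite ler_pdivlMr// => H; apply: le_trans H.
    by rewrite mulrC ler_wpM2l// lerDl.
  apply: DeriveDef; first by apply/cvg_ex; exists 0.
  exact/cvg_lim.
Unshelve. all: by end_near. Qed.

Lemma Ck_expinv N k : Ck N (expinv k).
Proof.
elim: N k => [k x|N IHN k].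
  by apply: differentiable_continuous; apply/derivable1_diffP; have [] := is_derive_expinv k x.
exists (fun t => expinv k.+2 t + - k%:R * expinv k.+1 t).
split; last by apply: CkD; [exact: IHN|apply: CkZ; exact: IHN].
by move=> t; apply: is_derive_eq; [exact: is_derive_expinv|rewrite mulNr].
Qed.

Lemma expinv0_ge0 t : 0 <= expinv 0 t.
Proof. by rewrite /expinv; case: ifPn => // _; rewrite expr0 mul1r expR_ge0. Qed.

Lemma expinv0_gt0 t : 0 < t -> 0 < expinv 0 t.
Proof. by move=> t0; rewrite /expinv t0 expr0 mul1r expR_gt0. Qed.

Lemma expinv0_le0 t : t <= 0 -> expinv 0 t = 0.
Proof. by move=> t0; rewrite /expinv ltNge t0. Qed.

Definition smooth_step (t : R) : R :=
  expinv 0 t * (expinv 0 t + expinv 0 (-1 * t + 1))^-1.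

Lemma smooth_step_den t : 0 < expinv 0 t + expinv 0 (-1 * t + 1).
Proof.
have [t0|t0] := ltP 0 t.
  by apply: ltr_pwDl; [exact: expinv0_gt0|exact: expinv0_ge0].
by apply: ltr_wpDl; [exact: expinv0_ge0|apply: expinv0_gt0; lra].
Qed.

Lemma Ck_smooth_step N : Ck N smooth_step.
Proof.
apply: CkM; first exact: Ck_expinv.
apply: (@CkV N (fun t => expinv 0 t + expinv 0 (-1 * t + 1))).
  by move=> t; rewrite gt_eqF// smooth_step_den.
by apply: CkD; [exact: Ck_expinv|apply: (@Ck_affine N (expinv 0)); exact: Ck_expinv].
Qed.

Lemma smooth_step0 t : t <= 0 -> smooth_step t = 0.
Proof. by move=> t0; rewrite /smooth_step expinv0_le0// mul0r. Qed.

Lemma smooth_step1 t : 1 <= t -> smooth_step t = 1.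
Proof.
move=> t1; have H := smooth_step_den t; move: H; rewrite /smooth_step.
rewrite (@expinv0_le0 (-1 * t + 1)); last by lra.
by rewrite addr0 => /gt_eqF/negbT; exact: divff.
Qed.

Lemma smooth_step_itv t : 0 <= smooth_step t <= 1.
Proof.
have H := smooth_step_den t; apply/andP; split.
  by rewrite divr_ge0 ?expinv0_ge0// ltW.
by rewrite ler_pdivrMr// mul1r lerDl expinv0_ge0.
Qed.

(** The integer translates of this bump form a partition of unity. *)
Definition bump (t : R) : R := smooth_step (1 * t + 1) + -1 * smooth_step t.

Lemma Ck_bump N : Ck N bump.
Proof.
apply: CkD; first by apply: (@Ck_affine N smooth_step); exact: Ck_smooth_step.
by apply: CkZ; exact: Ck_smooth_step.
Qed.

Lemma bump_ge0 t : 0 <= bump t.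
Proof.
rewrite /bump mulN1r subr_ge0 mul1r.
have [t0|t0] := leP t 0.
  by rewrite (smooth_step0 t0); have /andP[] := smooth_step_itv (t + 1).
rewrite [leRHS]smooth_step1; last by lra.
by have /andP[] := smooth_step_itv t.
Qed.

Lemma bump_off t : 1 <= `|t| -> bump t = 0.
Proof.
rewrite ler_normr => /orP[t1|t1]; rewrite /bump.
  by rewrite !smooth_step1; [ring|lra|lra].
by rewrite !smooth_step0; [ring|lra|lra].
Qed.

Lemma bump_sum (P : nat) t : `|t| <= P%:R ->
  \sum_(j < P.*2.+1) bump (t - P%:R + j%:R) = 1.
Proof.
rewrite ler_norml => /andP[t1 t2].
rewrite -(big_mkord xpredT (fun j => bump (t - P%:R + j%:R))).
rewrite (eq_bigr (fun j : nat => smooth_step (t - P%:R + j.+1%:R) - smooth_step (t - P%:R + j%:R))).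
  rewrite telescope_sumr// addr0 (@smooth_step0 (t - P%:R)) ?subr_le0// subr0 smooth_step1//.
  by rewrite -addn1 natrD -muln2 natrM; lra.
move=> j _; rewrite /bump mulN1r mul1r -natr1; congr (smooth_step _ - _); ring.
Qed.

Definition bump' := 'D_(1 : R) bump.

Lemma is_derive_bump t : is_derive t (1 : R) bump (bump' t).
Proof.
have [f' [df _]] := Ck_bump 1.
rewrite /bump'; have H := df t.
by rewrite derive_val.
Qed.

Lemma bump'_off t : 1 < `|t| -> bump' t = 0.
Proof.
move=> t1; rewrite /bump' (@near_eq_derive _ _ _ bump (cst 0)) ?derive_cst//.
have oN : open [set s : R | 1 < `|s|].
  apply: (@open_comp _ _ (fun s : R => `|s|) [set s | 1 < s]).
    by move=> s _; exact: norm_continuous.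
  exact: open_gt.
have : nbhs t [set s : R | 1 < `|s|] by apply: open_nbhs_nbhs.
by apply: filterS => s /= s1; rewrite bump_off// ltW.
Qed.

Lemma bump'_bounded : exists2 M, 0 <= M & forall t, `|bump' t| <= M.
Proof.
have cb : continuous bump'.
  have [f' [df cf]] := Ck_bump 1.
  rewrite (_ : bump' = f')//; apply/funext => t; rewrite /bump'.
  by have H := df t; rewrite derive_val.
have /compact_bounded[M [_ HM]] : compact (bump' @` `[(-1 : R), 1]).
  by apply: continuous_compact; [exact: continuous_subspaceT|exact: segment_compact].
exists (`|M| + 1); first by rewrite addr_ge0.
move=> t; have [t1|t1] := leP `|t| 1; last by rewrite bump'_off// normr0 addr_ge0.
apply: HM; first by rewrite ltr_pwDr// ler_norm.
by exists t => //=; rewrite in_itv/= -ler_norml.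
Qed.

(** Applied to a ramp at the integer translates of a point, it bounds the number of
    translates of an interval that contain the point. *)
Lemma telescope3 (a : nat -> R) Q : (forall k, 0 <= a k <= 1) ->
  \sum_(j < Q) (a j.+3 - a j) <= 3.
Proof.
move=> a01.
rewrite -(big_mkord xpredT (fun j => a j.+3 - a j)).
rewrite (eq_bigr (fun j : nat => (a j.+3 + a j.+2 + a j.+1) - (a j.+2 + a j.+1 + a j))).
  rewrite (telescope_sumr (fun j => a j.+2 + a j.+1 + a j))//.
  have /andP[_ H1] := a01 Q.+2; have /andP[_ H2] := a01 Q.+1.
  have /andP[_ H3] := a01 Q; have /andP[H4 _] := a01 2; have /andP[H5 _] := a01 1.
  have /andP[H6 _] := a01 0%N; lra.
by move=> j _; ring.
Qed.

End smooth_line.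

(** * Smooth functions of several variables *)

Section smooth_functions.
Context {R : realType} {n : nat}.
Implicit Types (f g : 'cV[R]_n -> R) (x y : 'cV[R]_n) (S U V : set 'cV[R]_n).
Implicit Types (b : 'I_n -> R -> R).

Definition smooth1 (p : R -> R) := forall N, Ck N p.

Lemma smooth1_derive (p : R -> R) : smooth1 p ->
  (forall t : R, is_derive t (1 : R) p ('D_(1 : R) p t)) /\ smooth1 ('D_(1 : R) p).
Proof.
move=> sp; split.
  by have [p' [dp _]] := sp 1; move=> t; have H := dp t; rewrite derive_val.
move=> N; have [p' [dp cp]] := sp N.+1.
rewrite (_ : 'D_(1 : R) p = p')//; apply/funext => t.
by have H := dp t; rewrite derive_val.
Qed.

Lemma lip_coord (i : 'I_n) : lip 1 (fun x : 'cV[R]_n => x i 0).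
Proof. by move=> x y; rewrite mul1r; have := entry_le_norm (x - y) i 0; rewrite !mxE. Qed.

Definition tensor b x : R := \prod_i b i (x i 0).

Lemma continuous_tensor b : (forall i, continuous (b i)) -> continuous (tensor b).
Proof.
move=> cb; rewrite /tensor.
have : forall s : seq 'I_n, continuous (fun x : 'cV[R]_n => \prod_(i <- s) b i (x i 0)).
  elim=> [|j s IHs].
    rewrite (_ : (fun x => _) = cst 1); last by apply/funext => x; rewrite big_nil.
    by move=> x; exact: cst_continuous.
  rewrite (_ : (fun x => _) = (fun x : 'cV[R]_n => b j (x j 0) * \prod_(i <- s) b i (x i 0))); last first.
    by apply/funext => x; rewrite big_cons.
  move=> x; apply: continuousM; last exact: IHs.
  apply: (@continuous_comp _ _ _ (fun x : 'cV[R]_n => x j 0) (b j)); last exact: cb.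
  exact: (lip_continuous (lip_coord j)).
exact.
Qed.

Lemma tensor_line b j x (h : R) :
  tensor b (h *: delta_mx j 0 + x) = b j (h + x j 0) * \prod_(i | i != j) b i (x i 0).
Proof.
rewrite /tensor (bigD1 j)//= !mxE !eqxx mulr1; congr (_ * _).
by apply: eq_bigr => i ij; rewrite !mxE (negbTE ij) mulr0 add0r.
Qed.

Lemma is_derive_tensor b j x d : is_derive (x j 0) (1 : R) (b j) d ->
  is_derive x (delta_mx j 0) (tensor b) (d * \prod_(i | i != j) b i (x i 0)).
Proof.
move=> [db dE]; set c := \prod_(_ | _) _.
have H : (h^-1 *: ((tensor b \o shift x) (h *: delta_mx j 0) - tensor b x) @[h --> 0^'] --> d * c).
  rewrite (_ : (fun h : R => _) = (fun h => (h^-1 *: ((b j \o shift (x j 0)) (h *: (1 : R)) - b j (x j 0))) * c)).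
    apply: cvgM; last exact: cvg_cst.
    by rewrite -dE; exact: db.
  apply/funext => h; rewrite /= tensor_line -/c.
  rewrite -[X in tensor b X]add0r -(scale0r (delta_mx j 0 : 'cV[R]_n)) tensor_line add0r -/c.
  by rewrite /GRing.scale/= mulr1; ring.
by apply: DeriveDef; [apply/cvg_ex; exists (d * c)|exact/cvg_lim].
Qed.

Lemma smooth_tensor b : (forall i, smooth1 (b i)) -> smooth (tensor b).
Proof.
move=> sb s.
have [b' [sb' ->]] : exists b', (forall i, smooth1 (b' i)) /\
    foldr (@partial R n) (tensor b) s = tensor b'.
  elim: s => [|j s [b' [sb' E]]]; first by exists b.
  exists (fun i => if i == j then 'D_(1 : R) (b' i) else b' i); split.
    by move=> i; case: eqP => // _; have [] := smooth1_derive (sb' i).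
  rewrite /= E; apply/funext => x; rewrite /partial.
  have H := is_derive_tensor ((smooth1_derive (sb' j)).1 (x j 0)).
  rewrite derive_val /tensor [RHS](bigD1 j)//= eqxx; congr (_ * _).
  by apply: eq_bigr => i /negbTE ->.
split; first by apply: continuous_tensor => i; exact: (Ck_continuous (sb' i 0%N)).
move=> i x.
by have [] := is_derive_tensor ((smooth1_derive (sb' i)).1 (x i 0)).
Qed.

Lemma smoothD_fold f g s : smooth f -> smooth g ->
  foldr (@partial R n) (fun x => f x + g x) s =
  (fun x => foldr (@partial R n) f s x + foldr (@partial R n) g s x).
Proof.
move=> sf sg; elim: s => [//|j s IHs] /=; rewrite IHs; apply/funext => x.
by rewrite /partial deriveD//; [exact: (sf s).2|exact: (sg s).2].
Qed.

Lemma smoothD f g : smooth f -> smooth g -> smooth (fun x => f x + g x).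
Proof.
move=> sf sg s; rewrite smoothD_fold//; split.
  by move=> x; apply: continuousD; [exact: (sf s).1|exact: (sg s).1].
by move=> i x; apply: derivableD; [exact: (sf s).2|exact: (sg s).2].
Qed.

Lemma smoothZ_fold c f s : smooth f ->
  foldr (@partial R n) (fun x => c * f x) s = (fun x => c * foldr (@partial R n) f s x).
Proof.
move=> sf; elim: s => [//|j s IHs] /=; rewrite IHs; apply/funext => x.
by rewrite /partial deriveZ//; exact: (sf s).2.
Qed.

Lemma smoothZ c f : smooth f -> smooth (fun x => c * f x).
Proof.
move=> sf s; rewrite smoothZ_fold//; split.
  by move=> x; apply: continuousM; [exact: cst_continuous|exact: (sf s).1].
by move=> i x; apply: derivableZ; exact: (sf s).2.
Qed.

Lemma smooth_cst0 : smooth (cst 0 : 'cV[R]_n -> R).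
Proof.
have E s : foldr (@partial R n) (cst 0) s = cst 0.
  elim: s => [//|j s IHs] /=; rewrite IHs; apply/funext => x.
  by rewrite /partial derive_cst.
by move=> s; rewrite E; split => [x|i x]; [exact: cst_continuous|exact: derivable_cst].
Qed.

Lemma smooth_sum (I : Type) (s : seq I) (F : I -> 'cV[R]_n -> R) :
  (forall k, smooth (F k)) -> smooth (fun x => \sum_(k <- s) F k x).
Proof.
move=> sF; elim: s => [|k s IHs].
  rewrite (_ : (fun x => _) = cst 0); first exact: smooth_cst0.
  by apply/funext => x; rewrite big_nil.
rewrite (_ : (fun x => _) = (fun x => F k x + \sum_(k <- s) F k x)).
  exact: smoothD.
by apply/funext => x; rewrite big_cons.
Qed.

(** A function with bounded partial derivatives is Lipschitz, by the mean value
    theorem on the segments of a path that changes one coordinate at a time. *)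
Lemma bounded_partial_lip f M : 0 <= M ->
  (forall i x, derivable f x (delta_mx i 0)) ->
  (forall i x, `|partial i f x| <= M) -> lip (n%:R * M) f.
Proof.
move=> M0 df bf x y.
have step j (w : 'cV[R]_n) (s : R) : `|f (s *: delta_mx j 0 + w) - f w| <= M * `|s|.
  pose p (h : R) := f (h *: delta_mx j 0 + w).
  have dp (h : R) : is_derive h (1 : R) p (partial j f (h *: delta_mx j 0 + w)).
    have := df j (h *: delta_mx j 0 + w); rewrite /derivable => D.
    have E : (fun k : R => k^-1 *: ((f \o shift (h *: delta_mx j 0 + w)) (k *: delta_mx j 0) - f (h *: delta_mx j 0 + w)))
       = (fun k : R => k^-1 *: ((p \o shift h) (k *: (1 : R)) - p h)).
      apply/funext => k; rewrite /p /= /GRing.scale/= mulr1; congr (_ * (f _ - _)).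
      by rewrite addrA -scalerDl.
    apply: DeriveDef; first by rewrite /derivable -E.
    by rewrite /derive -E.
  have E0 : p 0 = f w by rewrite /p scale0r add0r.
  have mvt (a q : R) : a <= q -> `|p q - p a| <= M * (q - a).
    move=> ab.
    have cp : {within `[a, q], continuous p}.
      apply: continuous_subspaceT => t; apply: differentiable_continuous.
      by apply/derivable1_diffP; have [] := dp t.
    have [c _ ->] := @MVT_segment R p (fun h => partial j f (h *: delta_mx j 0 + w)) a q ab (fun h _ => dp h) cp.
    by rewrite normrM [`|q - a|]ger0_norm ?subr_ge0// ler_wpM2r ?subr_ge0.
  rewrite -/(p s) -E0; have [s0|s0] := leP 0 s.
    by have := mvt 0 s s0; rewrite subr0 (ger0_norm s0).
  rewrite distrC (ltr0_norm s0); have := mvt s 0 (ltW s0); rewrite sub0r//.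
pose z (k : nat) : 'cV[R]_n := \col_i (if (i < k)%N then x i 0 else y i 0).
have zS (k : 'I_n) : z k.+1 = (x k 0 - y k 0) *: delta_mx k 0 + z k.
  apply/colP => i; rewrite !mxE eqxx andbT ltnS.
  case: (ltngtP i k) => [ik|ki|/val_inj ->].
  - by rewrite (_ : (i == k) = false) ?mulr0 ?add0r//; apply/negbTE; rewrite -val_eqE ltn_eqF.
  - by rewrite (_ : (i == k) = false) ?mulr0 ?add0r//; apply/negbTE; rewrite -val_eqE gtn_eqF.
  - by rewrite eqxx mulr1 subrK.
have z0 : z 0%N = y by apply/colP => i; rewrite mxE.
have zn : z n = x by apply/colP => i; rewrite mxE ltn_ord.
have -> : f x - f y = \sum_(k < n) (f (z k.+1) - f (z k)).
  by rewrite -(big_mkord xpredT (fun k => f (z k.+1) - f (z k))) telescope_sumr// zn z0.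
apply: le_trans (ler_norm_sum _ _ _) _.
apply: (@le_trans _ _ (\sum_(k < n) M * `|x - y|)).
  apply: ler_sum => k _; rewrite zS; apply: le_trans (step _ _ _) _.
  by rewrite ler_wpM2l//; have := entry_le_norm (x - y) k 0; rewrite !mxE.
by rewrite sumr_const card_ord -mulrA mulr_natl.
Qed.

End smooth_functions.

(** * Smooth approximation of Lipschitz functions *)

Section smooth_approximation.
Context {R : realType} {n : nat}.
Implicit Types (f g : 'cV[R]_n -> R) (x y : 'cV[R]_n) (S U V : set 'cV[R]_n).

(** The difference of two translates of this ramp is 1 where a derivative of a bump
    may be nonzero, so that the sum below telescopes. *)
Definition ramp (t : R) : R := Num.min 1 (Num.max 0 t).

Lemma ramp_itv t : 0 <= ramp t <= 1.
Proof. by rewrite /ramp ge_min lexx andbT le_min ler01 le_max lexx. Qed.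

Lemma bump'_sum (M : R) (Q : nat) (t : R) : 0 <= M -> (forall t : R, `|bump' t| <= M) ->
  \sum_(j < Q) `|bump' (t + j%:R)| <= M * 3.
Proof.
move=> M0 bM.
apply: (@le_trans _ _ (\sum_(j < Q) M * (ramp (t + j.+3%:R - 1) - ramp (t + j%:R - 1)))).
  apply: ler_sum => j _; set u := t + j%:R.
  have -> : t + j.+3%:R - 1 = u + 2 by rewrite /u -addn3 natrD; ring.
  have [u1|u1] := leP `|u| 1; last first.
    rewrite bump'_off// normr0 mulr_ge0// subr_ge0 /ramp le_min ge_min lexx/=.
    by rewrite ge_min; apply/orP; right; rewrite ge_max !le_max lexx/=; apply/orP; right; lra.
  move: u1; rewrite ler_norml => /andP[u1 u2].
  have -> : ramp (u + 2) = 1 by rewrite /ramp min_l// le_max; apply/orP; right; lra.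
  have -> : ramp (u - 1) = 0 by rewrite /ramp max_l ?min_r//; lra.
  by rewrite subr0 mulr1.
rewrite -mulr_sumr ler_wpM2l//.
by apply: (telescope3 (a := fun j => ramp (t + j%:R - 1))) => k; exact: ramp_itv.
Qed.

Lemma is_derive_sum_seq (I : Type) (s : seq I) (F : I -> 'cV[R]_n -> R) (dF : I -> R) x v :
  (forall k, is_derive x v (F k) (dF k)) ->
  is_derive x v (fun x => \sum_(k <- s) F k x) (\sum_(k <- s) dF k).
Proof.
move=> HF; elim: s => [|k s IHs].
  rewrite big_nil (_ : (fun x => _) = cst 0); first exact: is_derive_cst.
  by apply/funext => y; rewrite big_nil.
rewrite big_cons (_ : (fun x => _) = F k + (fun x => \sum_(k <- s) F k x)).
  exact: is_deriveD.
by apply/funext => y; rewrite big_cons.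
Qed.

Variables (phi : 'cV[R]_n -> R) (K N : R) (m : nat).
Hypotheses (K0 : 0 <= K) (N0 : 0 <= N) (phiK : lip K phi).
Hypothesis phiN : vanish_off (nball N) phi.

Let e : R := m.+1%:R^-1.
(* the nodes cover the ball of radius N + 2, and phi vanishes out of radius N *)
Let P : nat := ((Num.bound N).+2 * m.+1)%N.
Let idx := {ffun 'I_n -> 'I_(P.*2.+1)}.

Let e0 : 0 < e. Proof. by rewrite invr_gt0. Qed.
Let em : e * m.+1%:R = 1. Proof. by rewrite mulVf// pnatr_eq0. Qed.
Let e1 : e <= 1. Proof. by rewrite invf_le1// ler1n. Qed.

Let node (k : idx) : 'cV[R]_n := \col_i (e * (P%:R - (k i)%:R)).
Let arg (k : idx) (i : 'I_n) (t : R) : R := m.+1%:R * t + ((k i)%:R - P%:R).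
Let hat (k : idx) : 'cV[R]_n -> R := tensor (fun i t => bump (arg k i t)).

(** Interpolation of phi between the nodes of a grid of mesh e by a smooth
    partition of unity. It is a finite sum of smooth functions, where a convolution
    would have to be differentiated under the integral sign. *)
Definition smoothing x : R := \sum_(k : idx) phi (node k) * hat k x.

Let far_entry k x : e < `|x - node k| -> exists i, 1 < `|arg k i (x i 0)|.
Proof.
move=> H; apply: contrapT => /forallNP H1.
move: H; rewrite ltNge => /negP; apply; apply: norm_le_entries; first exact: ltW.
move=> i j; rewrite (ord1 j) !mxE.
have /negP := H1 i; rewrite -leNgt => {}H1.
have -> : x i 0 - e * (P%:R - (k i)%:R) = e * arg k i (x i 0).
  by rewrite /arg [RHS]mulrDr [e * (_ * x i 0)]mulrA em mul1r; ring.
by rewrite normrM (gtr0_norm e0) ler_piMr// ltW.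
Qed.

Let hat_far k x : e < `|x - node k| -> hat k x = 0.
Proof.
move=> /far_entry[i Hi]; rewrite /hat /tensor (bigD1 i)//= bump_off ?mul0r//.
exact: ltW.
Qed.

Let region x := `|x| <= N + 2.

Let region_P x i : region x -> `|m.+1%:R * x i 0| <= P%:R.
Proof.
move=> rx; rewrite normrM ger0_norm// /P natrM mulrC ler_wpM2r//.
apply: le_trans (entry_le_norm x i 0) _; apply: (le_trans rx).
rewrite -[(Num.bound N).+2]addn2 natrD lerD2r.
by apply: ltW; rewrite (archi_boundP N0).
Qed.

Let hat_sum x : region x -> \sum_(k : idx) hat k x = 1.
Proof.
move=> rx; rewrite /hat /tensor.
rewrite -(bigA_distr_bigA (fun i (j : 'I_(P.*2.+1)) => bump (m.+1%:R * x i 0 + (j%:R - P%:R)))).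
apply: big1 => i _; rewrite -[RHS](bump_sum (region_P i rx)).
by apply: eq_bigr => j _; congr (bump _); ring.
Qed.

Let hat_ge0 k x : 0 <= hat k x.
Proof. by apply: prodr_ge0 => i _; exact: bump_ge0. Qed.

Lemma smoothing_vanish : vanish_off (nball (N + 1)) smoothing.
Proof.
move=> x xN; apply: big1 => k _.
have [H|H] := ltP e `|x - node k|; first by rewrite hat_far// mulr0.
rewrite phiN ?mul0r// => kN; apply: xN; rewrite /nball /=.
rewrite -(subrK (node k) x) addrC; apply: le_trans (ler_normD _ _) _.
by apply: lerD => //; apply: (le_trans H).
Qed.

Lemma smoothing_support S x : vanish_off S phi -> smoothing x != 0 ->
  exists2 y, S y & `|x - y| <= m.+1%:R^-1.
Proof.
move=> pS sx; apply: contrapT => H; move/negP: sx; apply; apply/eqP.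
apply: big1 => k _.
have [D|D] := ltP e `|x - node k|; first by rewrite hat_far// mulr0.
by rewrite pS ?mul0r// => kS; apply: H; exists (node k).
Qed.

Lemma smoothing_close x : `|smoothing x - phi x| <= K * m.+1%:R^-1.
Proof.
have [xN|xN] := pselect (nball (N + 1) x); last first.
  rewrite smoothing_vanish// phiN ?subrr ?normr0 ?mulr_ge0 ?(ltW e0)//.
  by move=> H; apply: xN; apply: le_trans H _; rewrite lerDl.
have rx : region x by apply: le_trans xN _; rewrite lerD2l ler1n.
rewrite -[phi x]mulr1 -(hat_sum rx) mulr_sumr -sumrB.
apply: le_trans (ler_norm_sum _ _ _) _.
apply: (@le_trans _ _ (\sum_(k : idx) (K * e) * hat k x)); last first.
  by rewrite -mulr_sumr hat_sum// mulr1.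
apply: ler_sum => k _; rewrite -mulrBl normrM (ger0_norm (hat_ge0 k x)).
have [H|H] := ltP e `|x - node k|; first by rewrite hat_far// !mulr0.
apply: ler_wpM2r; first exact: hat_ge0.
by apply: le_trans (phiK _ _) _; rewrite distrC ler_wpM2l.
Qed.

Let is_derive_hat k i x :
  is_derive x (delta_mx i 0) (hat k)
    (bump' (arg k i (x i 0)) * m.+1%:R * \prod_(j | j != i) bump (arg k j (x j 0))).
Proof.
apply: (@is_derive_tensor _ _ (fun i t => bump (arg k i t))).
apply: (@is_derive1_comp _ bump (fun t => arg k i t)); first exact: is_derive_bump.
exact: is_derive_affine.
Qed.

Lemma smooth_smoothing : smooth smoothing.
Proof.
apply: (@smooth_sum _ _ _ _ (fun k x => phi (node k) * hat k x)) => k.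
apply: smoothZ; apply: smooth_tensor => i M.
by apply: (@Ck_affine _ M bump); exact: Ck_bump.
Qed.

(** The hats sum to 1, so that phi may be replaced by its difference with phi x;
    on the hats that matter at x this difference is at most K e, which
    compensates the factor 1/e of their derivatives. *)
Lemma smoothing_partial (M : R) i x : 0 <= M -> (forall t : R, `|bump' t| <= M) ->
  `|partial i smoothing x| <= K * (M * 3).
Proof.
move=> M0 bM.
have [xN|xN] := pselect (nball (N + 1) x); last first.
  rewrite (partial_vanish i (@closed_nball _ _ (N + 1)) smoothing_vanish)//.
  by rewrite normr0 !mulr_ge0.
have rx : region x by apply: le_trans xN _; rewrite lerD2l ler1n.
pose G y := \sum_(k : idx) (phi (node k) - phi x) * hat k y.
pose c0 := phi x.
have NG : \near x, G x = (smoothing - cst c0) x.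
  apply/nbhs_ballP; exists 1 => //= y; rewrite -ball_normE /= => xy.
  have ry : region y.
    rewrite /region -(subrK x y) addrC; apply: le_trans (ler_normD _ _) _.
    rewrite (_ : 2 = 1 + 1 :> R)// addrA; apply: lerD => //.
    by rewrite distrC ltW.
  rewrite /G /smoothing !fctE /=.
  under eq_bigr do rewrite mulrBl.
  by rewrite sumrB -mulr_sumr hat_sum// mulr1.
have dS : derivable smoothing x (delta_mx i 0) by exact: (smooth_smoothing [::]).2.
have -> : partial i smoothing x = partial i G x.
  by rewrite /partial (near_eq_derive _ NG) deriveB// derive_cst subr0.
have dG : is_derive x (delta_mx i 0) G (\sum_(k : idx) (phi (node k) - phi x) *
    (bump' (arg k i (x i 0)) * m.+1%:R * \prod_(j | j != i) bump (arg k j (x j 0)))).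
  apply: (@is_derive_sum_seq _ _ (fun k y => (phi (node k) - phi x) * hat k y)) => k.
  exact: (@is_deriveZ _ _ _ (hat k) _ x (delta_mx i 0) _ (is_derive_hat k i x)).
rewrite /partial derive_val; apply: le_trans (ler_norm_sum _ _ _) _.
pose c (j : 'I_n) (l : 'I_(P.*2.+1)) : R :=
  if j == i then `|bump' (m.+1%:R * x j 0 + (l%:R - P%:R))|
  else bump (m.+1%:R * x j 0 + (l%:R - P%:R)).
have prodc (k : idx) : \prod_j c j (k j) =
    `|bump' (arg k i (x i 0))| * \prod_(j | j != i) bump (arg k j (x j 0)).
  rewrite (bigD1 i)//= /c eqxx; congr (_ * _).
  by apply: eq_bigr => j /negbTE ->.
apply: (@le_trans _ _ (\sum_(k : idx) K * \prod_j c j (k j))).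
  apply: ler_sum => k _; rewrite prodc.
  have p0 : 0 <= \prod_(j | j != i) bump (arg k j (x j 0)).
    by apply: prodr_ge0 => j _; exact: bump_ge0.
  have [/far_entry[a Ha]|H] := ltP e `|x - node k|.
    have [ai|ai] := eqVneq a i.
      by rewrite -ai bump'_off// !mul0r mulr0 normr0 mul0r mulr0.
    by rewrite (bigD1 a)//= bump_off ?(ltW Ha)// mul0r !mulr0 normr0.
  rewrite normrM.
  have -> : `|bump' (arg k i (x i 0)) * m.+1%:R * \prod_(j | j != i) bump (arg k j (x j 0))|
     = m.+1%:R * (`|bump' (arg k i (x i 0))| * \prod_(j | j != i) bump (arg k j (x j 0))).
    by rewrite !normrM (ger0_norm p0) (@ger0_norm _ m.+1%:R)//; ring.
  set A := (X in K * X); have A0 : 0 <= A by rewrite /A mulr_ge0.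
  apply: (@le_trans _ _ ((K * e) * (m.+1%:R * A))).
    apply: ler_wpM2r; first by rewrite mulr_ge0.
    by apply: le_trans (phiK _ _) _; rewrite distrC ler_wpM2l.
  by rewrite -mulrA (mulrA e) em mul1r.
rewrite -mulr_sumr ler_wpM2l//.
rewrite -(bigA_distr_bigA c) (bigD1 i)//= [X in _ * X]big1 ?mulr1.
  rewrite /c eqxx.
  rewrite (eq_bigr (fun l : 'I_(P.*2.+1) => `|bump' (m.+1%:R * x i 0 - P%:R + l%:R)|)).
    exact: bump'_sum.
  by move=> l _; congr (`|bump' _|); ring.
move=> j /negbTE ji; rewrite /c ji -[RHS](bump_sum (region_P j rx)).
by apply: eq_bigr => l _; congr (bump _); ring.
Qed.

End smooth_approximation.

(** * Fundamental lemma of the calculus of variations *)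

Section square_integrable_classes.
Context {R : realType} {n : nat}.
Local Notation mu := (@leb R n).
Implicit Types (f g : 'cV[R]_n -> R) (U : set 'cV[R]_n).

Lemma restrict_sqr f U x : ((f \_ U) x) ^+ 2 = ((fun x => f x ^+ 2) \_ U) x.
Proof.
by rewrite !restrict_indicE indicE; case: (_ \in _) => /=; rewrite ?mulr1// !mulr0 expr0n.
Qed.

Lemma integral_sqr_restrict f U :
  (\int[mu]_x (`| ((EFin \o (f \_ U)) x : \bar R) | `^ 2)%E =
   \int[mu]_(x in U) (f x ^+ 2)%:E)%E.
Proof.
rewrite [RHS]integral_mkcond; apply: eq_integral => x _ /=.
rewrite (restrict_EFin (fun x => f x ^+ 2) U)/= -restrict_sqr powR_mulrn//.
by rewrite -normrX ger0_norm// sqr_ge0.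
Qed.

Lemma L2_sqint U f : measurable (U : set (eucl R n)) -> L2 U f <-> sqint mu U f.
Proof.
move=> mU; split.
  move=> H; have i2 := Lfun2_integrable_sqr H.
  have mf : measurable_fun (setT : set (eucl R n)) (f \_ U).
    by move: H; rewrite /L2 inE => /andP[]; rewrite inE.
  split; first exact/(measurable_restrictT _ mU).2.
  rewrite /rint (integrable_mkcond _ mU).
  apply: eq_integrable i2 => // x _; rewrite /= restrict_sqr.
  by rewrite (restrict_EFin (fun x => f x ^+ 2) U).
move=> [mf i2].
have mf' : measurable_fun (setT : set (eucl R n)) (f \_ U).
  exact/(measurable_restrictT _ mU).1.
rewrite /L2 inE; apply/andP; split; first by rewrite inE.
rewrite inE /= /finite_norm unlock /=.
apply: poweR_lty; rewrite integral_sqr_restrict.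
have /integrableP[_] := i2; apply: le_lt_trans; rewrite le_eqVlt; apply/orP; left; apply/eqP.
by apply: eq_integral => x _ /=; rewrite ger0_norm// sqr_ge0.
Qed.

Lemma L2_cvg_Rint U (uh : nat -> 'cV[R]_n -> R) (u : 'cV[R]_n -> R) :
  measurable (U : set (eucl R n)) -> (forall h, sqint mu U (fun x => uh h x - u x)) ->
  L2_cvg U uh u -> \int[mu]_(x in U) ((uh h x - u x) ^+ 2) @[h --> \oo] --> 0.
Proof.
move=> mU sd cu.
pose N h := Lnorm mu 2%:E (EFin \o ((uh h \- u) \_ U)).
have NE h : (N h `^ 2)%E = (\int[mu]_(x in U) ((uh h x - u x) ^+ 2)%:E)%E.
  rewrite /N poweR_Lnorm ?pnatr_eq0//.
  exact: (integral_sqr_restrict (fun x => uh h x - u x) U).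
have N0 h : (0 <= N h)%E by exact: Lnorm_ge0.
have Nf h : N h \is a fin_num.
  rewrite ge0_fin_numE//; have : L2 U (fun x => uh h x - u x) by exact/L2_sqint.
  by rewrite /L2 inE => /andP[_]; rewrite inE.
have E h : \int[mu]_(x in U) ((uh h x - u x) ^+ 2) = fine (N h) ^+ 2.
  rewrite /Rintegral -NE -[X in (X `^ _)%E](fineK (Nf h)) /= powR_mulrn//.
  by rewrite fine_ge0.
rewrite (_ : (fun h => _) = (fun h => fine (N h) * fine (N h))).
  by rewrite -(mulr0 0); apply: cvgM; exact: (fine_cvg cu).
by apply/funext => h; rewrite E expr2.
Qed.

Lemma sqint_Rint0_ae U f : measurable (U : set (eucl R n)) -> sqint mu U f ->
  \int[mu]_(x in U) (f x ^+ 2) = 0 -> {ae mu, forall x, U x -> f x = 0}.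
Proof.
move=> mU [mf i2] f0.
have m2 : measurable_fun (U : set (eucl R n)) (EFin \o (fun x => f x ^+ 2)).
  by apply/measurable_EFinP; exact: measurable_funX.
pose F := EFin \o (fun x => f x ^+ 2).
have H : (\int[mu]_(x in U) `|F x| = 0)%E.
  transitivity (\int[mu]_(x in U) F x)%E.
    by apply: eq_integral => x _; rewrite /F /= ger0_norm// sqr_ge0.
  have fi : (\int[mu]_(x in U) F x)%E \is a fin_num by exact: integrable_fin_num.
  by rewrite -(fineK fi); congr EFin.
have /(ae_eq_integral_abs mu mU m2) := H.
apply: ae_imply => x /[apply] /= -[]/eqP; rewrite sqrf_eq0 => /eqP.
exact.
Qed.

(** The cutoff functions of a box tend to its indicator, hence f has zero integral
    on all boxes; by the weak convergence on boxes of the constant sequence f,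
    it is orthogonal to itself. *)
Lemma orthogonal_lip_ae0 U f : (0 < n)%N -> open U -> bounded_set U ->
  sqint mu U f ->
  (forall eta j K, lip K eta -> vanish_off (cutoff_support U j) eta ->
     \int[mu]_(x in U) (f x * eta x) = 0) ->
  {ae mu, forall x, U x -> f x = 0}.
Proof.
move=> n0 oU bU sf fo.
have mU := open_leb_measurable oU; have Uoo := bounded_leb_lty bU.
apply: sqint_Rint0_ae => //.
suff H : \int[mu]_(x in U) (f x * f x) @[k --> \oo] --> 0.
  rewrite (_ : \int[mu]_(x in U) _ = \int[mu]_(x in U) (f x * f x)).
    by apply/esym; apply: (cvg_unique _ H) => //; exact: cvg_cst.
  by apply: eq_Rintegral => x _; rewrite expr2.
apply: (@weak_cvg_boxes _ _ U (fun _ => f) (\int[mu]_(x in U) (f x ^+ 2))) => // a b.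
set V := U `&` obox a b.
have oV : open V by apply: openI => //; exact: open_obox.
have VU : V `<=` U by exact: subIsetl.
have bV : bounded_set V := bounded_setS VU bU.
have mV := open_leb_measurable oV; have Voo := bounded_leb_lty bV.
have [z Uz] := bounded_compl_nonempty n0 bU.
have Vz : ~ V z by move=> /VU.
have sV : sqint mu V f by exact: sqintS sf.
have ssub j : cutoff_support V j `<=` cutoff_support U j.
  move=> x; rewrite /cutoff_support /= => /le_trans; apply.
  apply: lb_le_inf; first by exists `|x - z|, z.
  move=> _ [y Uy <-].
  have H : has_lbound [set `|x - y| | y in ~` V] by exists 0 => _ [w _ <-].
  by have := inf_lbound H; apply; exists y => // /VU.
have cv : \int[mu]_(x in V) (f x * cutoff V j x) @[j --> \oo] --> \int[mu]_(x in V) f x.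
  apply: (@Rint_dct _ _ _ mu V (fun j x => f x * cutoff V j x) f (fun x => `|f x|) mV _ _ _ _ _).2.
  - move=> j; apply: (@measurable_funM _ (eucl R n)); first by have [] := sV.
    by apply: continuous_on_measurable => // x _; exact: (lip_continuous (lip_cutoff Vz j)).
  - by have [] := sV.
  - by apply: integrable_norm; exact: sqint_rint.
  - apply: aeW => x Vx; rewrite -[X in _ --> X]mulr1.
    by apply: cvgM; [exact: cvg_cst|exact: (cutoff_cvg Vz)].
  - apply: aeW => x j Vx; rewrite normrM; have /andP[? ?] := cutoff_itv V j x.
    by rewrite ler_piMr// ger0_norm.
have E0 j : \int[mu]_(x in V) (f x * cutoff V j x) = 0.
  have vS := @vanish_cutoff _ _ V j.
  have vV : vanish_off V (fun x => f x * cutoff V j x).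
    move=> x Vx; rewrite vS ?mulr0// => Sx; apply: Vx; exact: (@cutoff_support_sub _ _ V z Vz j).
  rewrite vanish_Rint// -(@vanish_Rint _ _ U).
    by apply: (fo _ j _ (lip_cutoff Vz j)); exact: vanish_off_sub (ssub j) vS.
  exact: vanish_off_sub vV.
move: cv; rewrite (_ : (fun j => _) = cst 0); last by apply/funext => j; rewrite E0.
move=> c0; rewrite (_ : \int[mu]_(x in V) f x = 0); first exact: cvg_cst.
by apply/esym; apply: (cvg_unique _ _ c0) => //; exact: cvg_cst.
Qed.

End square_integrable_classes.

(** * X-gradients and Lipschitz test fields *)

Section X_gradient.
Context {R : realType} {m n : nat}.
Local Notation mu := (@leb R n).
Implicit Types (U S V : set 'cV[R]_n) (C : 'cV[R]_n -> 'M[R]_(m, n)).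
Implicit Types (u : 'cV[R]_n -> R) (g phi : 'cV[R]_n -> 'cV[R]_m).

Definition coef_bounds U C (L M : R) : Prop :=
  [/\ 0 <= L, 0 <= M,
    forall x y j i, U x -> U y -> `|C x j i - C y j i| <= L * `|x - y| &
    forall x j i, U x -> `|C x j i| <= M].

Lemma coef_boundsS U V C L M : V `<=` U -> coef_bounds U C L M -> coef_bounds V C L M.
Proof.
by move=> VU [L0 M0 cL cM]; split => // [x y j i /VU Ux /VU Uy|x j i /VU Ux];
  [exact: cL|exact: cM].
Qed.

Lemma lipschitz_in_bounds U C : bounded_set U -> lipschitz_in U C ->
  exists L M, coef_bounds U C L M.
Proof.
move=> bU [K CK].
have {}CK x y : U x -> U y -> `|C x - C y| <= `|K| * `|x - y|.
  move=> Ux Uy; apply: (le_trans (CK (x, y) (conj Ux Uy))).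
  by rewrite ler_wpM2r// ler_norm.
have [N N0 UN] := bounded_sub_nball bU.
have [[x0 Ux0]|U0] := pselect (exists x0, U x0); last first.
  exists 0, 0; split => // [x y j i Ux|x j i Ux]; by case: U0; exists x.
exists `|K|, (`|C x0| + `|K| * (N + N)); split => //.
- by rewrite addr_ge0// mulr_ge0// addr_ge0.
- move=> x y j i Ux Uy; apply: le_trans (CK x y Ux Uy).
  by have := entry_le_norm (C x - C y) j i; rewrite !mxE.
- move=> x j i Ux; apply: (le_trans (entry_le_norm _ _ _)).
  rewrite -(subrK (C x0) (C x)) addrC; apply: le_trans (ler_normD _ _) _.
  rewrite lerD2l; apply: le_trans (CK _ _ Ux Ux0) _.
  rewrite ler_wpM2l//; apply: le_trans (ler_normB _ _) _.
  by apply: lerD; exact: UN.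
Qed.

Lemma lipD K L (f h : 'cV[R]_n -> R) : lip K f -> lip L h -> lip (K + L) (fun x => f x + h x).
Proof.
move=> fK hL x y; rewrite opprD addrACA mulrDl.
by apply: le_trans (ler_normD _ _) _; exact: lerD.
Qed.

Lemma lip_sum I (s : seq I) (F : I -> 'cV[R]_n -> R) K :
  (forall k, lip K (F k)) -> lip ((size s)%:R * K) (fun x => \sum_(k <- s) F k x).
Proof.
move=> FK; elim: s => [|k s IHs] x y.
  by rewrite !big_nil subrr normr0 mul0r mul0r.
rewrite !big_cons /=; have := lipD (FK k) IHs x y.
by rewrite -natr1 [(_ + 1) * K]mulrDl mul1r [_ * K + K]addrC.
Qed.

(** The i-th component of the field whose divergence defines the distributional
    X-gradient. *)
Definition pull C phi (i : 'I_n) (x : 'cV[R]_n) : R := \sum_j C x j i * phi x j 0.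

Lemma pullE C phi i : (fun x => ((C x)^T *m phi x) i 0) = pull C phi i.
Proof.
by apply/funext => x; rewrite mxE; apply: eq_bigr => j _; rewrite mxE.
Qed.

Lemma divergence_pull C phi x :
  divergence (fun y => (C y)^T *m phi y) x = \sum_i partial i (pull C phi i) x.
Proof. by apply: eq_bigr => i _; rewrite pullE. Qed.

Lemma lip_pull U S C L M phi K B i : coef_bounds U C L M -> S `<=` U -> 0 <= K ->
  0 <= B -> (forall j, lip K (fun x => phi x j 0)) ->
  (forall j, vanish_off S (fun x => phi x j 0)) ->
  (forall j x, `|phi x j 0| <= B) ->
  lip (m%:R * (B * L + K * M)) (pull C phi i).
Proof.
move=> [L0 M0 cL cM] SU K0 B0 pK pS pB; rewrite /pull.
have H j : lip (B * L + K * M) (fun x => C x j i * phi x j 0).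
  have := @lip_mul _ _ S (fun x => phi x j 0) (fun x => C x j i) K L B M (pK j) (pS j) (pB j)
    (fun x y Sx Sy => cL x y j i (SU _ Sx) (SU _ Sy)) (fun x Sx => cM x j i (SU _ Sx)).
  rewrite !ger0_norm// => H x y; have := H x y.
  by rewrite ![phi _ j 0 * _]mulrC.
have := lip_sum (index_enum 'I_m) H.
rewrite (_ : size (index_enum 'I_m) = m)//.
by rewrite -[LHS](count_predT) -sum1_count sum1_card card_ord.
Qed.

Lemma vanish_pull S C phi i : (forall j, vanish_off S (fun x => phi x j 0)) ->
  vanish_off S (pull C phi i).
Proof.
by move=> pS x Sx; rewrite /pull big1// => j _; rewrite pS// mulr0.
Qed.

Lemma pull_bound U S C L M phi B i x : coef_bounds U C L M -> S `<=` U ->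
  0 <= B -> (forall j, vanish_off S (fun x => phi x j 0)) ->
  (forall j x, `|phi x j 0| <= B) -> `|pull C phi i x| <= m%:R * (M * B).
Proof.
move=> [L0 M0 cL cM] SU B0 pS pB.
have [Sx|Sx] := pselect (S x); last first.
  by rewrite (vanish_pull C i pS Sx) normr0 !mulr_ge0.
apply: le_trans (ler_norm_sum _ _ _) _.
apply: (@le_trans _ _ (\sum_(j < m) M * B)).
  by apply: ler_sum => j _; rewrite normrM ler_pM// cM//; exact: SU.
by rewrite sumr_const card_ord mulr_natl.
Qed.

End X_gradient.

Section X_gradient_theory.
Context {R : realType} {m n : nat}.
Local Notation mu := (@leb R n).
Implicit Types (U S V : set 'cV[R]_n) (C : 'cV[R]_n -> 'M[R]_(m, n)).
Implicit Types (u : 'cV[R]_n -> R) (g phi : 'cV[R]_n -> 'cV[R]_m).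

Lemma compact_vanish_bounded S (f : 'cV[R]_n -> R) : compact S -> continuous f ->
  vanish_off S f -> exists2 M, 0 <= M & forall x, `|f x| <= M.
Proof.
move=> cS cf fS.
have /compact_bounded[M [_ HM]] : compact (f @` S).
  by apply: continuous_compact => //; exact: continuous_subspaceT.
exists (`|M| + 1); first by rewrite addr_ge0.
move=> x; have [Sx|Sx] := pselect (S x); last by rewrite fS// normr0 addr_ge0.
by apply: HM; [rewrite ltr_pwDr// ler_norm|exists x].
Qed.

Lemma finite_bounds (I : finType) (P : I -> R -> Prop) :
  (forall i M M', M <= M' -> P i M -> P i M') ->
  (forall i, exists2 M, 0 <= M & P i M) -> exists2 M, 0 <= M & forall i, P i M.
Proof.
move=> mono ex.
have ex' i : exists M, 0 <= M /\ P i M by have [M ? ?] := ex i; exists M.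
have [F FP] := choice ex'.
exists (\sum_i F i); first by apply: sumr_ge0 => i _; have [] := FP i.
move=> i; apply: (mono i (F i)); last by have [] := FP i.
by rewrite (bigD1 i)//= lerDl; apply: sumr_ge0 => j _; have [] := FP j.
Qed.

Lemma test_function_lip U phi : test_function U phi ->
  exists S K B, [/\ compact S, S `<=` U, 0 <= K /\ 0 <= B &
    [/\ forall j, lip K (fun x => phi x j 0),
      forall j, vanish_off S (fun x => phi x j 0) & forall j x, `|phi x j 0| <= B]].
Proof.
move=> [sphi [S [cS SU pS]]].
have vS j : vanish_off S (fun x => phi x j 0) by move=> x /pS ->; rewrite mxE.
have [B B0 BP] : exists2 B, 0 <= B & forall j x, `|phi x j 0| <= B.
  apply: (@finite_bounds _ (fun j B => forall x, `|phi x j 0| <= B)).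
    by move=> j M M' MM H x; exact: le_trans (H x) MM.
  move=> j; apply: (compact_vanish_bounded cS _ (vS j)).
  exact: (sphi j [::]).1.
have clS : closed S by apply: compact_closed => //; exact: norm_hausdorff.
have [K K0 KP] : exists2 K, 0 <= K & forall ji : 'I_m * 'I_n, forall x, `|partial ji.2 (fun x => phi x ji.1 0) x| <= K.
  apply: (@finite_bounds _ (fun (ji : 'I_m * 'I_n) K => forall x, `|partial ji.2 (fun x => phi x ji.1 0) x| <= K)).
    by move=> j M M' MM H x; exact: le_trans (H x) MM.
  move=> [j i]; apply: (compact_vanish_bounded cS).
    exact: (sphi j [:: i]).1.
  by apply: partial_vanish => //; exact: vS.
exists S, (n%:R * K), B; split => //; first by split => //; rewrite mulr_ge0.
split => // j; apply: (bounded_partial_lip K0) => [i x|i x].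
  exact: (sphi j [::]).2.
exact: (KP (j, i) x).
Qed.

Lemma sqint_dot U g phi : measurable (U : set (eucl R n)) ->
  (forall j, sqint mu U (fun x => g x j 0)) ->
  (forall j, sqint mu U (fun x => phi x j 0)) ->
  rint mu U (fun x => dot (g x) (phi x)).
Proof.
move=> mU sg sp; rewrite /dot.
elim: (index_enum _) => [|j s IHs].
  apply: (@eq_rint _ _ _ mu U (cst 0) _ mU); last exact: integrable0.
  by move=> x _; rewrite big_nil.
apply: (@eq_rint _ _ _ mu U _ _ mU _ (rintD mU (sqintM_rint mU (sg j) (sp j)) IHs)).
by move=> x _; rewrite big_cons.
Qed.

Lemma Rint_sum U I (s : seq I) (F : I -> 'cV[R]_n -> R) :
  measurable (U : set (eucl R n)) -> (forall k, rint mu U (F k)) ->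
  rint mu U (fun x => \sum_(k <- s) F k x) /\
  \int[mu]_(x in U) (\sum_(k <- s) F k x) = \sum_(k <- s) \int[mu]_(x in U) F k x.
Proof.
move=> mU FU; elim: s => [|k s [IH1 IH2]].
  split.
    apply: (@eq_rint _ _ _ mu U (cst 0) _ mU); last exact: integrable0.
    by move=> x _; rewrite big_nil.
  rewrite big_nil (@eq_Rintegral _ _ _ mu U (cst 0)).
    by rewrite Rintegral_cst// mul0r.
  by move=> x _; rewrite big_nil.
split.
  apply: (@eq_rint _ _ _ mu U _ _ mU _ (rintD mU (FU k) IH1)).
  by move=> x _; rewrite big_cons.
rewrite big_cons -IH2 -(RintegralD mU (FU k) IH1).
by apply: eq_Rintegral => x _; rewrite big_cons.
Qed.

Lemma sqint_lip_partial U K (f : 'cV[R]_n -> R) i : open U -> bounded_set U ->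
  lip K f -> sqint mu U (partial i f).
Proof.
move=> oU bU fK; apply: (@sqint_ae_bounded _ _ _ mu U _ K).
- exact: open_leb_measurable.
- exact: bounded_leb_lty.
- by apply: (measurable_funS measurableT) (measurable_partial i fK) => //.
- by apply: ae_imply (partial_le_ae i fK).
Qed.

Lemma sqint_lip U K (f : 'cV[R]_n -> R) : open U -> bounded_set U ->
  lip K f -> sqint mu U f.
Proof.
move=> oU bU fK; have [N N0 UN] := bounded_sub_nball bU.
apply: (@sqint_bounded _ _ _ mu U _ (`|f 0| + `|K| * N)).
- exact: open_leb_measurable.
- exact: bounded_leb_lty.
- by apply: continuous_on_measurable => // x _; exact: lip_continuous fK x.
- by move=> x /UN; exact: lip_nball.
Qed.

Lemma Rint_div_pull U C u phi K : open U -> bounded_set U -> sqint mu U u ->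
  (forall i, lip K (pull C phi i)) ->
  \int[mu]_(x in U) (u x * divergence (fun y => (C y)^T *m phi y) x) =
  \sum_i \int[mu]_(x in U) (partial i (pull C phi i) x * u x).
Proof.
move=> oU bU su pK; have mU := open_leb_measurable oU.
rewrite -(Rint_sum _ mU (fun i => sqintM_rint mU (sqint_lip_partial i oU bU (pK i)) su)).2.
by apply: eq_Rintegral => x _; rewrite divergence_pull mulr_sumr; apply: eq_bigr => i _; rewrite mulrC.
Qed.

Lemma Rint_partialD U K L (f h u : 'cV[R]_n -> R) i : open U -> bounded_set U ->
  sqint mu U u -> lip K f -> lip L h ->
  \int[mu]_(x in U) (partial i (fun x => f x + h x) x * u x) =
  \int[mu]_(x in U) (partial i f x * u x) + \int[mu]_(x in U) (partial i h x * u x).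
Proof.
move=> oU bU su fK hL; have mU := open_leb_measurable oU.
have i1 := sqintM_rint mU (sqint_lip_partial i oU bU fK) su.
have i2 := sqintM_rint mU (sqint_lip_partial i oU bU hL) su.
have i3 := sqintM_rint mU (sqint_lip_partial i oU bU (lipD fK hL)) su.
rewrite -(RintegralD mU i1 i2).
apply: (Rint_ae_eq mU (rint_measurable i3) (rint_measurable (rintD mU i1 i2))).
apply: ae_imply (ae_and (lip_derivable_ae i fK) (lip_derivable_ae i hL)) => x [df dh] _.
by rewrite -mulrDl /partial -deriveD.
Qed.

Lemma Rint_dot U g phi : measurable (U : set (eucl R n)) ->
  (forall j, sqint mu U (fun x => g x j 0)) ->
  (forall j, sqint mu U (fun x => phi x j 0)) ->
  \int[mu]_(x in U) dot (g x) (phi x) = \sum_j \int[mu]_(x in U) (g x j 0 * phi x j 0).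
Proof.
move=> mU sg sp.
exact: (Rint_sum (index_enum 'I_m) mU (fun j => sqintM_rint mU (sg j) (sp j))).2.
Qed.

Lemma Rint_cvg0 U (f : 'cV[R]_n -> R) (psi : nat -> 'cV[R]_n -> R) (e : nat -> R) :
  measurable (U : set (eucl R n)) -> (mu U < +oo)%E -> sqint mu U f ->
  (forall k, sqint mu U (psi k)) ->
  (forall k x, `|psi k x| <= e k) -> e k @[k --> \oo] --> (0 : R) ->
  \int[mu]_(x in U) (f x * psi k x) @[k --> \oo] --> (0 : R).
Proof.
move=> mU Uoo sf sp pe e0.
have rf : rint mu U f by exact: (sqint_rint mU Uoo sf).
have bd k : `|\int[mu]_(x in U) (f x * psi k x)| <= e k * \int[mu]_(x in U) `|f x|.
  have r1 := sqintM_rint mU sf (sp k).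
  have r2 : rint mu U (fun x => `|f x|) := integrable_norm rf.
  apply: le_trans (le_normr_Rintegral mU r1) _.
  rewrite -(RintegralZl _ mU r2).
  apply: (@le_Rintegral _ _ _ mu U _ _ mU (integrable_norm r1) (rintZ (e k) mU r2)).
  by move=> x _; rewrite /= normrM mulrC; apply: ler_wpM2r => //; exact: pe.
apply/cvgr0Pnorm_le => r r0.
have : e k * \int[mu]_(x in U) `|f x| @[k --> \oo] --> (0 : R).
  rewrite -(mul0r (\int[mu]_(x in U) `|f x|)).
  by apply: cvgM; [exact: e0|exact: cvg_cst].
move=> /cvgr0Pnorm_le/(_ r r0)[k0 _ k0P]; exists k0 => // k kk.
by apply: le_trans (bd k) _; apply: le_trans (ler_norm _) (k0P k kk).
Qed.

Lemma cvg_sum (I : Type) (r : seq I) (F : I -> nat -> R) (l : I -> R) :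
  (forall i, F i k @[k --> \oo] --> l i) ->
  \sum_(i <- r) F i k @[k --> \oo] --> \sum_(i <- r) l i.
Proof. by move=> Fl; apply: cvg_big => [|i _]; [exact: add_continuous|exact: Fl]. Qed.

End X_gradient_theory.

Section X_gradient_test.
Context {R : realType} {m n : nat}.
Local Notation mu := (@leb R n).
Implicit Types (U S V : set 'cV[R]_n) (C : 'cV[R]_n -> 'M[R]_(m, n)).
Implicit Types (u : 'cV[R]_n -> R) (g phi : 'cV[R]_n -> 'cV[R]_m).

(** Smooth fields that are uniformly Lipschitz converge uniformly to phi. The
    divergence of the error need not be small in norm, but it tends weakly to zero,
    which is enough against u. *)
Lemma Xgrad_lip_test U C L M u g phi K p : (0 < n)%N ->
  open U -> bounded_set U -> coef_bounds U C L M ->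
  sqint mu U u -> is_Xgrad C U u g -> 0 <= K ->
  (forall j, lip K (fun x => phi x j 0)) ->
  (forall j, vanish_off (cutoff_support U p) (fun x => phi x j 0)) ->
  \sum_i \int[mu]_(x in U) (partial i (pull C phi i) x * u x) =
  - \int[mu]_(x in U) dot (g x) (phi x).
Proof.
move=> n0 oU bU CU su [gL2 Hg] K0 pK pv.
have mU := open_leb_measurable oU; have Uoo := bounded_leb_lty bU.
have sg j : sqint mu U (fun x => g x j 0) by apply/L2_sqint => //; exact: gL2.
have [L0 M0 _ _] := CU.
have [z Uz] := bounded_compl_nonempty n0 bU.
have [N N0 UN] := bounded_sub_nball bU.
have SU q : cutoff_support U q `<=` U by exact: (@cutoff_support_sub _ _ U z Uz).
have [B' B'0 bB] := @bump'_bounded R.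
(* q + 1 = 2 (p + 1): smoothing at the scale 1/(k+q+1) moves the support by at most
   half of its distance 1/(p+1) to the complement of U *)
pose q := p.*2.+1.
pose phik k x : 'cV[R]_m := \col_j smoothing (fun y => phi y j 0) N (k + q) x.
have phikE k j : (fun x => phik k x j 0) = smoothing (fun y => phi y j 0) N (k + q).
  by apply/funext => x; rewrite mxE.
have vN j : vanish_off (nball N) (fun y => phi y j 0).
  by apply: vanish_off_sub (pv j) => x /SU /UN.
pose K' := n%:R * (K * (B' * 3)).
have K'0 : 0 <= K' by rewrite /K' !mulr_ge0.
have lipk k j : lip K' (fun x => phik k x j 0).
  rewrite phikE; apply: bounded_partial_lip.
  - by rewrite !mulr_ge0.
  - by move=> i x; exact: (smooth_smoothing _ _ _ [::]).2.
  - by move=> i x; apply: (smoothing_partial _ K0 N0 (pK j) (vN j)).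
have close k j x : `|phik k x j 0 - phi x j 0| <= K * (k + q).+1%:R^-1.
  by rewrite mxE; exact: (smoothing_close _ K0 N0 (pK j) (vN j)).
have vk k j : vanish_off (cutoff_support U q) (fun x => phik k x j 0).
  move=> x Sx; apply: contrapT => /eqP; rewrite mxE => H; apply: Sx.
  have [y Sy xy] := smoothing_support (pv j) H.
  rewrite /cutoff_support /=; move: Sy; rewrite /cutoff_support /= => Sy.
  have := lip_dist_compl Uz y x; rewrite mul1r => dxy.
  have := le_trans (ler_norm _) dxy; rewrite distrC => {}dxy.
  have kq : (k + q).+1%:R^-1 <= q.+1%:R^-1 :> R.
    by rewrite lef_pV2 ?posrE// ler_nat ltnS leq_addl.
  have pq : p.+1%:R^-1 = 2 * q.+1%:R^-1 :> R.
    have -> : q.+1 = (2 * p.+1)%N by rewrite /q mul2n doubleS.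
    by rewrite natrM invfM mulrA divff ?mul1r// pnatr_eq0.
  move: Sy kq xy dxy; rewrite pq; move: (q.+1%:R^-1) ((k + q).+1%:R^-1) (`|x - y|) => a b c.
  by lra.
have testk k : test_function U (phik k).
  split; first by move=> j; rewrite phikE; exact: smooth_smoothing.
  exists (cutoff_support U q); split => //.
  - apply: closed_bounded_compact; first exact: (@closed_cutoff_support _ _ U z Uz).
    exact: bounded_setS (SU q) bU.
  - by move=> x Sx; apply/colP => j; rewrite [RHS]mxE; exact: vk.
have cU : coef_bounds U C L M := CU.
have bS : bounded_set (cutoff_support U q) := bounded_setS (SU q) bU.
have pvq j : vanish_off (cutoff_support U q) (fun x => phi x j 0).
  apply: vanish_off_sub (pv j) => x; rewrite /cutoff_support /=; apply: le_trans.
  by rewrite lef_pV2 ?posrE// ler_nat ltnS /q -addnn ltnW// ltnS leq_addr.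
have [B B0 bphi] : exists2 B, 0 <= B & forall j x, `|phi x j 0| <= B.
  apply: (finite_bounds (P := fun j B => forall x, `|phi x j 0| <= B)).
    by move=> j A A' AA H x; exact: le_trans (H x) AA.
  by move=> j; exact: lip_vanish_bounded (pK j) bS (pvq j).
pose psi k x : 'cV[R]_m := phik k x - phi x.
have psi0 k j x : psi k x j 0 = phik k x j 0 - phi x j 0.
  by rewrite /psi mxE [(- phi x) j 0]mxE.
have psiE k j : (fun x => psi k x j 0) = (fun x => phik k x j 0 + (-1) * phi x j 0).
  by apply/funext => x; rewrite /psi mxE [(- phi x) j 0]mxE mulN1r.
have vpsi k j : vanish_off (cutoff_support U q) (fun x => psi k x j 0).
  move=> x Sx; rewrite /psi mxE [(- phi x) j 0]mxE.
  by have /= -> := vk k j x Sx; have /= -> := pvq j x Sx; rewrite subrr.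
have lippsi k j : lip (K' + K) (fun x => psi k x j 0).
  rewrite psiE; apply: lipD; first exact: lipk.
  by move=> x y; rewrite -mulrBr normrM normrN normr1 mul1r; exact: pK.
have bpsi k j x : `|psi k x j 0| <= K.
  rewrite /psi mxE [(- phi x) j 0]mxE; apply: le_trans (close k j x) _.
  by rewrite ler_piMr// invf_le1// ler1n.
have bpsik k j x : `|psi k x j 0| <= K * (k + q).+1%:R^-1.
  by rewrite /psi mxE [(- phi x) j 0]mxE.
have K'K : 0 <= K' + K by rewrite addr_ge0.
have lipV k i := lip_pull i cU (SU q) K'K K0 (lippsi k) (vpsi k) (bpsi k).
have lipP i := lip_pull i cU (SU q) K0 B0 pK pvq bphi.
have bV k i x : `|pull C (psi k) i x| <= m%:R * (M * (K * (k + q).+1%:R^-1)).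
  apply: (pull_bound (S := cutoff_support U q) (U := U) (L := L)) => //.
  by rewrite mulr_ge0// invr_ge0.
have e0 : m%:R * (M * (K * (k + q).+1%:R^-1)) @[k --> \oo] --> (0 : R).
  have H : ((k + q).+1%:R^-1 : R) @[k --> \oo] --> (0 : R).
    by rewrite (cvg_shiftn q (fun k => k.+1%:R^-1 : R)); exact: cvg_harmonic.
  rewrite [X in _ --> X](_ : _ = m%:R * (M * (K * 0)) :> R); last by rewrite !mulr0.
  by apply: cvgM; [exact: cvg_cst|apply: cvgM; [exact: cvg_cst|apply: cvgM => //; exact: cvg_cst]].
have wk i : \int[mu]_(x in U) (partial i (pull C (psi k) i) x * u x) @[k --> \oo] --> 0.
  exact: (partial_weak_cvg0 i oU bU (fun k => lipV k i) (fun k => bV k i) e0 su).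
have pullD k i : pull C (phik k) i = (fun x => pull C phi i x + pull C (psi k) i x).
  apply/funext => x; rewrite /pull -big_split/=; apply: eq_bigr => j _.
  by rewrite psi0 -mulrDr subrKC.
have lipk' k i : lip (m%:R * (B * L + K * M) + m%:R * (K * L + (K' + K) * M)) (pull C (phik k) i).
  by rewrite pullD; apply: lipD; [exact: lipP|exact: lipV].
have sphi j : sqint mu U (fun x => phi x j 0) := sqint_lip oU bU (pK j).
have sphik k j : sqint mu U (fun x => phik k x j 0) := sqint_lip oU bU (lipk k j).
have spsi k j : sqint mu U (fun x => psi k x j 0) := sqint_lip oU bU (lippsi k j).
pose a := \sum_i \int[mu]_(x in U) (partial i (pull C phi i) x * u x).
pose a' k := \sum_i \int[mu]_(x in U) (partial i (pull C (psi k) i) x * u x).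
pose b' k := \sum_j \int[mu]_(x in U) (g x j 0 * psi k x j 0).
have E1 k : \sum_i \int[mu]_(x in U) (partial i (pull C (phik k) i) x * u x) = a + a' k.
  rewrite -big_split; apply: eq_bigr => i _; rewrite pullD.
  exact: (Rint_partialD i oU bU su (lipP i) (lipV k i)).
have E2 k : \int[mu]_(x in U) dot (g x) (phik k x) = \int[mu]_(x in U) dot (g x) (phi x) + b' k.
  rewrite (Rint_dot mU sg (sphik k)) (Rint_dot mU sg sphi) -big_split.
  apply: eq_bigr => j _.
  have r1 := sqintM_rint mU (sg j) (sphi j).
  have r2 := sqintM_rint mU (sg j) (spsi k j).
  apply: etrans _ (RintegralD mU r1 r2); apply: eq_Rintegral => x _ /=.
  by rewrite psi0 -mulrDr subrKC.
have E3 k : \int[mu]_(x in U) dot (g x) (phik k x) = - (a + a' k).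
  rewrite -E1 -(Rint_div_pull oU bU su (lipk' k)).
  by rewrite -(Hg _ (testk k)).
have eqk k : a + \int[mu]_(x in U) dot (g x) (phi x) = - (a' k + b' k).
  by have := E2 k; rewrite E3; lra.
have e1 : K * (k + q).+1%:R^-1 @[k --> \oo] --> (0 : R).
  have H : ((k + q).+1%:R^-1 : R) @[k --> \oo] --> (0 : R).
    by rewrite (cvg_shiftn q (fun k => k.+1%:R^-1 : R)); exact: cvg_harmonic.
  by rewrite -(mulr0 K); apply: cvgM; [exact: cvg_cst|exact: H].
have rk j : \int[mu]_(x in U) (g x j 0 * psi k x j 0) @[k --> \oo] --> 0.
  exact: (Rint_cvg0 mU Uoo (sg j) (fun k => spsi k j) (fun k => bpsik k j) e1).
have ca : a' k @[k --> \oo] --> (0 : R).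
  rewrite [X in _ --> X](_ : _ = \sum_(i < n) (0 : R)); last by rewrite big1.
  by apply: cvg_sum => i; exact: wk.
have cb : b' k @[k --> \oo] --> (0 : R).
  rewrite [X in _ --> X](_ : _ = \sum_(i < m) (0 : R)); last by rewrite big1.
  by apply: cvg_sum => i; exact: rk.
have cv : (cst (a + \int[mu]_(x in U) dot (g x) (phi x)) : nat -> R) @ \oo --> - ((0 : R) + 0).
  rewrite (_ : cst _ = (fun k => - (a' k + b' k))); last exact/funext.
  by apply: cvgN; apply: cvgD.
have : a + \int[mu]_(x in U) dot (g x) (phi x) = 0.
  rewrite addr0 oppr0 in cv.
  by apply: (cvg_unique _ _ cv) => //; exact: cvg_cst.
by rewrite /a => H; apply/eqP; rewrite -addr_eq0; apply/eqP.
Qed.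

End X_gradient_test.

(** * Calculus of X-gradients *)

Section X_gradient_calculus.
Context {R : realType} {m n : nat}.
Local Notation mu := (@leb R n).
Implicit Types (U S V : set 'cV[R]_n) (C : 'cV[R]_n -> 'M[R]_(m, n)).
Implicit Types (u : 'cV[R]_n -> R) (g phi : 'cV[R]_n -> 'cV[R]_m).

Lemma dotC k (v w : 'cV[R]_k) : dot v w = dot w v.
Proof. by apply: eq_bigr => i _; rewrite mulrC. Qed.

Lemma dotDl k (v v' w : 'cV[R]_k) : dot (v + v') w = dot v w + dot v' w.
Proof. by rewrite /dot -big_split; apply: eq_bigr => i _; rewrite mxE mulrDl. Qed.

Lemma dotZl k a (v w : 'cV[R]_k) : dot (a *: v) w = a * dot v w.
Proof. by rewrite /dot mulr_sumr; apply: eq_bigr => i _; rewrite mxE mulrA. Qed.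

Lemma dotDr k (v w w' : 'cV[R]_k) : dot v (w + w') = dot v w + dot v w'.
Proof. by rewrite dotC dotDl ![dot _ v]dotC. Qed.

Lemma dotZr k a (v w : 'cV[R]_k) : dot v (a *: w) = a * dot v w.
Proof. by rewrite dotC dotZl dotC. Qed.

Lemma dot_delta k (v : 'cV[R]_k) j : dot v (delta_mx j 0) = v j 0.
Proof.
rewrite /dot (bigD1 j)//= mxE !eqxx mulr1 big1 ?addr0// => i ij.
by rewrite mxE (negPf ij) mulr0.
Qed.

Lemma dot_adj k l (B : 'M[R]_(k, l)) v w : dot (B *m v) w = dot v (B^T *m w).
Proof.
rewrite /dot; transitivity (\sum_i \sum_j B i j * v j 0 * w i 0).
  by apply: eq_bigr => i _; rewrite mxE mulr_suml.
rewrite exchange_big; apply: eq_bigr => j _; rewrite mxE mulr_sumr.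
by apply: eq_bigr => i _; rewrite mxE; ring.
Qed.

Lemma test_function_pull U C L M phi : open U -> coef_bounds U C L M ->
  test_function U phi ->
  exists S K, [/\ closed S /\ bounded_set S, S `<=` U,
    forall j, lip K (fun x => phi x j 0),
    forall j, vanish_off S (fun x => phi x j 0) &
    (forall i, lip K (pull C phi i)) /\ (forall i, vanish_off S (pull C phi i))].
Proof.
move=> oU CU /test_function_lip[S [K [B [cS SU [K0 B0] [pK pS pB]]]]].
have [L0 M0 _ _] := CU.
have X0 : 0 <= m%:R * (B * L + K * M) by rewrite mulr_ge0// addr_ge0// mulr_ge0.
exists S, (K + m%:R * (B * L + K * M)); split => //.
- split; first by apply: compact_closed => //; exact: norm_hausdorff.
  exact: compact_bounded.
- by move=> j; apply: le_lip (pK j); rewrite lerDl.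
- split=> i; last exact: vanish_pull.
  by apply: (@le_lip _ _ _ _ _ _ (lip_pull i CU SU K0 B0 pK pS pB)); rewrite lerDr.
Qed.

Lemma Xdistr_pull U C L M u phi : open U -> bounded_set U -> coef_bounds U C L M ->
  sqint mu U u -> test_function U phi ->
  Xdistr C U u phi = - \sum_i \int[mu]_(x in U) (partial i (pull C phi i) x * u x).
Proof.
move=> oU bU CU su /(test_function_pull oU CU)[S [K [_ _ _ _ [pK _]]]].
by rewrite /Xdistr (Rint_div_pull oU bU su pK).
Qed.

Lemma L2v_sqint k U (g : 'cV[R]_n -> 'cV[R]_k) : measurable (U : set (eucl R n)) ->
  L2v U g <-> forall j, sqint mu U (fun x => g x j 0).
Proof. by move=> mU; split=> H j; [apply/(L2_sqint _ mU)|apply/(L2_sqint _ mU)]; exact: H. Qed.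

Lemma L2S U V f : measurable (U : set (eucl R n)) -> measurable (V : set (eucl R n)) ->
  V `<=` U -> L2 U f -> L2 V f.
Proof. by move=> mU mV VU /(L2_sqint _ mU) sf; apply/(L2_sqint _ mV); exact: (sqintS mU mV VU sf). Qed.

(** A test field of V is one of U, and all the integrands vanish off its support. *)
Lemma is_Xgrad_sub U V C L M u g : open U -> bounded_set U -> open V -> V `<=` U ->
  coef_bounds U C L M -> sqint mu U u -> is_Xgrad C U u g -> is_Xgrad C V u g.
Proof.
move=> oU bU oV VU CU su [gL2 Hg].
have mU := open_leb_measurable oU; have mV := open_leb_measurable oV.
split; first by move=> j; exact: (L2S mU mV VU (gL2 j)).
move=> phi tV.
have tU : test_function U phi.
  by have [sp [K [cK KV pK]]] := tV; split => //; exists K; split => //; exact: subset_trans VU.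
have := Hg _ tU.
rewrite (Xdistr_pull oU bU CU su tU) (Xdistr_pull oV (bounded_setS VU bU) (coef_boundsS VU CU) (sqintS mU mV VU su) tV).
have [S [K [[cS bS] SV pK pS [_ qS]]]] := test_function_pull oV (coef_boundsS VU CU) tV.
have pV x : ~ V x -> phi x = 0.
  by move=> Vx; apply/colP => j; rewrite mxE pS// => /SV.
have v1 : vanish_off V (fun x => dot (g x) (phi x)).
  by move=> x /pV ->; rewrite /dot big1// => j _; rewrite mxE mulr0.
have v2 i : vanish_off V (fun x => partial i (pull C phi i) x * u x).
  by move=> x Vx; rewrite (partial_vanish i cS (qS i)) ?mul0r// => /SV.
rewrite (vanish_Rint v1) (vanish_Rint (vanish_off_sub VU v1)) => <-.
congr (- _); apply: eq_bigr => i _.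
by rewrite (vanish_Rint (v2 i)) (vanish_Rint (vanish_off_sub VU (v2 i))).
Qed.

Lemma is_XgradDZ U C L M u w g f t : open U -> bounded_set U -> coef_bounds U C L M ->
  sqint mu U u -> sqint mu U w -> is_Xgrad C U u g -> is_Xgrad C U w f ->
  is_Xgrad C U (fun x => u x + t * w x) (fun x => g x + t *: f x).
Proof.
move=> oU bU CU su sw [gL2 Hg] [fL2 Hf].
have mU := open_leb_measurable oU.
have sg := (L2v_sqint _ mU).1 gL2; have sf := (L2v_sqint _ mU).1 fL2.
have sgf j : sqint mu U (fun x => (g x + t *: f x) j 0).
  apply: (eq_sqint mU _ (sqintD mU (sg j) (sqintZ t mU (sf j)))).
  by move=> x _; rewrite mxE [(t *: f x) j 0]mxE.
split; first exact/(L2v_sqint _ mU).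
move=> phi tp.
have suw := sqintD mU su (sqintZ t mU sw).
have := Hg _ tp; have := Hf _ tp.
rewrite (Xdistr_pull oU bU CU su tp) (Xdistr_pull oU bU CU sw tp) (Xdistr_pull oU bU CU suw tp).
have [S [K [_ _ pK pS [qK _]]]] := test_function_pull oU CU tp.
have sp j : sqint mu U (fun x => phi x j 0) := sqint_lip oU bU (pK j).
rewrite (Rint_dot mU sg sp) (Rint_dot mU sf sp) (Rint_dot mU sgf sp) => Ef Eg.
have E1 i : \int[mu]_(x in U) (partial i (pull C phi i) x * (u x + t * w x)) =
    \int[mu]_(x in U) (partial i (pull C phi i) x * u x) +
    t * \int[mu]_(x in U) (partial i (pull C phi i) x * w x).
  have sq := sqint_lip_partial i oU bU (qK i).
  have r1 := sqintM_rint mU sq su; have r2 := sqintM_rint mU sq sw.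
  apply: etrans _ (congr1 (fun z => _ + z) (RintegralZl t mU r2)).
  apply: etrans _ (RintegralD mU r1 (rintZ t mU r2)).
  by apply: eq_Rintegral => x _ /=; ring.
have E2 j : \int[mu]_(x in U) ((g x + t *: f x) j 0 * phi x j 0) =
    \int[mu]_(x in U) (g x j 0 * phi x j 0) +
    t * \int[mu]_(x in U) (f x j 0 * phi x j 0).
  have r1 := sqintM_rint mU (sg j) (sp j); have r2 := sqintM_rint mU (sf j) (sp j).
  apply: etrans _ (congr1 (fun z => _ + z) (RintegralZl t mU r2)).
  apply: etrans _ (RintegralD mU r1 (rintZ t mU r2)).
  by apply: eq_Rintegral => x _ /=; rewrite mxE [(t *: f x) j 0]mxE; ring.
under eq_bigr do rewrite E1.
under [RHS]eq_bigr do rewrite E2.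
by rewrite !big_split/= -!mulr_sumr -Ef -Eg; ring.
Qed.

Lemma lip_dot (xi : 'cV[R]_n) : exists K, lip K (dot xi).
Proof.
exists ((size (index_enum 'I_n))%:R * \sum_i `|xi i 0|); apply: lip_sum => i x y.
rewrite -mulrBr normrM; apply: (@le_trans _ _ (`|xi i 0| * `|x - y|)).
  by apply: ler_wpM2l => //; have := lip_coord i x y; rewrite mul1r.
apply: ler_wpM2r => //; rewrite (bigD1 i)//= lerDl.
by apply: sumr_ge0 => k _.
Qed.

(** Along a linear function the distributional X-gradient is the classical one:
    the test field is moved back by an integration by parts. *)
Lemma is_Xgrad_linear U C L M (xi : 'cV[R]_n) : open U -> bounded_set U ->
  coef_bounds U C L M -> (forall j i, measurable_fun (U : set (eucl R n)) (fun x => C x j i)) ->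
  is_Xgrad C U (dot xi) (fun x => C x *m xi).
Proof.
move=> oU bU CU mC; have mU := open_leb_measurable oU; have Uoo := bounded_leb_lty bU.
have [L0 M0 cL cM] := CU.
have sC j i : sqint mu U (fun x => C x j i).
  by apply: (@sqint_bounded _ _ _ mu U _ M mU Uoo (mC j i)) => x; exact: cM.
have sCx j : sqint mu U (fun x => (C x *m xi) j 0).
  apply: (eq_sqint mU _ (sqint_sum (index_enum 'I_n) mU (fun i => sqintZ (xi i 0) mU (sC j i)))).
  by move=> x _; rewrite mxE; apply: eq_bigr => i _; rewrite mulrC.
have [Kx lipx] := lip_dot xi.
split; first exact/(L2v_sqint _ mU).
move=> phi tp.
have [S [K [[cS bS] SU pK pS [qK qS]]]] := test_function_pull oU CU tp.
have sp j : sqint mu U (fun x => phi x j 0) := sqint_lip oU bU (pK j).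
rewrite (Xdistr_pull oU bU CU (sqint_lip oU bU lipx) tp) -sumrN.
have E i : - (\int[mu]_(x in U) (partial i (pull C phi i) x * dot xi x)) =
    \int[mu]_(x in U) (xi i 0 * pull C phi i x).
  have v1 : vanish_off U (fun x => partial i (pull C phi i) x * dot xi x).
    by move=> x Ux; rewrite (partial_vanish i cS (qS i)) ?mul0r// => /SU.
  have v2 : vanish_off U (fun x => xi i 0 * pull C phi i x).
    by move=> x Ux; rewrite qS ?mulr0// => /SU.
  rewrite (vanish_Rint v1) (vanish_Rint v2) (Rint_by_parts i (qK i) bS (qS i) lipx) opprK.
  apply: eq_Rintegral => x _ /=; rewrite mulrC; congr (_ * _).
  rewrite /partial /derive; apply: cvg_lim => //.
  have e0 : {near 0^', (fun=> xi i 0) =1 (fun h : R => h^-1 *: (dot xi (h *: delta_mx i 0 + x) - dot xi x))}.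
    near=> h; have h0 : h != 0 by near: h; exact: nbhs_dnbhs_neq.
    by rewrite dotDr addrK dotZr dot_delta scalerA mulVf// scale1r.
  by apply: cvg_trans (near_eq_cvg e0) _; exact: cvg_cst.
under eq_bigr do rewrite E.
have sq i : sqint mu U (pull C phi i) := sqint_lip oU bU (qK i).
have r i : rint mu U (fun x => xi i 0 * pull C phi i x) := rintZ (xi i 0) mU (sqint_rint mU Uoo (sq i)).
rewrite -(Rint_sum (index_enum 'I_n) mU r).2.
apply: eq_Rintegral => x _; rewrite dot_adj /dot; apply: eq_bigr => i _.
by rewrite -pullE.
Unshelve. all: by end_near. Qed.

Lemma ae_forall_fin (I : finType) (P : I -> 'cV[R]_n -> Prop) :
  (forall i, {ae mu, forall x, P i x}) -> {ae mu, forall x, forall i, P i x}.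
Proof.
move=> H; suff : forall s : seq I, {ae mu, forall x, forall i, i \in s -> P i x}.
  by move=> /(_ (enum I)); apply: ae_imply => x Hx i; apply: Hx; rewrite mem_enum.
elim=> [|i s IHs]; first by apply: aeW => x i; rewrite in_nil.
apply: ae_imply (ae_and (H i) IHs) => x [Pi Ps] k; rewrite inE => /orP[/eqP ->//|].
exact: Ps.
Qed.

(** The difference of the two gradients is orthogonal to all Lipschitz fields with
    compact support in U. *)
Lemma is_Xgrad_unique U C L M u g f : (0 < n)%N -> open U -> bounded_set U ->
  coef_bounds U C L M -> sqint mu U u -> is_Xgrad C U u g -> is_Xgrad C U u f ->
  {ae mu, forall x, U x -> g x = f x}.
Proof.
move=> n0 oU bU CU su gu fu.
have mU := open_leb_measurable oU.
have sg := (L2v_sqint _ mU).1 gu.1; have sf := (L2v_sqint _ mU).1 fu.1.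
suff H : {ae mu, forall x, forall j, U x -> g x j 0 - f x j 0 = 0}.
  by apply: ae_imply H => x H Ux; apply/colP => j; apply/eqP; rewrite -subr_eq0 H.
apply: ae_forall_fin => j; apply: (orthogonal_lip_ae0 n0 oU bU (sqintB mU (sg j) (sf j))).
move=> eta p K /lip_ge0 lipe ve.
pose phi x : 'cV[R]_m := eta x *: delta_mx j 0.
have phiE k : (fun x => phi x k 0) = (fun x => (k == j)%:R * eta x).
  by apply/funext => x; rewrite !mxE eqxx andbT mulrC.
have lipp k : lip `|K| (fun x => phi x k 0).
  rewrite phiE; case: eqP => _ x y; last by rewrite !mul0r subrr normr0 mulr_ge0.
  by rewrite !mul1r.
have vp k : vanish_off (cutoff_support U p) (fun x => phi x k 0).
  by rewrite phiE => x /ve ->; rewrite mulr0.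
have Eg := Xgrad_lip_test n0 oU bU CU su gu (normr_ge0 K) lipp vp.
have Ef := Xgrad_lip_test n0 oU bU CU su fu (normr_ge0 K) lipp vp.
have se : sqint mu U eta := sqint_lip oU bU lipe.
have r1 := sqintM_rint mU (sg j) se; have r2 := sqintM_rint mU (sf j) se.
have H : \int[mu]_(x in U) (g x j 0 * eta x) = \int[mu]_(x in U) (f x j 0 * eta x).
  have D (h : 'cV[R]_n -> 'cV[R]_m) : \int[mu]_(x in U) (h x j 0 * eta x) = \int[mu]_(x in U) dot (h x) (phi x).
    by apply: eq_Rintegral => x _; rewrite dotZr dot_delta mulrC.
  by rewrite !D; apply: oppr_inj; rewrite -Eg -Ef.
apply: (@etrans _ _ (\int[mu]_(x in U) (g x j 0 * eta x) - \int[mu]_(x in U) (f x j 0 * eta x))).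
  apply: etrans _ (RintegralB mU r1 r2).
  by apply: eq_Rintegral => x _ /=; rewrite mulrBl.
by rewrite H subrr.
Qed.

End X_gradient_calculus.

(** * Regularized projections *)

Section regularized_projection.
Context {R : realType} {m n : nat}.
Implicit Types (C D : 'M[R]_(m, n)) (T e : R) (j : 'I_m).

Lemma dot_ge0 k (v : 'cV[R]_k) : 0 <= dot v v.
Proof. by apply: sumr_ge0 => i _; rewrite -expr2 sqr_ge0. Qed.

Lemma dotNl k (v w : 'cV[R]_k) : dot (- v) w = - dot v w.
Proof. by rewrite -scaleN1r dotZl mulN1r. Qed.

Lemma dotBl k (v v' w : 'cV[R]_k) : dot (v - v') w = dot v w - dot v' w.
Proof. by rewrite dotDl dotNl. Qed.

Lemma dotBr k (v w w' : 'cV[R]_k) : dot v (w - w') = dot v w - dot v w'.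
Proof. by rewrite dotC dotBl ![dot _ v]dotC. Qed.

Lemma sqr_le_dot k (v : 'cV[R]_k) i : v i 0 ^+ 2 <= dot v v.
Proof.
rewrite /dot (bigD1 i)//= -expr2 lerDl; apply: sumr_ge0 => l _.
by rewrite -expr2 sqr_ge0.
Qed.

Lemma dot_eq0 k (v : 'cV[R]_k) : dot v v = 0 -> v = 0.
Proof.
move=> v0; apply/colP => i; rewrite mxE; apply/eqP; rewrite -sqrf_eq0 eq_le sqr_ge0.
by rewrite -v0 sqr_le_dot.
Qed.

Lemma normr_le_sqr (a b : R) : 0 <= b -> a ^+ 2 <= b ^+ 2 -> `|a| <= b.
Proof. by move=> b0 H; rewrite -(@ler_pXn2r _ 2) ?nnegrE// real_normK// num_real. Qed.

Lemma dot_le_const k (v : 'cV[R]_k) c : 0 <= c -> (forall i, `|v i 0| <= c) ->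
  dot v v <= k%:R * c ^+ 2.
Proof.
move=> c0 vc; apply: (@le_trans _ _ (\sum_(i < k) c ^+ 2)).
  by apply: ler_sum => i _; rewrite -expr2 -real_normK ?num_real// ler_pXn2r ?nnegrE// vc.
by rewrite sumr_const card_ord mulr_natl.
Qed.

Lemma mulmx_entry_le p q (E : 'M[R]_(p, q)) (v : 'cV[R]_q) i e (c : R) : 0 <= e ->
  (forall l, `|E i l| <= e) -> (forall l, `|v l 0| <= c) ->
  `|(E *m v) i 0| <= q%:R * (e * c).
Proof.
move=> e0 Ee vc; rewrite mxE; apply: le_trans (ler_norm_sum _ _ _) _.
apply: (@le_trans _ _ (\sum_(l < q) e * c)).
  by apply: ler_sum => l _; rewrite normrM ler_pM.
by rewrite sumr_const card_ord mulr_natl.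
Qed.

Lemma dot_le_norm1 k (v w : 'cV[R]_k) c : 0 <= c -> (forall i, `|w i 0| <= c) ->
  `|dot v w| <= c * \sum_i `|v i 0|.
Proof.
move=> c0 wc; rewrite /dot; apply: le_trans (ler_norm_sum _ _ _) _.
by rewrite mulr_sumr; apply: ler_sum => i _; rewrite normrM mulrC ler_wpM2r.
Qed.

(** The range of C and the kernel of C^T are complementary by dimension: a vector
    in both is orthogonal to itself. *)
Lemma range_decomposition C (g : 'cV[R]_m) :
  exists z p, g = C *m z + p /\ C^T *m p = 0.
Proof.
have I0 : (C^T :&: kermx C = 0)%MS.
  apply/eqP/rowV0P => v; rewrite sub_capmx => /andP[/submxP[w vw] /sub_kermxP vC].
  suff : v^T = 0 by move=> /(congr1 trmx); rewrite trmxK trmx0.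
  apply: dot_eq0; rewrite {1}vw trmx_mul trmxK dot_adj -trmx_mul vC trmx0.
  by rewrite /dot big1// => i _; rewrite [X in _ * X]mxE mulr0.
have full : row_full (C^T + kermx C)%MS.
  rewrite /row_full mxrank_disjoint_sum// mxrank_ker mxrank_tr subnKC//.
  exact: rank_leq_row.
have /sub_addsmxP[[w1 w2] /= E] : (g^T <= C^T + kermx C)%MS by exact: submx_full.
exists w1^T, (w2 *m kermx C)^T; split.
  by apply: trmx_inj; rewrite linearD/= trmx_mul !trmxK.
by rewrite -trmx_mul -mulmxA mulmx_ker mulmx0 trmx0.
Qed.

(** As T grows it tends to the projection of the j-th basis vector on the kernel of
    C^T. The projection itself jumps with the rank of C, whereas this
    approximation is Lipschitz in C. *)
Definition reg T C j : 'cV[R]_m :=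
  invmx (1%:M + T ^+ 2 *: (C *m C^T)) *m delta_mx j 0.

Definition regT T C j : 'cV[R]_n := C^T *m reg T C j.

Lemma reg_unit T C : 1%:M + T ^+ 2 *: (C *m C^T) \in unitmx.
Proof.
rewrite -row_free_unit -kermx_eq0; apply/rowV0P => v /sub_kermxP H.
suff : v^T = 0 by move=> /(congr1 trmx); rewrite trmxK trmx0.
have {}H : v^T + T ^+ 2 *: (C *m (C^T *m v^T)) = 0.
  move/(congr1 trmx): H; rewrite trmx0 trmx_mul linearD/= linearZ/= trmx_mul trmxK trmx1.
  by rewrite mulmxDl mul1mx -scalemxAl mulmxA.
have := congr1 (fun z => dot z v^T) H.
rewrite dotDl dotZl dot_adj [RHS](_ : _ = 0); last first.
  by rewrite /dot big1// => i _; rewrite [X in X * _]mxE mul0r.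
move=> E; apply: dot_eq0; apply/eqP; rewrite eq_le dot_ge0 andbT -E lerDl.
by rewrite mulr_ge0 ?sqr_ge0// dot_ge0.
Qed.

Lemma regE T C j : reg T C j + T ^+ 2 *: (C *m regT T C j) = delta_mx j 0.
Proof.
rewrite /regT /reg; set A := 1%:M + _; set y := invmx A *m _.
have <- : A *m y = delta_mx j 0 by rewrite /y mulmxA mulmxV ?mul1mx// reg_unit.
by rewrite /A mulmxDl mul1mx -scalemxAl mulmxA.
Qed.

(** The equation regE, paired with its solution. *)
Lemma reg_energy T C j :
  dot (reg T C j) (reg T C j) + T ^+ 2 * dot (regT T C j) (regT T C j) = reg T C j j 0.
Proof.
rewrite -[RHS]dot_delta -(regE T C j) dotDr dotZr; congr (_ + _ * _).
by rewrite [RHS]dotC dot_adj.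
Qed.

Lemma reg_le1 T C j : dot (reg T C j) (reg T C j) <= 1 /\
  T ^+ 2 * dot (regT T C j) (regT T C j) <= 1.
Proof.
have := reg_energy T C j; have := sqr_le_dot (reg T C j) j.
have := dot_ge0 (reg T C j).
have : 0 <= T ^+ 2 * dot (regT T C j) (regT T C j) by rewrite mulr_ge0 ?sqr_ge0// dot_ge0.
move: (dot _ _) (_ * dot _ _) (reg T C j j 0) => a b c; nra.
Qed.

Lemma reg_entry T C j k : `|reg T C j k 0| <= 1.
Proof.
apply: normr_le_sqr => //; rewrite expr1n.
by apply: le_trans (reg_le1 T C j).1; exact: sqr_le_dot.
Qed.

Lemma regT_entry T C j i : 0 < T -> `|regT T C j i 0| <= T^-1.
Proof.
move=> T0; apply: normr_le_sqr; first by rewrite invr_ge0 ltW.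
rewrite exprVn -[leRHS]mul1r ler_pdivlMr ?exprn_gt0// mulrC.
apply: le_trans (reg_le1 T C j).2; apply: ler_wpM2l; first exact: sqr_ge0.
exact: sqr_le_dot.
Qed.

(** The bound does not depend on T: the term that the factor T^2 makes large
    has a sign. *)
Lemma regT_close T C D j i e : 0 < T -> 0 <= e ->
  (forall k l, `|C k l - D k l| <= e) ->
  `|regT T C j i 0 - regT T D j i 0| <= (n + m)%:R ^+ 2 * e.
Proof.
move=> T0 e0 CD.
pose E := C - D; pose w := regT T C j - regT T D j.
pose a := regT T C j; pose y := reg T C j.
have Ee k l : `|E k l| <= e by rewrite /E !mxE; exact: CD.
have Ew : w = E^T *m y + D^T *m (reg T C j - reg T D j).
  by rewrite /w /regT /E linearB/= mulmxBl mulmxBr addrA subrK.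
have Ev : reg T C j - reg T D j = - (T ^+ 2 *: (E *m a + D *m w)).
  have H : reg T C j + T ^+ 2 *: (C *m a) = reg T D j + T ^+ 2 *: (D *m regT T D j).
    by rewrite !regE.
  have -> : E *m a + D *m w = C *m a - D *m regT T D j.
    by rewrite /w /E mulmxBl mulmxBr addrA subrK.
  by apply/eqP; rewrite scalerBr opprB subr_eq addrAC eq_sym subr_eq H addrC.
have wi : regT T C j i 0 - regT T D j i 0 = w i 0 by apply/esym; rewrite /w mxE [X in _ + X]mxE.
have ya k : `|y k 0| <= 1 by exact: reg_entry.
have aT k : `|a k 0| <= T^-1 by exact: regT_entry.
rewrite {}wi; clearbody w a y.
(* the last term, which has a sign, absorbs D w in the middle one *)
have id1 : dot w w = dot (E^T *m y) w - T ^+ 2 * dot (E *m a) (D *m w) -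
    T ^+ 2 * dot (D *m w) (D *m w).
  rewrite {1}Ew dotDl Ev mulmxN dotNl [dot (D^T *m _) w]dot_adj trmxK dotZl dotDl.
  by ring.
have c1 : 0 <= dot (E^T *m y - w) (E^T *m y - w) by exact: dot_ge0.
have c2 : 0 <= dot (E *m a + D *m w) (E *m a + D *m w) by exact: dot_ge0.
have x1 : dot (E^T *m y - w) (E^T *m y - w) =
    dot (E^T *m y) (E^T *m y) - 2 * dot (E^T *m y) w + dot w w.
  by rewrite dotBl !dotBr [dot w (E^T *m y)]dotC; ring.
have x2 : dot (E *m a + D *m w) (E *m a + D *m w) =
    dot (E *m a) (E *m a) + 2 * dot (E *m a) (D *m w) + dot (D *m w) (D *m w).
  by rewrite !dotDl !dotDr [dot (D *m w) (E *m a)]dotC; ring.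
have b1 : dot (E^T *m y) (E^T *m y) <= n%:R * (m%:R * e) ^+ 2.
  apply: dot_le_const => [|l]; first by rewrite mulr_ge0.
  by rewrite -[e]mulr1; apply: mulmx_entry_le => // k; rewrite mxE.
have b2 : T ^+ 2 * dot (E *m a) (E *m a) <= m%:R * (n%:R * e) ^+ 2.
  have H : dot (E *m a) (E *m a) <= m%:R * (n%:R * (e * T^-1)) ^+ 2.
    apply: dot_le_const => [|l]; first by rewrite !mulr_ge0// invr_ge0 ltW.
    by apply: mulmx_entry_le => // k; exact: aT.
  apply: le_trans (ler_wpM2l (sqr_ge0 T) H) _.
  rewrite le_eqVlt; apply/orP; left; apply/eqP.
  by field; rewrite gt_eqF.
have Tc2 := mulr_ge0 (sqr_ge0 T) c2.
have Tc3 := mulr_ge0 (sqr_ge0 T) (dot_ge0 (D *m w)).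
have fin : dot w w <= n%:R * (m%:R * e) ^+ 2 + m%:R * (n%:R * e) ^+ 2.
  move: Tc2; rewrite x2; move: c1; rewrite x1.
  move: id1 b1 b2 Tc3.
  move: (dot w w) (dot (E^T *m y) w) (dot (E *m a) (D *m w)) (dot (D *m w) (D *m w)) (dot (E *m a) (E *m a)) (dot (E^T *m y) (E^T *m y)) (T ^+ 2) (n%:R * _) (m%:R * _) => X1 X2 X3 X4 X5 X6 X7 X8 X9.
  rewrite !mulrDr [X7 * (2 * X3)]mulrCA; move: (X7 * X3) (X7 * X4) (X7 * X5) => Y3 Y4 Y5; lra.
apply: normr_le_sqr; first by rewrite mulr_ge0// sqr_ge0.
apply: le_trans (sqr_le_dot w i) _; apply: le_trans fin _.
rewrite !exprMn mulrA [m%:R * (_ * _)]mulrA -mulrDl; apply: ler_wpM2r; first exact: sqr_ge0.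
rewrite -!natrX -!natrM -natrD ler_nat.
have nm : (n * m ^ 2 + m * n ^ 2 = (n * m) * (n + m))%N by rewrite !expnS !expn0; ring.
rewrite nm; apply: leq_mul.
  by rewrite expnS expn1; apply: leq_mul; rewrite ?leq_addr ?leq_addl.
by case: (n + m)%N => // k; rewrite expnS expn1 leq_pmulr.
Qed.

Lemma reg_close T C D j k e M : 0 < T -> 0 <= e -> 0 <= M ->
  (forall k l, `|C k l - D k l| <= e) -> (forall k l, `|D k l| <= M) ->
  `|reg T C j k 0 - reg T D j k 0| <=
  T ^+ 2 * (n%:R * (T^-1 + M * (n + m)%:R ^+ 2)) * e.
Proof.
move=> T0 e0 M0 CD DM.
have H l : (T ^+ 2 *: (C *m regT T C j)) l 0 - (T ^+ 2 *: (D *m regT T D j)) l 0 =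
    T ^+ 2 * (((C - D) *m regT T C j) l 0 + (D *m (regT T C j - regT T D j)) l 0).
  rewrite mulmxBl mulmxBr !mxE; ring.
have := congr1 (fun z : 'cV[R]_m => z k 0) (etrans (regE T C j) (esym (regE T D j))).
rewrite /= [LHS]mxE [RHS]mxE => E.
have -> : reg T C j k 0 - reg T D j k 0 =
    - ((T ^+ 2 *: (C *m regT T C j)) k 0 - (T ^+ 2 *: (D *m regT T D j)) k 0).
  by move: E; lra.
rewrite H normrN normrM ger0_norm ?sqr_ge0// -mulrA; apply: ler_wpM2l; first exact: sqr_ge0.
apply: le_trans (ler_normD _ _) _; rewrite -mulrA mulrDl mulrDr; apply: lerD.
  rewrite [T^-1 * e]mulrC; apply: mulmx_entry_le => // l; first by rewrite !mxE.
  exact: regT_entry.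
rewrite -mulrA; apply: mulmx_entry_le => // l.
by rewrite [X in `|X|]mxE [X in _ + X]mxE; exact: regT_close.
Qed.

End regularized_projection.

(** * The X-gradient takes values in the range of C *)

Section X_gradient_range.
Context {R : realType} {m n : nat}.
Local Notation mu := (@leb R n).
Implicit Types (U S V : set 'cV[R]_n) (C : 'cV[R]_n -> 'M[R]_(m, n)).
Implicit Types (u : 'cV[R]_n -> R) (g phi : 'cV[R]_n -> 'cV[R]_m).

Lemma lip_on_measurable U K (f : 'cV[R]_n -> R) : open U ->
  (forall x y, U x -> U y -> `|f x - f y| <= K * `|x - y|) ->
  measurable_fun (U : set (eucl R n)) f.
Proof.
move=> oU fK; apply: continuous_on_measurable => // x Ux.
apply/(@cvgrPdist_le _ _ _ (nbhs x) (nbhs_filter x)) => e e0.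
have K1 : 0 < `|K| + 1 by rewrite ltr_pwDr.
have [r /= r0 rU] : exists2 r, 0 < r & ball x r `<=` U.
  by apply/nbhs_ballP; exact: open_nbhs_nbhs.
apply/nbhs_ballP; exists (Num.min r (e / (`|K| + 1))).
  by rewrite /= lt_min r0 divr_gt0.
move=> y; rewrite -ball_normE /= lt_min => /andP[xr xy].
have Uy : U y by apply: rU; rewrite -ball_normE.
apply: le_trans (fK x y Ux Uy) _.
move: (ltW xy); rewrite ler_pdivlMr// => H; apply: le_trans H.
rewrite mulrC; apply: ler_wpM2l => //.
by apply: le_trans (ler_norm K) _; rewrite lerDl.
Qed.

(** Let y be the regularized projection of a basis vector on the kernel of C^T. As
    T tends to infinity, testing against eta y gives in the limit a component of
    the part of g that is orthogonal to the range of C. On the other side stand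
    the divergences of the fields eta C^T y, which are uniformly Lipschitz and
    tend uniformly to zero, so that this limit is zero. *)
Lemma is_Xgrad_range U C L M u g : (0 < n)%N -> open U -> bounded_set U ->
  coef_bounds U C L M -> sqint mu U u -> is_Xgrad C U u g ->
  {ae mu, forall x, U x -> exists z, g x = C x *m z}.
Proof.
move=> n0 oU bU CU su gu.
have mU := open_leb_measurable oU; have Uoo := bounded_leb_lty bU.
have sg := (L2v_sqint _ mU).1 gu.1.
have [L0 M0 cL cM] := CU.
have [z Uz] := bounded_compl_nonempty n0 bU.
have ex x : exists zp : 'cV[R]_n * 'cV[R]_m, g x = C x *m zp.1 + zp.2 /\ (C x)^T *m zp.2 = 0.
  by have [w [p H]] := range_decomposition (C x) (g x); exists (w, p).
have [F FP] := choice ex.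
pose p x := (F x).2.
suff : {ae mu, forall x, forall j, U x -> p x j 0 = 0}.
  apply: ae_imply => x H Ux; exists (F x).1; have [{1}-> _] := FP x.
  by rewrite (_ : (F x).2 = 0) ?addr0//; apply/colP => j; rewrite [RHS]mxE; exact: H.
apply: ae_forall_fin => j.
pose T k : R := k.+1%:R.
have T0 k : 0 < T k by rewrite /T ltr0n.
have Ti1 k : (T k)^-1 <= 1 by rewrite /T invf_le1 ?ler1n ?ltr0n.
have Ti0 : (T k)^-1 @[k --> \oo] --> (0 : R) by exact: cvg_harmonic.
pose y k x := reg (T k) (C x) j.
pose a k x := regT (T k) (C x) j.
have cCx x x' : U x -> U x' -> forall k l, `|C x k l - C x' k l| <= L * `|x - x'|.
  by move=> Ux Ux' k l; exact: cL.
pose Ly k := T k ^+ 2 * (n%:R * ((T k)^-1 + M * (n + m)%:R ^+ 2)) * L.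
pose La := (n + m)%:R ^+ 2 * L.
have lipy k l x x' : U x -> U x' -> `|y k x l 0 - y k x' l 0| <= Ly k * `|x - x'|.
  move=> Ux Ux'; rewrite /Ly -mulrA.
  apply: (reg_close _ _ (T0 k) _ M0 (cCx x x' Ux Ux')); first by rewrite mulr_ge0.
  by move=> i i'; exact: cM.
have lipa k i x x' : U x -> U x' -> `|a k x i 0 - a k x' i 0| <= La * `|x - x'|.
  move=> Ux Ux'; rewrite /La -mulrA.
  by apply: (regT_close _ _ (T0 k) _ (cCx x x' Ux Ux')); rewrite mulr_ge0.
have my k l : measurable_fun (U : set (eucl R n)) (fun x => y k x l 0).
  exact: (lip_on_measurable oU (lipy k l)).
have sy k l : sqint mu U (fun x => y k x l 0).
  by apply: (@sqint_bounded _ _ _ mu U _ 1 mU Uoo (my k l)) => x _; exact: reg_entry.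
have mgy k : measurable_fun (U : set (eucl R n)) (fun x => dot (g x) (y k x)).
  exact: (rint_measurable (sqint_dot mU sg (sy k))).
pose G x := \sum_l `|g x l 0|.
have gyG k x : `|dot (g x) (y k x)| <= G x.
  by have := @dot_le_norm1 R m (g x) (y k x) 1 ler01 (fun l => reg_entry (T k) (C x) j l); rewrite mul1r.
have gyp x : dot (g x) (y k x) @[k --> \oo] --> p x j 0.
  have [gx px] := FP x.
  have E k : dot (g x) (y k x) = dot (F x).1 (a k x) + p x j 0.
    rewrite {1}gx dotDl dot_adj; congr (_ + _).
    have -> : y k x = delta_mx j 0 - T k ^+ 2 *: (C x *m a k x).
      by rewrite -(regE (T k) (C x) j) addrK.
    rewrite dotBr dot_delta dotZr [dot _ (C x *m _)]dotC dot_adj px.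
    by rewrite (_ : dot _ 0 = 0) ?mulr0 ?subr0// /dot big1// => i _; rewrite [X in _ * X]mxE mulr0.
  rewrite (_ : (fun k => _) = (fun k => dot (F x).1 (a k x) + p x j 0)); last exact/funext.
  rewrite -[X in _ --> X]add0r; apply: cvgD; last exact: cvg_cst.
  apply/cvgr0Pnorm_le => r r0.
  have : (T k)^-1 * \sum_i `|(F x).1 i 0| @[k --> \oo] --> (0 : R).
    rewrite -[X in _ --> X](mul0r (\sum_i `|(F x).1 i 0|)).
    by apply: cvgM; [exact: Ti0|exact: cvg_cst].
  move=> /cvgr0Pnorm_le/(_ r r0)[k0 _ k0P]; exists k0 => // k kk.
  apply: le_trans _ (le_trans (ler_norm _) (k0P k kk)).
  apply: dot_le_norm1; first by rewrite invr_ge0 ltW.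
  by move=> i; exact: regT_entry.
have pG x : `|p x j 0| <= G x.
  have cn : `|dot (g x) (y k x)| @[k --> \oo] --> `|p x j 0| by apply: cvg_norm; exact: gyp.
  have c2 : (G x) @[k --> \oo] --> G x by exact: cvg_cst.
  apply: (@ler_cvg_to _ _ _ _ _ _ _ _ cn c2).
  by exists 0%N => // k _; exact: gyG.
have mp : measurable_fun (U : set (eucl R n)) (fun x => p x j 0).
  apply: (@measurable_fun_cvg _ (eucl R n) R U (fun k x => dot (g x) (y k x)) (fun x => p x j 0) mgy).
  by move=> x _; exact: gyp.
have sG : sqint mu U G.
  exact: (sqint_sum (index_enum 'I_m) mU (fun l => sqint_norm mU (sg l))).
have sp : sqint mu U (fun x => p x j 0).
  apply: (@sqint_le _ _ _ mu U _ _ mU mp _ sG); apply: aeW => x _.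
  by rewrite [leRHS]ger0_norm ?pG// sumr_ge0.
apply: (orthogonal_lip_ae0 n0 oU bU sp) => eta q K /lip_ge0 lipe ve.
have SU : cutoff_support U q `<=` U by exact: (@cutoff_support_sub _ _ U z Uz).
have bS : bounded_set (cutoff_support U q) := bounded_setS SU bU.
have [B B0 eB] := lip_vanish_bounded lipe bS ve.
pose phi k x : 'cV[R]_m := eta x *: y k x.
have phiE k l : (fun x => phi k x l 0) = (fun x => eta x * y k x l 0).
  by apply/funext => x; rewrite mxE.
have vphi k l : vanish_off (cutoff_support U q) (fun x => phi k x l 0).
  by rewrite phiE => x /ve ->; rewrite mul0r.
have lipp k l := @lip_mul _ _ (cutoff_support U q) eta (fun x => y k x l 0)
  `|K| (Ly k) B 1 lipe ve eB
  (fun x x' Sx Sx' => lipy k l x x' (SU _ Sx) (SU _ Sx')) (fun x Sx => reg_entry _ _ _ l).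
have pullE' k i : pull C (phi k) i = (fun x => eta x * a k x i 0).
  apply/funext => x; rewrite /pull /a /regT mxE mulr_sumr; apply: eq_bigr => l _.
  by rewrite !mxE mulrCA.
have lipq k i := @lip_mul _ _ (cutoff_support U q) eta (fun x => a k x i 0)
  `|K| La B 1 lipe ve eB
  (fun x x' Sx Sx' => lipa k i x x' (SU _ Sx) (SU _ Sx'))
  (fun x Sx => le_trans (regT_entry (C x) j i (T0 k)) (Ti1 k)).
have bq k i x : `|eta x * a k x i 0| <= B * (T k)^-1.
  by rewrite normrM ler_pM//; exact: regT_entry.
have BT0 : B * (T k)^-1 @[k --> \oo] --> (0 : R).
  by rewrite -(mulr0 B); apply: cvgM; [exact: cvg_cst|exact: Ti0].
have wk i : \int[mu]_(x in U) (partial i (fun x => eta x * a k x i 0) x * u x) @[k --> \oo] --> 0.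
  exact: (partial_weak_cvg0 i oU bU (fun k => lipq k i) (fun k => bq k i) BT0 su).
have E k : \sum_i \int[mu]_(x in U) (partial i (fun x => eta x * a k x i 0) x * u x) =
    - \int[mu]_(x in U) (dot (g x) (y k x) * eta x).
  have lipp' l : lip `|B * `|Ly k| + `| `|K| | * `|1 : R| | (fun x => phi k x l 0).
    by rewrite phiE; apply: lip_ge0; exact: lipp.
  apply: (@etrans _ _ (\sum_i \int[mu]_(x in U) (partial i (pull C (phi k) i) x * u x))).
    by apply: eq_bigr => i _; rewrite pullE'.
  rewrite (Xgrad_lip_test n0 oU bU CU su gu (normr_ge0 _) lipp' (vphi k)); congr (- _).
  by apply: eq_Rintegral => x _; rewrite dotZr mulrC.
have c1 : \int[mu]_(x in U) (dot (g x) (y k x) * eta x) @[k --> \oo] --> 0.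
  rewrite (_ : (fun k => _) = (fun k => - \sum_i \int[mu]_(x in U) (partial i (fun x => eta x * a k x i 0) x * u x))); last first.
    by apply/funext => k; rewrite E opprK.
  rewrite -[X in _ --> X]oppr0; apply: cvgN.
  rewrite [X in _ --> X](_ : _ = \sum_(i < n) (0 : R)); last by rewrite big1.
  by apply: cvg_sum => i; exact: wk.
have me : measurable_fun (U : set (eucl R n)) eta by have [] := sqint_lip oU bU lipe.
have rBG : rint mu U (fun x => B * G x) := rintZ B mU (sqint_rint mU Uoo sG).
have c2 : \int[mu]_(x in U) (dot (g x) (y k x) * eta x) @[k --> \oo] -->
    \int[mu]_(x in U) (p x j 0 * eta x).
  apply: (@Rint_dct _ _ _ mu U (fun k x => dot (g x) (y k x) * eta x) (fun x => p x j 0 * eta x) (fun x => B * G x) mU _ _ rBG _ _).2.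
  - by move=> k; exact: (@measurable_funM _ (eucl R n) R U _ _ (mgy k) me).
  - exact: (@measurable_funM _ (eucl R n) R U _ _ mp me).
  - by apply: aeW => x _; apply: cvgM; [exact: gyp|exact: cvg_cst].
  - by apply: aeW => x k _; rewrite normrM mulrC ler_pM//; exact: gyG.
by apply: (cvg_unique _ c2 c1).
Qed.

End X_gradient_range.

(** * Quadratic forms on the range of C *)

Section elliptic_forms.
Context {R : realType} {m n : nat}.
Local Notation mu := (@leb R n).
Implicit Types (U S V : set 'cV[R]_n) (C : 'cV[R]_n -> 'M[R]_(m, n)).
Implicit Types (g f : 'cV[R]_n -> 'cV[R]_m) (A : 'cV[R]_n -> 'M[R]_m).
Implicit Types (lam Lam : R).

Lemma form_sym (B : 'M[R]_m) (v w : 'cV[R]_m) : B^T = B ->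
  dot (B *m v) w = dot (B *m w) v.
Proof. by move=> BT; rewrite dot_adj BT dotC. Qed.

(** Polarization: B is tested on c v + w and c v - w, which lie in the range of D, the
    only place where the ellipticity bounds hold. *)
Lemma form_le (B : 'M[R]_m) (D : 'M[R]_(m, n)) lam Lam y z c : B^T = B -> 0 <= lam ->
  (forall xi : 'cV[R]_n, let v := D *m xi in
     lam * dot v v <= dot (B *m v) v <= Lam * dot v v) -> 0 < c ->
  `|dot (B *m (D *m y)) (D *m z)| <=
  Lam / 2 * (c * dot (D *m y) (D *m y) + c^-1 * dot (D *m z) (D *m z)).
Proof.
move=> BT l0 HB c0; set v := D *m y; set w := D *m z.
have pol (s : R) : 0 <= dot (B *m (c *: v + s *: w)) (c *: v + s *: w) <=
    Lam * dot (c *: v + s *: w) (c *: v + s *: w).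
  have -> : c *: v + s *: w = D *m (c *: y + s *: z) by rewrite mulmxDr -!scalemxAr.
  have /andP[h1 ->] := HB (c *: y + s *: z); rewrite andbT.
  by apply: le_trans h1; rewrite mulr_ge0// dot_ge0.
have E1 (s : R) : dot (B *m (c *: v + s *: w)) (c *: v + s *: w) =
    c ^+ 2 * dot (B *m v) v + 2 * (c * s) * dot (B *m v) w + s ^+ 2 * dot (B *m w) w.
  rewrite mulmxDr -!scalemxAr !dotDl !dotDr !dotZl !dotZr (form_sym w v BT).
  by ring.
have E2 (s : R) : dot (c *: v + s *: w) (c *: v + s *: w) =
    c ^+ 2 * dot v v + 2 * (c * s) * dot v w + s ^+ 2 * dot w w.
  by rewrite !dotDl !dotDr !dotZl !dotZr (dotC w v); ring.
have := pol 1; have := pol (-1); rewrite !E1 !E2.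
move: (dot (B *m v) v) (dot (B *m v) w) (dot (B *m w) w) (dot v v) (dot v w) (dot w w) => a b d V X W.
rewrite !expr1n sqrrN !expr1n !mulr1 !mul1r => /andP[h1 h2] /andP[h3 h4].
have {}H : `|2 * (2 * c * b)| <= 2 * (Lam * (c ^+ 2 * V + W)).
  by rewrite ler_norml; apply/andP; split; nra.
move: H; rewrite !normrM (ger0_norm (ltW c0)) ger0_norm// => H.
rewrite -(ler_pM2l c0); apply: (@le_trans _ _ (Lam / 2 * (c ^+ 2 * V + W))).
  by move: H; move: (`|b|) => b'; nra.
by rewrite le_eqVlt; apply/orP; left; apply/eqP; field; rewrite gt_eqF.
Qed.

(** The Cauchy-Schwarz form of the previous bound, by the best choice of c. *)
Lemma form_sqr_le (B : 'M[R]_m) (D : 'M[R]_(m, n)) lam Lam y z : B^T = B -> 0 <= lam ->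
  0 < Lam ->
  (forall xi : 'cV[R]_n, let v := D *m xi in
     lam * dot v v <= dot (B *m v) v <= Lam * dot v v) ->
  dot (B *m (D *m y)) (D *m z) ^+ 2 <=
  Lam ^+ 2 * dot (D *m y) (D *m y) * dot (D *m z) (D *m z).
Proof.
move=> BT l0 L0 HB.
have := fun c => form_le y z BT l0 HB (c := c).
have := dot_ge0 (D *m y); have := dot_ge0 (D *m z).
move: (dot (D *m y) (D *m y)) (dot (D *m z) (D *m z)) (dot (B *m _) _) => V W b W0 V0 H.
have [b0|b0] := eqVneq b 0; first by rewrite b0 expr0n/= !mulr_ge0// ltW.
have nb : 0 < `|b| by rewrite normr_gt0.
have [V1|V1] := eqVneq V 0.
  have [W1|W1] := eqVneq W 0.
    have := H 1 ltr01; rewrite V1 W1 !mulr0 addr0 mulr0 => /le_lt_trans/(_ nb).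
    by rewrite ltxx.
  have cp : 0 < Lam * W / `|b| by rewrite !mulr_gt0 ?invr_gt0// lt_neqAle eq_sym W1.
  have := H _ cp; rewrite V1 mulr0 add0r invfM invrK.
  have -> : Lam / 2 * ((Lam * W)^-1 * `|b| * W) = `|b| / 2.
    by field; rewrite W1 gt_eqF.
  by move=> H'; exfalso; move: nb H'; lra.
have Vp : 0 < V by rewrite lt_neqAle eq_sym V1.
have cp : 0 < `|b| / (Lam * V) by rewrite divr_gt0// mulr_gt0.
have := H _ cp.
have -> : Lam / 2 * (`|b| / (Lam * V) * V + (`|b| / (Lam * V))^-1 * W) =
   `|b| / 2 + Lam ^+ 2 * V * W / (2 * `|b|).
  by field; rewrite normr_eq0 b0 V1 gt_eqF.
move=> H'; rewrite -[b ^+ 2]real_normK ?num_real//.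
have {}H' : `|b| / 2 <= Lam ^+ 2 * V * W / (2 * `|b|) by lra.
move: H'; rewrite ler_pdivlMr ?mulr_gt0// => H'; apply: le_trans H'.
by rewrite le_eqVlt; apply/orP; left; apply/eqP; field.
Qed.

(** Square integrable fields with values in the range of C, on which the
    ellipticity bounds of A are available. *)
Definition range_field U C g : Prop :=
  (forall j, sqint mu U (fun x => g x j 0)) /\
  {ae mu, forall x, U x -> exists z, g x = C x *m z}.

Lemma range_fieldS U V C g : measurable (U : set (eucl R n)) ->
  measurable (V : set (eucl R n)) -> V `<=` U -> range_field U C g -> range_field V C g.
Proof.
move=> mU mV VU [sg gr]; split; first by move=> j; exact: (sqintS mU mV VU (sg j)).
by apply: ae_imply gr => x H /VU; exact: H.
Qed.

Lemma coef_measurable U C L M : open U -> coef_bounds U C L M ->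
  forall j i, measurable_fun (U : set (eucl R n)) (fun x => C x j i).
Proof.
by move=> oU [_ _ cL _] j i; apply: (lip_on_measurable (K := L) oU) => x y Ux Uy; exact: cL.
Qed.

Lemma range_field_mul U C L M (Phi : 'cV[R]_n -> 'cV[R]_n) : open U -> coef_bounds U C L M ->
  (forall i, sqint mu U (fun x => Phi x i 0)) -> range_field U C (fun x => C x *m Phi x).
Proof.
move=> oU CU sP; have mU := open_leb_measurable oU; split; last first.
  by apply: aeW => x _; exists (Phi x).
move=> j.
have s1 i : sqint mu U (fun x => C x j i * Phi x i 0).
  apply: (@sqintM_bounded _ _ _ mu U _ _ M mU (coef_measurable oU CU j i) _ (sP i)).
  by have [_ _ _ cM] := CU; apply: aeW => x Ux; exact: cM.
by apply: (eq_sqint mU _ (sqint_sum (index_enum 'I_n) mU s1)) => x _; rewrite mxE.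
Qed.

Lemma range_field_Xgrad U C L M u g : (0 < n)%N -> open U -> bounded_set U ->
  coef_bounds U C L M -> sqint mu U u -> is_Xgrad C U u g -> range_field U C g.
Proof.
move=> n0 oU bU CU su gu; have mU := open_leb_measurable oU.
by split; [exact/(L2v_sqint _ mU).1/gu.1|exact: is_Xgrad_range n0 oU bU CU su gu].
Qed.

Definition sqnorm U g : R := \int[mu]_(x in U) dot (g x) (g x).

Lemma sqnorm_rint U C g : measurable (U : set (eucl R n)) -> range_field U C g ->
  rint mu U (fun x => dot (g x) (g x)).
Proof. by move=> mU [sg _]; exact: sqint_dot. Qed.

Lemma sqnorm_ge0 U g : 0 <= sqnorm U g.
Proof. by apply: Rintegral_ge0 => x _; exact: dot_ge0. Qed.

Lemma classE_sub U V C A lam Lam : measurable (U : set (eucl R n)) ->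
  measurable (V : set (eucl R n)) -> V `<=` U ->
  classE U lam Lam C A -> classE V lam Lam C A.
Proof.
move=> mU mV VU [As mA HA]; split.
- by move=> x /VU; exact: As.
- by move=> i j; exact: (measurable_funS mU VU (mA i j)).
- by apply: ae_imply HA => x H /VU; exact: H.
Qed.

Definition form_int U A g f : R := \int[mu]_(x in U) dot (A x *m g x) (f x).

Lemma form_measurable U C A lam Lam g f : measurable (U : set (eucl R n)) ->
  classE U lam Lam C A -> range_field U C g -> range_field U C f ->
  measurable_fun (U : set (eucl R n)) (fun x => dot (A x *m g x) (f x)).
Proof.
move=> mU [_ mA _] [sg _] [sf _].
have m1 j k : measurable_fun (U : set (eucl R n)) (fun x => A x j k * g x k 0 * f x j 0).
  apply: (@measurable_funM _ (eucl R n) R U _ _ _ (sf j).1).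
  exact: (@measurable_funM _ (eucl R n) R U _ _ (mA j k) (sg k).1).
have -> : (fun x => dot (A x *m g x) (f x)) =
    (fun x => \sum_j \sum_k A x j k * g x k 0 * f x j 0).
  by apply/funext => x; apply: eq_bigr => j _; rewrite mxE mulr_suml.
have ms (I : Type) (s : seq I) (F : I -> 'cV[R]_n -> R) :
    (forall i, measurable_fun (U : set (eucl R n)) (F i)) ->
    measurable_fun (U : set (eucl R n)) (fun x => \sum_(i <- s) F i x).
  move=> mF; exact: (@measurable_sum _ (eucl R n) R U I s F mF).
by apply: (ms) => j; apply: (ms) => k; exact: m1.
Qed.

Lemma form_ae_le U C A lam Lam g f c : classE U lam Lam C A -> 0 <= lam -> 0 < c ->
  range_field U C g -> range_field U C f ->
  {ae mu, forall x, U x -> `|dot (A x *m g x) (f x)| <=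
     Lam / 2 * (c * dot (g x) (g x) + c^-1 * dot (f x) (f x))}.
Proof.
move=> [As _ HA] l0 c0 [_ gr] [_ fr].
apply: ae_imply (ae_and HA (ae_and gr fr)) => x [H1 [H2 H3]] Ux.
have [z1 ->] := H2 Ux; have [z2 ->] := H3 Ux.
exact: (form_le z1 z2 (As x Ux) l0 (H1 Ux) c0).
Qed.

Lemma form_rint U C A lam Lam g f : measurable (U : set (eucl R n)) ->
  classE U lam Lam C A -> 0 <= lam -> range_field U C g -> range_field U C f ->
  rint mu U (fun x => dot (A x *m g x) (f x)).
Proof.
move=> mU EA l0 rg rf.
have r1 := rintZ 1 mU (sqnorm_rint mU rg).
have r2 := rintZ (1^-1) mU (sqnorm_rint mU rf).
have r3 := rintZ (Lam / 2) mU (rintD mU r1 r2).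
exact: (rint_ae_le mU (form_measurable mU EA rg rf) (form_ae_le EA l0 ltr01 rg rf) r3).
Qed.

Lemma form_int_le U C A lam Lam g f c : measurable (U : set (eucl R n)) ->
  classE U lam Lam C A -> 0 <= lam -> 0 < c -> range_field U C g -> range_field U C f ->
  `|form_int U A g f| <= Lam / 2 * (c * sqnorm U g + c^-1 * sqnorm U f).
Proof.
move=> mU EA l0 c0 rg rf.
have r1 := rintZ c mU (sqnorm_rint mU rg).
have r2 := rintZ (c^-1) mU (sqnorm_rint mU rf).
have r3 := rintZ (Lam / 2) mU (rintD mU r1 r2).
have rF := form_rint mU EA l0 rg rf.
have -> : Lam / 2 * (c * sqnorm U g + c^-1 * sqnorm U f) =
    \int[mu]_(x in U) (Lam / 2 * (c * dot (g x) (g x) + c^-1 * dot (f x) (f x))).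
  apply/esym; apply: (etrans (RintegralZl _ mU (rintD mU r1 r2))); congr (_ * _).
  apply: (etrans (RintegralD mU r1 r2)); congr (_ + _).
    exact: (RintegralZl _ mU (sqnorm_rint mU rg)).
  exact: (RintegralZl _ mU (sqnorm_rint mU rf)).
apply: (le_trans (le_normr_Rintegral mU rF)).
apply: (le_Rint_ae mU (integrable_norm rF) r3).
exact: (form_ae_le EA l0 c0 rg rf).
Qed.

Lemma form_int_bounds U C A lam Lam g : measurable (U : set (eucl R n)) ->
  classE U lam Lam C A -> 0 <= lam -> range_field U C g ->
  lam * sqnorm U g <= form_int U A g g <= Lam * sqnorm U g.
Proof.
move=> mU EA l0 rg; have r1 := sqnorm_rint mU rg; have rF := form_rint mU EA l0 rg rg.
have H : {ae mu, forall x, U x -> lam * dot (g x) (g x) <= dot (A x *m g x) (g x) <=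
    Lam * dot (g x) (g x)}.
  have [_ _ HA] := EA; have [_ gr] := rg.
  by apply: ae_imply (ae_and HA gr) => x [H1 H2] Ux; have [z ->] := H2 Ux; exact: (H1 Ux).
rewrite /sqnorm -(RintegralZl lam mU r1) -(RintegralZl Lam mU r1); apply/andP; split.
  apply: (le_Rint_ae mU (rintZ lam mU r1) rF).
  by apply: ae_imply H => x H /H/andP[].
apply: (le_Rint_ae mU rF (rintZ Lam mU r1)).
by apply: ae_imply H => x H /H/andP[].
Qed.

Lemma form_int_ge0 U C A lam Lam g : measurable (U : set (eucl R n)) ->
  classE U lam Lam C A -> 0 <= lam -> range_field U C g -> 0 <= form_int U A g g.
Proof.
move=> mU EA l0 rg; have /andP[h _] := form_int_bounds mU EA l0 rg.
by apply: le_trans h; rewrite mulr_ge0// sqnorm_ge0.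
Qed.

Lemma form_intDZ U C A lam Lam g f t : measurable (U : set (eucl R n)) ->
  classE U lam Lam C A -> 0 <= lam -> range_field U C g -> range_field U C f ->
  form_int U A (fun x => g x + t *: f x) (fun x => g x + t *: f x) =
  form_int U A g g + (2 * t) * form_int U A g f + t ^+ 2 * form_int U A f f.
Proof.
move=> mU EA l0 rg rf; have [As _ _] := EA.
have r1 := form_rint mU EA l0 rg rg.
have r2 := rintZ (2 * t) mU (form_rint mU EA l0 rg rf).
have r3 := rintZ (t ^+ 2) mU (form_rint mU EA l0 rf rf).
apply: (@etrans _ _ (\int[mu]_(x in U) (dot (A x *m g x) (g x) +
    2 * t * dot (A x *m g x) (f x) + t ^+ 2 * dot (A x *m f x) (f x)))).
  apply: eq_Rintegral => x; rewrite inE => Ux.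
  rewrite mulmxDr -scalemxAr !dotDl !dotDr !dotZl !dotZr (form_sym (f x) (g x) (As x Ux)).
  by ring.
apply: (etrans (RintegralD mU (rintD mU r1 r2) r3)); congr (_ + _).
  apply: (etrans (RintegralD mU r1 r2)); congr (_ + _).
  exact: (RintegralZl _ mU (form_rint mU EA l0 rg rf)).
exact: (RintegralZl _ mU (form_rint mU EA l0 rf rf)).
Qed.

Lemma form_intDr U C A lam Lam g f f' : measurable (U : set (eucl R n)) ->
  classE U lam Lam C A -> 0 <= lam -> range_field U C g -> range_field U C f ->
  range_field U C f' ->
  form_int U A g (fun x => f x + f' x) = form_int U A g f + form_int U A g f'.
Proof.
move=> mU EA l0 rg rf rf'.
have r1 := form_rint mU EA l0 rg rf; have r2 := form_rint mU EA l0 rg rf'.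
apply: etrans _ (RintegralD mU r1 r2).
by apply: eq_Rintegral => x _; rewrite dotDr.
Qed.

Lemma is_Xgrad_W12 U C u : W12 C U u -> is_Xgrad C U u (Xgrad C U u).
Proof. by move=> [_ [g gu]]; exact: (xgetPex (fun=> 0) (ex_intro [set g | is_Xgrad C U u g] g gu)). Qed.

(** By uniqueness of the X-gradient, any representative computes the energy. *)
Lemma energyE U C L M A lam Lam u g : (0 < n)%N -> open U -> bounded_set U ->
  coef_bounds U C L M -> classE U lam Lam C A -> 0 <= lam ->
  L2 U u -> is_Xgrad C U u g -> energy C A U u = (form_int U A g g)%:E.
Proof.
move=> n0 oU bU CU EA l0 uL2 gu; have mU := open_leb_measurable oU.
have su : sqint mu U u by apply/(L2_sqint _ mU).
have Wu : W12 C U u by split => //; exists g.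
have Gu := is_Xgrad_W12 Wu.
have rg := range_field_Xgrad n0 oU bU CU su gu.
have rG := range_field_Xgrad n0 oU bU CU su Gu.
rewrite /energy asboolT//.
have i1 := form_rint mU EA l0 rG rG.
have fi : (\int[mu]_(x in U) (dot (A x *m Xgrad C U u x) (Xgrad C U u x))%:E)%E \is a fin_num.
  exact: (integrable_fin_num mU i1).
rewrite -(fineK fi); congr EFin.
apply: (Rint_ae_eq mU (form_measurable mU EA rG rG) (form_measurable mU EA rg rg)).
have := is_Xgrad_unique n0 oU bU CU su Gu gu.
by apply: ae_imply => x H Ux; rewrite (H Ux).
Qed.

End elliptic_forms.

(** * Localization of the energies *)

Section limits_superior.
Context {R : realType}.
Implicit Types (v : nat -> \bar R) (c : \bar R).

Lemma limn_esup_lt v c : (limn_esup v < c)%E -> exists N, forall h, (N <= h)%N -> (v h < c)%E.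
Proof.
move=> /ereal_inf_lt[_ [V [N _ NV] <-]] H; exists N => h Nh.
by apply: le_lt_trans H; apply: ereal_sup_ubound; exists h => //; exact: NV.
Qed.

Lemma limn_einf_gt v c : (c < limn_einf v)%E -> exists N, forall h, (N <= h)%N -> (c < v h)%E.
Proof.
move=> cv; have : (limn_esup (-%E \o v) < - c)%E by rewrite limn_esupN lteN2.
by move=> /limn_esup_lt[N NP]; exists N => h /NP; rewrite /= lteN2.
Qed.

Lemma cvgD0 (s t : nat -> R) (l : R) : t @ \oo --> l -> s @ \oo --> (0 : R) ->
  t k + s k @[k --> \oo] --> l.
Proof. by move=> tl s0; rewrite -[l]addr0; exact: cvgD. Qed.

Lemma cvg0Z (a : R) (s : nat -> R) : s @ \oo --> (0 : R) -> a * s k @[k --> \oo] --> (0 : R).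
Proof. by move=> s0; rewrite -(mulr0 a); apply: cvgM; [exact: cvg_cst|exact: s0]. Qed.

End limits_superior.

Section energy_localization.
Context {R : realType} {m n : nat}.
Local Notation mu := (@leb R n).
Implicit Types (U S V Omega : set 'cV[R]_n) (C : 'cV[R]_n -> 'M[R]_(m, n)).
Implicit Types (g f : 'cV[R]_n -> 'cV[R]_m) (A : 'cV[R]_n -> 'M[R]_m).
Implicit Types (lam Lam : R) (a b : 'cV[R]_n).

Definition cbox a b : set 'cV[R]_n := [set x | forall i, a i 0 <= x i 0 <= b i 0].

Lemma closed_cbox a b : closed (cbox a b).
Proof.
have -> : cbox a b = \bigcap_(i in setT) ((fun x : 'cV[R]_n => x i 0) @^-1` `[a i 0, b i 0]).
  apply/seteqP; split => x /=.
    by move=> H i _ /=; have := H i; rewrite in_itv.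
  by move=> H i; have := H i I; rewrite /= in_itv.
apply: closed_bigI => i _; apply: closed_comp; last exact: itv_closed.
by move=> x _; exact: lip_continuous (lip_coord i) x.
Qed.

(** The faces of the box are negligible. *)
Lemma Rint_box_split U a b (f : 'cV[R]_n -> R) : open U -> rint mu U f ->
  \int[mu]_(x in U) f x =
  \int[mu]_(x in U `&` obox a b) f x + \int[mu]_(x in U `\` cbox a b) f x.
Proof.
move=> oU rf; have mU := open_leb_measurable oU.
have mV : measurable (U `&` obox a b : set (eucl R n)).
  by apply: open_leb_measurable; apply: openI => //; exact: open_obox.
have mV' : measurable (U `\` cbox a b : set (eucl R n)).
  apply: open_leb_measurable; rewrite setDE; apply: openI => //.
  by apply: closed_openC; exact: closed_cbox.
pose W : set (eucl R n) := (U `&` obox a b) `|` (U `\` cbox a b).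
have mW : measurable W by exact: measurableU.
have WU : W `<=` U by move=> x [[]|[]].
have rW : rint mu W f by apply: integrableS rf.
have dj : [disjoint (U `&` obox a b : set (eucl R n)) & (U `\` cbox a b : set (eucl R n))]%classic.
  apply/disj_setPS => x [[_ H] [_ H']]; apply: H' => i.
  by have /andP[h1 h2] := H i; rewrite !ltW.
apply: etrans _ (Rintegral_setU mV mV' rW dj).
rewrite [LHS]Rintegral_mkcond [RHS]Rintegral_mkcond.
have mf : measurable_fun (setT : set (eucl R n)) (f \_ U).
  by apply/(measurable_restrictT _ mU).1; exact: (rint_measurable rf).
have mfW : measurable_fun (setT : set (eucl R n)) (f \_ W).
  by apply/(measurable_restrictT _ mW).1; exact: (rint_measurable rW).
apply: (Rint_ae_eq measurableT mf mfW).
have face (c : 'cV[R]_n) i : {ae mu, forall x : 'cV[R]_n, x i 0 <> c i 0}.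
  exists [set x : 'cV[R]_n | x i 0 = c i 0]; split.
  - apply: borel_col_measurable; apply: closed_borel_col.
    suff : closed ((fun x : 'cV[R]_n => x i 0) @^-1` [set y | y = c i 0]) by [].
    apply: closed_comp; last exact: closed_eq.
    by move=> x _; exact: lip_continuous (lip_coord i) x.
  - exact: leb_hyperplane.
  - by move=> x /= /contrapT.
have faces := ae_and (ae_forall_fin (face a)) (ae_forall_fin (face b)).
apply: ae_imply faces => x [xa xb] _; rewrite !restrict_indicE !indicE.
congr (_ * _%:R); have [Ux|Ux] := pselect (U x); last first.
  by rewrite !memNset// => /WU.
rewrite !mem_set//; have [Qx|Qx] := pselect (cbox a b x); last by right.
left; split => // i; have /andP[h1 h2] := Qx i.
by rewrite !lt_neqAle h1 h2 !andbT; apply/andP; split; apply/eqP => // /esym; exact: xa.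
Qed.

Lemma L2_cvgDr Omega (vh : nat -> 'cV[R]_n -> R) v w :
  L2_cvg Omega vh v -> L2_cvg Omega (fun h x => vh h x + w x) (fun x => v x + w x).
Proof.
suff E h : (fun x => vh h x + w x) \- (fun x => v x + w x) = vh h \- v.
  by rewrite /L2_cvg; under [in X in _ -> X]eq_fun do rewrite E.
by apply/funext => x /=; rewrite opprD addrACA subrr addr0.
Qed.

Lemma W12_energy U C A v e : (energy C A U v < e%:E)%E -> W12 C U v.
Proof. by rewrite /energy; case: asboolP. Qed.

Lemma dot_mul_delta (v : 'cV[R]_m) (D : 'M[R]_(m, n)) (y : 'cV[R]_n) :
  dot v (D *m y) = \sum_i dot v (D *m delta_mx i 0) * y i 0.
Proof.
rewrite dotC dot_adj dotC; apply: eq_bigr => i _; congr (_ * _).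
by rewrite dotC dot_adj dotC dot_delta.
Qed.

Lemma form_coef_sqint U (D : 'cV[R]_n -> 'M[R]_(m, n)) B lam Lam M g (xi : 'cV[R]_n) :
  measurable (U : set (eucl R n)) -> 0 <= lam -> 0 < Lam -> 0 <= M ->
  (forall x j i, U x -> `|D x j i| <= M) -> classE U lam Lam D B -> range_field U D g ->
  range_field U D (fun x => D x *m xi) ->
  sqint mu U (fun x => dot (B x *m g x) (D x *m xi)) /\
  \int[mu]_(x in U) (dot (B x *m g x) (D x *m xi) ^+ 2) <=
    Lam ^+ 2 * (m%:R * (n%:R * (M * `|xi|)) ^+ 2) * sqnorm U g.
Proof.
move=> mU l0 L0 M0 DM EB rg rx; set k := m%:R * _.
have mp := form_measurable mU EB rg rx.
have mp2 : measurable_fun (U : set (eucl R n)) (fun x => dot (B x *m g x) (D x *m xi) ^+ 2).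
  exact: (@measurable_funX _ (eucl R n) R U _ 2 mp).
have r1 := sqnorm_rint mU rg.
have H : {ae mu, forall x, U x -> dot (B x *m g x) (D x *m xi) ^+ 2 <=
    Lam ^+ 2 * k * dot (g x) (g x)}.
  have [Bs _ HB] := EB; have [_ gr] := rg.
  apply: ae_imply (ae_and HB gr) => x [H1 H2] Ux; have [z ->] := H2 Ux.
  apply: (le_trans (form_sqr_le z xi (Bs x Ux) l0 L0 (H1 Ux))).
  rewrite mulrAC; apply: ler_wpM2r; first exact: dot_ge0.
  apply: ler_wpM2l; first exact: sqr_ge0.
  apply: dot_le_const; first by rewrite !mulr_ge0.
  by move=> j; apply: mulmx_entry_le => // l; [exact: DM|exact: entry_le_norm].
have r2 := rintZ (Lam ^+ 2 * k) mU r1.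
have rp : rint mu U (fun x => dot (B x *m g x) (D x *m xi) ^+ 2).
  apply: (rint_ae_le mU mp2 _ r2).
  by apply: ae_imply H => x H Ux; rewrite ger0_norm ?sqr_ge0//; exact: H.
split; first by split.
rewrite /sqnorm -(RintegralZl _ mU r1).
exact: (le_Rint_ae mU rp r2 H).
Qed.

Lemma sqnorm_sub U V g : measurable (U : set (eucl R n)) ->
  measurable (V : set (eucl R n)) -> V `<=` U ->
  (forall j, sqint mu U (fun x => g x j 0)) -> sqnorm V g <= sqnorm U g.
Proof.
move=> mU mV VU sg; have r := sqint_dot mU sg sg.
have rV : rint mu V (fun x => dot (g x) (g x)) := integrableS mU mV VU r.
apply: fine_le.
- exact: (integrable_fin_num mV rV).
- exact: (integrable_fin_num mU r).
have mr : measurable_fun (U : set (eucl R n)) (fun x => (dot (g x) (g x))%:E).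
  by have /integrableP[] := r.
exact: (ge0_subset_integral mu mV mU mr (fun x _ => dot_ge0 (g x)) VU).
Qed.

Lemma sqnormD_le U g f : measurable (U : set (eucl R n)) ->
  (forall j, sqint mu U (fun x => g x j 0)) -> (forall j, sqint mu U (fun x => f x j 0)) ->
  sqnorm U (fun x => g x + f x) <= 2 * sqnorm U g + 2 * sqnorm U f.
Proof.
move=> mU sg sf; have r1 := sqint_dot mU sg sg; have r2 := sqint_dot mU sf sf.
have sgf j : sqint mu U (fun x => (g x + f x) j 0).
  by apply: (eq_sqint mU _ (sqintD mU (sg j) (sf j))) => x _; rewrite mxE.
have r3 := sqint_dot mU sgf sgf.
have E : 2 * sqnorm U g + 2 * sqnorm U f =
    \int[mu]_(x in U) (2 * dot (g x) (g x) + 2 * dot (f x) (f x)).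
  apply/esym; apply: (etrans (RintegralD mU (rintZ 2 mU r1) (rintZ 2 mU r2))).
  by congr (_ + _); [exact: (RintegralZl _ mU r1)|exact: (RintegralZl _ mU r2)].
rewrite E; apply: (le_Rint_ae mU r3 (rintD mU (rintZ 2 mU r1) (rintZ 2 mU r2))).
apply: aeW => x _; rewrite !dotDl !dotDr (dotC (f x) (g x)).
have := dot_ge0 (g x - f x); rewrite dotBl !dotBr (dotC (f x) (g x)).
by lra.
Qed.

Lemma L2v_cvg_sqnorm U (gh : nat -> 'cV[R]_n -> 'cV[R]_m) g :
  measurable (U : set (eucl R n)) ->
  (forall h j, sqint mu U (fun x => (gh h x - g x) j 0)) -> L2v_cvg U gh g ->
  sqnorm U (fun x => gh h x - g x) @[h --> \oo] --> 0.
Proof.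
move=> mU sd cg.
have E h : sqnorm U (fun x => gh h x - g x) =
    \sum_j \int[mu]_(x in U) ((gh h x j 0 - g x j 0) ^+ 2).
  rewrite /sqnorm (Rint_dot mU (sd h) (sd h)); apply: eq_bigr => j _.
  by apply: eq_Rintegral => x _; rewrite expr2 !mxE.
rewrite (_ : (fun h => _) = (fun h => \sum_j \int[mu]_(x in U) ((gh h x j 0 - g x j 0) ^+ 2))); last exact/funext.
rewrite [X in _ --> X](_ : _ = \sum_(j < m) (0 : R)); last by rewrite big1.
apply: cvg_sum => j; apply: (L2_cvg_Rint mU _ (cg j)) => h.
by apply: (eq_sqint mU _ (sd h j)) => x _; rewrite !mxE.
Qed.

End energy_localization.

(** * Convergence of the momenta *)

Section box_flux.
Context {R : realType} {m n : nat}.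
Local Notation mu := (@leb R n).
Context (Omega : set 'cV[R]_n) (Ch : nat -> 'cV[R]_n -> 'M[R]_(m, n)).
Context (C : 'cV[R]_n -> 'M[R]_(m, n)) (lam Lam M : R).
Context (Ah : nat -> 'cV[R]_n -> 'M[R]_m) (A : 'cV[R]_n -> 'M[R]_m).
Context (N0 : nat).
Hypotheses (n0 : (0 < n)%N) (oO : open Omega) (bO : bounded_set Omega).
Hypothesis CO : exists L L', coef_bounds Omega C L L'.
Hypothesis ChO : forall h, exists L L', coef_bounds Omega (Ch h) L L'.
Hypothesis M0 : 0 <= M.
Hypothesis ChM : forall h x j i, (N0 <= h)%N -> Omega x -> `|Ch h x j i| <= M.
Hypotheses (l0 : 0 < lam) (lL : lam <= Lam).
Hypothesis EAh : forall h, classE Omega lam Lam (Ch h) (Ah h).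
Hypothesis EA : classE Omega lam Lam C A.
Hypothesis liminf : forall V, open V -> V `<=` Omega -> forall v vh, L2 Omega v ->
  (forall h, L2 Omega (vh h)) -> L2_cvg Omega vh v ->
  (energy C A V v <= limn_einf (fun h => energy (Ch h) (Ah h) V (vh h)))%E.
Context (U : set 'cV[R]_n) (u : 'cV[R]_n -> R) (uh : nat -> 'cV[R]_n -> R).
Hypotheses (oU : open U) (UO : U `<=` Omega) (uL2 : L2 Omega u) (Wu : W12 C U u).
Hypothesis rec : recovery_sequence Omega (fun h => energy (Ch h) (Ah h) U)
  (energy C A U) u uh.

Local Notation G := (Xgrad C U u).
Local Notation Gh h := (Xgrad (Ch h) U (uh h)).

Let bU : bounded_set U := bounded_setS UO bO.
Let mO := open_leb_measurable oO.
Let mU := open_leb_measurable oU.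
Let l0' : 0 <= lam := ltW l0.
Let Lam0 : 0 < Lam := lt_le_trans l0 lL.
Let sO v : L2 Omega v -> sqint mu Omega v := (L2_sqint v mO).1.

Lemma limit_range_field : range_field U C G.
Proof.
have [L [L' CL]] := CO.
have su : sqint mu U u := sqintS mO mU UO (sO uL2).
exact: (range_field_Xgrad n0 oU bU (coef_boundsS UO CL) su (is_Xgrad_W12 Wu)).
Qed.

Lemma recovery_range_field h : W12 (Ch h) U (uh h) -> range_field U (Ch h) (Gh h).
Proof.
move=> W; have [L [L' CL]] := ChO h.
have su : sqint mu U (uh h) := (L2_sqint _ mU).1 W.1.
exact: (range_field_Xgrad n0 oU bU (coef_boundsS UO CL) su (is_Xgrad_W12 W)).
Qed.

Lemma recovery_energy_le e : 0 < e -> exists N, forall h, (N <= h)%N ->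
  W12 (Ch h) U (uh h) /\ form_int U (Ah h) (Gh h) (Gh h) < form_int U A G G + e.
Proof.
move=> e0; have [_ _ supF] := rec.
have [L [L' CL]] := CO.
have E := energyE n0 oU bU (coef_boundsS UO CL) (classE_sub mO mU UO EA) l0' Wu.1 (is_Xgrad_W12 Wu).
have : (limn_esup (fun h => energy (Ch h) (Ah h) U (uh h)) < (form_int U A G G + e)%:E)%E.
  by apply: le_lt_trans supF _; rewrite E lte_fin ltrDl.
move=> /limn_esup_lt[N NP]; exists N => h /NP H.
have W := W12_energy H; split => //; have [Lh [Lh' CLh]] := ChO h.
move: H; rewrite (energyE n0 oU bU (coef_boundsS UO CLh) (classE_sub mO mU UO (EAh h)) l0' W.1 (is_Xgrad_W12 W)).
by rewrite lte_fin.
Qed.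

Lemma coef_field_range V (D : 'cV[R]_n -> 'M[R]_(m, n)) (xi : 'cV[R]_n) : open V ->
  V `<=` Omega -> (exists L L', coef_bounds Omega D L L') ->
  range_field V D (fun x => D x *m xi).
Proof.
move=> oV VO [L [L' CL]]; have bV := bounded_setS VO bO.
apply: (range_field_mul (Phi := fun=> xi) oV (coef_boundsS VO CL)) => i.
apply: (@sqint_bounded _ _ _ mu V _ `|xi i 0| (open_leb_measurable oV) (bounded_leb_lty bV)).
  exact: measurable_cst.
by move=> x _.
Qed.

(** The linear perturbation is an admissible competitor whose X-gradient is explicit,
    which makes the energy a quadratic polynomial in t. *)
Lemma energy_perturbed V (D : 'cV[R]_n -> 'M[R]_(m, n)) B v t (xi : 'cV[R]_n) : open V ->
  V `<=` U -> (exists L L', coef_bounds Omega D L L') -> classE Omega lam Lam D B ->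
  W12 D U v ->
  energy D B V (fun x => v x + t * dot xi x) =
  (form_int V B (Xgrad D U v) (Xgrad D U v) +
   (2 * t) * form_int V B (Xgrad D U v) (fun x => D x *m xi) +
   t ^+ 2 * form_int V B (fun x => D x *m xi) (fun x => D x *m xi))%:E.
Proof.
move=> oV VU exD EB Wv; have [L [L' CL]] := exD; have VO := subset_trans VU UO.
have mV := open_leb_measurable oV; have bV := bounded_setS VO bO.
have CV := coef_boundsS VO CL; have CU := coef_boundsS UO CL.
have svU : sqint mu U v := (L2_sqint _ mU).1 Wv.1.
have svV : sqint mu V v := sqintS mU mV VU svU.
have gV := is_Xgrad_sub oU bU oV VU CU svU (is_Xgrad_W12 Wv).
have lV := is_Xgrad_linear xi oV bV CV (coef_measurable oV CV).
have [Kx lipx] : exists K, lip K (dot xi) by exact: lip_dot.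
have swV : sqint mu V (dot xi) := sqint_lip oV bV lipx.
have gl := is_XgradDZ t oV bV CV svV swV gV lV.
have EV := classE_sub mO mV VO EB.
have L2w : L2 V (fun x => v x + t * dot xi x).
  by apply/(L2_sqint _ mV); exact: (sqintD mV svV (sqintZ t mV swV)).
rewrite (energyE n0 oV bV CV EV l0' L2w gl); congr EFin.
apply: (form_intDZ _ mV EV l0'); last exact: coef_field_range.
exact: (range_field_Xgrad n0 oV bV CV svV gV).
Qed.

Lemma coef_form_le h V (xi : 'cV[R]_n) : (N0 <= h)%N -> open V -> V `<=` Omega ->
  form_int V (Ah h) (fun x => Ch h x *m xi) (fun x => Ch h x *m xi) <=
  Lam * (m%:R * (n%:R * (M * `|xi|)) ^+ 2 * fine (mu V)).
Proof.
move=> Nh oV VO; have mV := open_leb_measurable oV; have bV := bounded_setS VO bO.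
have rg := coef_field_range xi oV VO (ChO h).
have /andP[_ H] := form_int_bounds mV (classE_sub mO mV VO (EAh h)) l0' rg.
apply: le_trans H _; apply: ler_wpM2l; first exact: ltW.
rewrite -(Rintegral_cst mu mV); apply: (le_Rint_ae mV (sqnorm_rint mV rg)).
  apply: (sqint_rint mV (bounded_leb_lty bV)).
  apply: (@sqint_bounded _ _ _ mu V _ `|m%:R * (n%:R * (M * `|xi|)) ^+ 2| mV (bounded_leb_lty bV)).
    exact: measurable_cst.
  by move=> x _.
apply: aeW => x Vx; apply: dot_le_const; first by rewrite !mulr_ge0.
move=> j; apply: mulmx_entry_le => // [l|l]; last exact: entry_le_norm.
by apply: ChM => //; exact: VO.
Qed.

Lemma energy_box_split V' a b (D : 'cV[R]_n -> 'M[R]_(m, n)) B g : V' = U `\` cbox a b ->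
  classE Omega lam Lam D B -> range_field U D g ->
  form_int U B g g = form_int (U `&` obox a b) B g g + form_int V' B g g.
Proof.
move=> -> EB rg.
exact: (Rint_box_split a b oU (form_rint mU (classE_sub mO mU UO EB) l0' rg rg)).
Qed.

(** Here a, b are the energies on the box and on its complement, k is the first
    variation and q the second one; primes denote the approximating quantities.
    The error d^2 is negligible with respect to the increment d of t. *)
Lemma first_variation_bound (d e D a b k q a' b' k' q' y z y' z' : R) :
  0 < d -> d * (D + 3) = e -> 0 <= q -> q' <= D -> a' + b' < a + b + d ^+ 2 ->
  b + 2 * 0 * y + 0 ^+ 2 * z - d ^+ 2 < b' + 2 * 0 * y' + 0 ^+ 2 * z' ->
  a + 2 * d * k + d ^+ 2 * q - d ^+ 2 < a' + 2 * d * k' + d ^+ 2 * q' ->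
  a + 2 * (- d) * k + (- d) ^+ 2 * q - d ^+ 2 < a' + 2 * (- d) * k' + (- d) ^+ 2 * q' ->
  `|k - k'| <= e.
Proof.
move=> d0 dD q0 qD H1; rewrite mulr0 !mul0r expr0n /= !mul0r !addr0 sqrrN => H2 H3 H4.
have k1 : d ^+ 2 * q' <= d ^+ 2 * D by rewrite ler_pM2l// exprn_gt0.
have k2 : 0 <= d ^+ 2 * q by rewrite mulr_ge0// sqr_ge0.
have F1 : d * (2 * (k - k')) <= d * (d * (D + 3)) by nra.
have F2 : d * (2 * (k' - k)) <= d * (d * (D + 3)) by nra.
have e0 : 0 <= e by move: F1 F2; rewrite !ler_pM2l// dD; lra.
rewrite !ler_pM2l// dD in F1 F2.
by rewrite ler_norml; apply/andP; split; lra.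
Qed.

(** Lower semicontinuity on the box and on its complement, against the upper
    bound on U, forces the convergence of the energies on the box; the
    perturbation of u by the linear functions t xi, with t of either sign, then
    gives the convergence of their first variations. *)
Lemma box_flux_cvg a b (xi : 'cV[R]_n) :
  form_int (U `&` obox a b) (Ah h) (Gh h) (fun x => Ch h x *m xi) @[h --> \oo] -->
  form_int (U `&` obox a b) A G (fun x => C x *m xi).
Proof.
set V := U `&` obox a b; pose V' := U `\` cbox a b.
have oV : open V by apply: openI => //; exact: open_obox.
have oV' : open V'.
  by rewrite /V' setDE; apply: openI => //; apply: closed_openC; exact: closed_cbox.
have VU : V `<=` U by exact: subIsetl.
have V'U : V' `<=` U by exact: subDsetl.
have VO := subset_trans VU UO; have V'O := subset_trans V'U UO.
pose D := Lam * (m%:R * (n%:R * (M * `|xi|)) ^+ 2 * fine (mu V)).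
have D0 : 0 <= D by rewrite !mulr_ge0 ?sqr_ge0 ?fine_ge0// ltW.
have [recL2 recu _] := rec.
have [Kx lipx] := lip_dot xi.
have swO : sqint mu Omega (dot xi) := sqint_lip oO bO lipx.
have L2D t v : L2 Omega v -> L2 Omega (fun x => v x + t * dot xi x).
  by move=> /sO sv; apply/(L2_sqint _ mO); exact: (sqintD mO sv (sqintZ t mO swO)).
have liminfV t e W : open W -> W `<=` U -> 0 < e -> exists N, forall h, (N <= h)%N ->
    W12 (Ch h) U (uh h) ->
    form_int W A G G + (2 * t) * form_int W A G (fun x => C x *m xi) +
      t ^+ 2 * form_int W A (fun x => C x *m xi) (fun x => C x *m xi) - e <
    form_int W (Ah h) (Gh h) (Gh h) +
      (2 * t) * form_int W (Ah h) (Gh h) (fun x => Ch h x *m xi) +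
      t ^+ 2 * form_int W (Ah h) (fun x => Ch h x *m xi) (fun x => Ch h x *m xi).
  move=> oW WU e0; have WO := subset_trans WU UO.
  have := liminf oW WO (L2D t u uL2) (fun h => L2D t (uh h) (recL2 h))
    (L2_cvgDr (fun x => t * dot xi x) recu).
  rewrite (energy_perturbed t xi oW WU CO EA Wu).
  set X := _ + _ => H.
  have : ((X - e)%:E < limn_einf (fun h => energy (Ch h) (Ah h) W (fun x => (uh h x + t * dot xi x)%R)))%E.
    by apply: lt_le_trans H; rewrite lte_fin ltrBlDr ltrDl.
  move=> /limn_einf_gt[N NP]; exists N => h Nh Wh; have := NP h Nh.
  by rewrite (energy_perturbed t xi oW WU (ChO h) (EAh h) Wh) lte_fin.
apply/(@cvgrPdist_le _ R^o) => e e0.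
(* D bounds the second variations; three errors d^2 add up to it *)
pose d := e / (D + 3).
have D3 : 0 < D + 3 by rewrite ltr_wpDl.
have d0 : 0 < d by rewrite divr_gt0.
have dD : d * (D + 3) = e by rewrite /d divfK// gt_eqF.
have dd0 : 0 < d ^+ 2 by rewrite exprn_gt0.
have [N1 N1P] := recovery_energy_le dd0.
have [N2 N2P] := liminfV 0 _ V' oV' V'U dd0.
have [N3 N3P] := liminfV d _ V oV VU dd0.
have [N4 N4P] := liminfV (- d) _ V oV VU dd0.
exists (maxn N0 (maxn (maxn N1 N2) (maxn N3 N4))) => // h /=.
rewrite !geq_max => /and3P[h0 /andP[h1 h2] /andP[h3 h4]].
have [Wh Eh] := N1P h h1.
have S1 : form_int U (Ah h) (Gh h) (Gh h) =
    form_int V (Ah h) (Gh h) (Gh h) + form_int V' (Ah h) (Gh h) (Gh h).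
  exact: (energy_box_split (erefl V') (EAh h) (recovery_range_field Wh)).
have S2 : form_int U A G G = form_int V A G G + form_int V' A G G.
  exact: (energy_box_split (erefl V') EA limit_range_field).
rewrite S1 S2 in Eh.
have dhD := coef_form_le xi h0 oV VO; rewrite -/D in dhD.
have dl0 : 0 <= form_int V A (fun x => C x *m xi) (fun x => C x *m xi).
  exact: (form_int_ge0 (open_leb_measurable oV) (classE_sub mO (open_leb_measurable oV) VO EA) l0' (coef_field_range xi oV VO CO)).
exact: (first_variation_bound d0 dD dl0 dhD Eh (N2P h h2 Wh) (N3P h h3 Wh) (N4P h h4 Wh)).
Qed.

Lemma recovery_bounded : exists N K, 0 <= K /\ forall h, (N <= h)%N ->
  [/\ (N0 <= h)%N, W12 (Ch h) U (uh h) & sqnorm U (Gh h) <= K].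
Proof.
have [N NP] := recovery_energy_le ltr01.
exists (maxn N0 N), (lam^-1 * (form_int U A G G + 1)); split.
  rewrite mulr_ge0// ?invr_ge0// addr_ge0//.
  exact: (form_int_ge0 mU (classE_sub mO mU UO EA) l0' limit_range_field).
move=> h; rewrite geq_max => /andP[h1 /NP[W Eh]]; split => //.
rewrite ler_pdivlMl//; apply: le_trans (ltW Eh).
by have /andP[] := form_int_bounds mU (classE_sub mO mU UO (EAh h)) l0' (recovery_range_field W).
Qed.

(** By the convergence on boxes, the components of the momenta, which are
    bounded in L^2, converge weakly. *)
Lemma flux_weak_cvg (Phi : 'cV[R]_n -> 'cV[R]_n) : L2v Omega Phi ->
  form_int U (Ah h) (Gh h) (fun x => Ch h x *m Phi x) @[h --> \oo] -->
  form_int U A G (fun x => C x *m Phi x).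
Proof.
move=> PL2.
have sP i : sqint mu U (fun x => Phi x i 0) := sqintS mO mU UO (sO (PL2 i)).
have [N [K [K0 NP]]] := recovery_bounded.
pose e i : 'cV[R]_n := delta_mx i 0.
pose p h i x := dot (Ah h x *m Gh h x) (Ch h x *m e i).
pose q i x := dot (A x *m G x) (C x *m e i).
have [L [L' CL]] := CO; have [_ L'0 _ CL'] := CL.
have EU := classE_sub mO mU UO EA.
have EUh h := classE_sub mO mU UO (EAh h).
have sq i : sqint mu U (q i).
  apply: (form_coef_sqint (M := L') mU l0' Lam0 L'0 _ EU limit_range_field (coef_field_range (e i) oU UO CO)).1.
  by move=> x j l /UO; exact: CL'.
pose kap i := Lam ^+ 2 * (m%:R * (n%:R * (M * `|e i|)) ^+ 2).
have kap0 i : 0 <= kap i by rewrite /kap mulr_ge0 ?sqr_ge0// mulr_ge0// sqr_ge0.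
have pP h i : (N <= h)%N -> sqint mu U (p h i) /\ \int[mu]_(x in U) (p h i x ^+ 2) <= kap i * K.
  move=> /NP[h0 W sK].
  have [s1 s2] := form_coef_sqint mU l0' Lam0 M0 (fun x j l Ux => ChM j l h0 (UO Ux))
    (EUh h) (recovery_range_field W) (coef_field_range (e i) oU UO (ChO h)).
  by split => //; exact: (le_trans s2 (ler_wpM2l (kap0 i) sK)).
pose f i k x := p (k + N)%N i x - q i x.
have sp i k : sqint mu U (p (k + N)%N i) := (pP _ i (leq_addl k N)).1.
have sf i k : sqint mu U (f i k) := sqintB mU (sp i k) (sq i).
have bf i k : \int[mu]_(x in U) (f i k x ^+ 2) <=
    2 * (kap i * K) + 2 * \int[mu]_(x in U) (q i x ^+ 2).
  have r1 := (sp i k).2; have r2 := (sq i).2.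
  have r3 := rintD mU (rintZ 2 mU r1) (rintZ 2 mU r2).
  apply: (@le_trans _ _ (2 * \int[mu]_(x in U) (p (k + N)%N i x ^+ 2) + 2 * \int[mu]_(x in U) (q i x ^+ 2))).
    rewrite -(RintegralZl 2 mU r1) -(RintegralZl 2 mU r2) -(RintegralD mU (rintZ 2 mU r1) (rintZ 2 mU r2)).
    apply: (le_Rint_ae mU (sf i k).2 r3); apply: aeW => x _; rewrite /f.
    by move: (p _ i x) (q i x) => a b; have := sqr_ge0 (a + b); nra.
  by rewrite lerD2r ler_pM2l//; exact: (pP _ i (leq_addl k N)).2.
have boxf i a b : \int[mu]_(x in U `&` obox a b) f i k x @[k --> \oo] --> 0.
  have mV : measurable (U `&` obox a b : set (eucl R n)).
    by apply: open_leb_measurable; apply: openI => //; exact: open_obox.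
  have VU : U `&` obox a b `<=` U by exact: subIsetl.
  have Voo := bounded_leb_lty (bounded_setS VU bU).
  have rp k := sqint_rint mV Voo (sqintS mU mV VU (sp i k)).
  have rq := sqint_rint mV Voo (sqintS mU mV VU (sq i)).
  pose F h := form_int (U `&` obox a b) (Ah h) (Gh h) (fun x => Ch h x *m e i).
  rewrite (_ : (fun k => _) = (fun k => F (k + N)%N - form_int (U `&` obox a b) A G (fun x => C x *m e i))); last first.
    by apply/funext => k; exact: (RintegralB mV (rp k) rq).
  rewrite -[X in _ --> X](subrr (form_int (U `&` obox a b) A G (fun x => C x *m e i))).
  apply: cvgB; last exact: cvg_cst.
  by rewrite (cvg_shiftn N F); exact: box_flux_cvg.
have wf i : \int[mu]_(x in U) (f i k x * Phi x i 0) @[k --> \oo] --> 0.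
  exact: (weak_cvg_boxes oU bU (sf i) (bf i) (boxf i) (sP i)).
pose H h := form_int U (Ah h) (Gh h) (fun x => Ch h x *m Phi x).
rewrite -(cvg_shiftn N H).
have E k : H (k + N)%N - form_int U A G (fun x => C x *m Phi x) =
    \sum_i \int[mu]_(x in U) (f i k x * Phi x i 0).
  have rpP i := sqintM_rint mU (sp i k) (sP i).
  have rqP i := sqintM_rint mU (sq i) (sP i).
  have E1 : H (k + N)%N = \sum_i \int[mu]_(x in U) (p (k + N)%N i x * Phi x i 0).
    rewrite -(Rint_sum (index_enum 'I_n) mU rpP).2.
    by apply: eq_Rintegral => x _; exact: dot_mul_delta.
  have E2 : form_int U A G (fun x => C x *m Phi x) = \sum_i \int[mu]_(x in U) (q i x * Phi x i 0).
    rewrite -(Rint_sum (index_enum 'I_n) mU rqP).2.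
    by apply: eq_Rintegral => x _; exact: dot_mul_delta.
  rewrite E1 E2 -sumrB; apply: eq_bigr => i _.
  rewrite -(RintegralB mU (rpP i) (rqP i)).
  by apply: eq_Rintegral => x _; rewrite -mulrBl.
rewrite (_ : (fun k => H (k + N)%N) = (fun k =>
    form_int U A G (fun x => C x *m Phi x) + \sum_i \int[mu]_(x in U) (f i k x * Phi x i 0))); last first.
  by apply/funext => k; rewrite -E addrC subrK.
have cs : \sum_i \int[mu]_(x in U) (f i k x * Phi x i 0) @[k --> \oo] --> (0 : R).
  rewrite [X in _ --> X](_ : _ = \sum_(i < n) (0 : R)); last by rewrite big1.
  by apply: cvg_sum => i; exact: wf.
have cl : (fun _ : nat => form_int U A G (fun x => C x *m Phi x)) @ \oo -->
    form_int U A G (fun x => C x *m Phi x) by exact: cvg_cst.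
exact: (cvgD0 cl cs).
Qed.

Hypothesis Cuni : forall e, 0 < e -> exists N, forall h, (N <= h)%N ->
  forall x j i, Omega x -> `|Ch h x j i - C x j i| <= e.

(** On fields C^h z the momenta only see z through C^h z, whose strong
    convergence allows for varying test fields. *)
Lemma flux_cvg (Phi : 'cV[R]_n -> 'cV[R]_n) (Phih : nat -> 'cV[R]_n -> 'cV[R]_n) :
  L2v Omega Phi -> (forall h, L2v Omega (Phih h)) ->
  L2v_cvg Omega (fun h x => Ch h x *m Phih h x) (fun x => C x *m Phi x) ->
  form_int U (Ah h) (Gh h) (fun x => Ch h x *m Phih h x) @[h --> \oo] -->
  form_int U A G (fun x => C x *m Phi x).
Proof.
move=> PL2 PhL2 cP.
have sP i : sqint mu Omega (fun x => Phi x i 0) := sO (PL2 i).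
have sPh h i : sqint mu Omega (fun x => Phih h x i 0) := sO (PhL2 h i).
have [L [L' CL]] := CO.
have [Lh CLh] := choice ChO.
have rPh h : range_field Omega (Ch h) (fun x => Ch h x *m Phih h x).
  by have [L1 CL1] := CLh h; exact: (range_field_mul oO CL1 (sPh h)).
have rhP h : range_field Omega (Ch h) (fun x => Ch h x *m Phi x).
  by have [L1 CL1] := CLh h; exact: (range_field_mul oO CL1 sP).
have rP : range_field Omega C (fun x => C x *m Phi x) := range_field_mul oO CL sP.
pose a h x := Ch h x *m Phih h x - C x *m Phi x.
pose b h x := C x *m Phi x - Ch h x *m Phi x.
have sa h j : sqint mu Omega (fun x => a h x j 0).
  by apply: (eq_sqint mO _ (sqintB mO ((rPh h).1 j) (rP.1 j))) => x _; rewrite [RHS]mxE [X in _ = _ + X]mxE.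
have sb h j : sqint mu Omega (fun x => b h x j 0).
  by apply: (eq_sqint mO _ (sqintB mO (rP.1 j) ((rhP h).1 j))) => x _; rewrite [RHS]mxE [X in _ = _ + X]mxE.
have ca : sqnorm Omega (a h) @[h --> \oo] --> 0 := L2v_cvg_sqnorm mO sa cP.
pose S x := \sum_i `|Phi x i 0|.
have sS : sqint mu Omega S := sqint_sum (index_enum 'I_n) mO (fun i => sqint_norm mO (sP i)).
have S0 x : 0 <= S x by exact: sumr_ge0.
pose IS := \int[mu]_(x in Omega) (S x ^+ 2).
have IS0 : 0 <= IS by apply: Rintegral_ge0 => x _; exact: sqr_ge0.
have bS h e : 0 <= e -> (forall x j i, Omega x -> `|Ch h x j i - C x j i| <= e) ->
    sqnorm Omega (b h) <= m%:R * e ^+ 2 * IS.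
  move=> e0 He; have r := sS.2.
  rewrite /IS -(RintegralZl (m%:R * e ^+ 2) mO r).
  apply: (le_Rint_ae mO (sqint_dot mO (sb h) (sb h)) (rintZ (m%:R * e ^+ 2) mO r)).
  apply: aeW => x Ox; rewrite -mulrA -exprMn; apply: dot_le_const; first by rewrite mulr_ge0.
  move=> j; rewrite /b -mulmxBl mxE; apply: le_trans (ler_norm_sum _ _ _) _.
  rewrite /S mulr_sumr; apply: ler_sum => i _; rewrite normrM; apply: ler_wpM2r => //.
  by rewrite !mxE distrC; exact: He.
have cb : sqnorm Omega (b h) @[h --> \oo] --> 0.
  apply/cvgr0Pnorm_le => r r0.
  pose e := Num.min 1 (r / (m%:R * IS + 1)).
  have mI : 0 < m%:R * IS + 1 by rewrite ltr_wpDl// mulr_ge0.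
  have e0 : 0 < e by rewrite lt_min ltr01 divr_gt0.
  have [N NP] := Cuni e0; exists N => // h Nh.
  rewrite ger0_norm ?sqnorm_ge0//; apply: le_trans (bS h e (ltW e0) (NP h Nh)) _.
  have e1 : e <= 1 by rewrite ge_min lexx.
  have e2 : e * (m%:R * IS + 1) <= r.
    by rewrite -ler_pdivlMr// ge_min lexx orbT.
  have mI0 : 0 <= m%:R * IS by rewrite mulr_ge0.
  rewrite mulrAC; move: mI0 e2; move: (m%:R * IS) => X X0 e2.
  have e3 : e ^+ 2 <= e by rewrite expr2 ler_piMl// ltW.
  by apply: le_trans (ler_wpM2l X0 e3) _; move: e2 (ltW e0); rewrite mulrDr mulr1 mulrC; lra.
pose d h x := Ch h x *m (Phih h x - Phi x).
have sd h j : sqint mu U (fun x => d h x j 0).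
  apply: (eq_sqint mU _ (sqintS mO mU UO (sqintB mO ((rPh h).1 j) ((rhP h).1 j)))) => x _.
  by rewrite /d mulmxBr [RHS]mxE [X in _ = _ + X]mxE.
have dle h : sqnorm U (d h) <= 2 * sqnorm Omega (a h) + 2 * sqnorm Omega (b h).
  have E : d h = (fun x => a h x + b h x).
    by apply/funext => x; rewrite /d /a /b mulmxBr addrA subrK.
  have saU j := sqintS mO mU UO (sa h j); have sbU j := sqintS mO mU UO (sb h j).
  rewrite E; apply: le_trans (sqnormD_le mU saU sbU) _.
  by apply: lerD; rewrite ler_pM2l//; exact: sqnorm_sub.
have cd : 2 * sqnorm Omega (a h) + 2 * sqnorm Omega (b h) @[h --> \oo] --> 0.
  exact: (cvgD0 (cvg0Z 2 ca) (cvg0Z 2 cb)).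
have rd h : range_field U (Ch h) (d h).
  by split; [exact: sd|apply: aeW => x _; exists (Phih h x - Phi x)].
have [N [K [K0 NP]]] := recovery_bounded.
have EUh h := classE_sub mO mU UO (EAh h).
have cr : form_int U (Ah h) (Gh h) (d h) @[h --> \oo] --> 0.
  apply/cvgr0Pnorm_le => r r0.
  (* c makes the contribution of the gradients at most r / Lam; the other one has
   the factor 1/c and tends to zero *)
pose c := r / (Lam * (K + 1)).
  have K1 : 0 < K + 1 by rewrite ltr_wpDl.
  have c0 : 0 < c by rewrite divr_gt0// mulr_gt0.
  have rc0 : 0 < c * r / Lam by rewrite divr_gt0// mulr_gt0.
  move: cd => /cvgr0Pnorm_le/(_ _ rc0)[N1 _ N1P].
  exists (maxn N N1) => // h /=; rewrite geq_max => /andP[h1 h2].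
  have [_ W GK] := NP h h1.
  apply: le_trans (form_int_le mU (EUh h) l0' c0 (recovery_range_field W) (rd h)) _.
  have := le_trans (ler_norm _) (N1P h h2) => /(le_trans (dle h)) dk.
  have k1 : c * sqnorm U (Gh h) <= r / Lam.
    apply: (@le_trans _ _ (c * (K + 1))).
      by rewrite ler_pM2l//; apply: le_trans GK _; rewrite lerDl.
    by rewrite le_eqVlt; apply/orP; left; apply/eqP; rewrite /c; field; rewrite !gt_eqF.
  have k2 : c^-1 * sqnorm U (d h) <= r / Lam.
    by rewrite ler_pdivrMl// mulrA.
  apply: (@le_trans _ _ (Lam / 2 * (r / Lam + r / Lam))).
    by apply: ler_wpM2l; [rewrite divr_ge0// ltW|exact: lerD].
  by rewrite le_eqVlt; apply/orP; left; apply/eqP; field; rewrite gt_eqF.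
pose H h := form_int U (Ah h) (Gh h) (fun x => Ch h x *m Phih h x).
pose H' h := form_int U (Ah h) (Gh h) (fun x => Ch h x *m Phi x) +
  form_int U (Ah h) (Gh h) (d h).
have E k : H (k + N)%N = H' (k + N)%N.
  have [_ W _] := NP _ (leq_addl k N).
  rewrite /H' -(form_intDr mU (EUh _) l0' (recovery_range_field W) (range_fieldS mO mU UO (rhP _)) (rd _)).
  by apply: eq_Rintegral => x _; rewrite /d mulmxBr addrC subrK.
rewrite -(cvg_shiftn N H) (_ : (fun k => H (k + N)%N) = (fun k => H' (k + N)%N)); last exact/funext.
rewrite (cvg_shiftn N H').
exact: (cvgD0 (flux_weak_cvg PL2) cr).
Qed.

End box_flux.

Section uniform_convergence.
Context {R : realType} {m n : nat}.

Lemma uniform_cvg_entries (Omega : set 'cV[R]_n) (Ch : nat -> 'cV[R]_n -> 'M[R]_(m, n))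
    (C : 'cV[R]_n -> 'M[R]_(m, n)) e :
  {uniform Omega, Ch @ \oo --> C} -> 0 < e ->
  exists2 N, True & forall h, (N <= h)%N ->
    forall x, Omega x -> forall j i, `|Ch h x j i - C x j i| <= e.
Proof.
move=> uni e0.
have /uni[N _ NP] : nbhs (C : {uniform` Omega -> 'M[R]_(m, n)})
    [set f : {uniform` Omega -> 'M[R]_(m, n)} | forall x, Omega x -> ball (C x) e (f x)].
  apply/uniform_nbhs; exists [set xy | ball xy.1 e xy.2]; split => //.
  exact: entourage_ball (PosNum e0).
exists N => // h Nh x Ox j i; have := NP h Nh x Ox.
rewrite -ball_normE /= => /ltW; apply: le_trans; rewrite distrC.
by have := entry_le_norm (C x - Ch h x) j i; rewrite !mxE.
Qed.

End uniform_convergence.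

Unset Implicit Arguments.

Theorem theorem6p15 (R : realType) (m n : nat) (Omega : set 'cV[R]_n)
    (Ch : nat -> 'cV[R]_n -> 'M[R]_(m, n)) (C : 'cV[R]_n -> 'M[R]_(m, n))
    (lambda Lambda : R)
    (Ah : nat -> 'cV[R]_n -> 'M[R]_m) (A : 'cV[R]_n -> 'M[R]_m) :
  (0 < m <= n)%N ->
  open Omega -> bounded_set Omega ->
  (forall h, lipschitz_in Omega (Ch h)) -> lipschitz_in Omega C ->
  {uniform Omega, Ch @ \oo --> C} ->
  classS1 Omega Ch C \/ classS2 Omega Ch ->
  0 < lambda <= Lambda ->
  (forall h, classE Omega lambda Lambda (Ch h) (Ah h)) ->
  classE Omega lambda Lambda C A ->
  (forall U, open U -> U `<=` Omega ->
     Gamma_cvg Omega (fun h => energy (Ch h) (Ah h) U) (energy C A U)) ->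
  exists s : nat -> nat, {homo s : h k / (h < k)%N} /\
    forall (U : set 'cV[R]_n) (u : 'cV[R]_n -> R) (uh : nat -> 'cV[R]_n -> R)
      (Phi : 'cV[R]_n -> 'cV[R]_n) (Phih : nat -> 'cV[R]_n -> 'cV[R]_n),
    open U -> U `<=` Omega ->
    L2 Omega u -> W12 C U u ->
    recovery_sequence Omega (fun h => energy (Ch (s h)) (Ah (s h)) U)
      (energy C A U) u uh ->
    L2v Omega Phi -> (forall h, L2v Omega (Phih h)) ->
    L2v_cvg Omega (fun h x => Ch (s h) x *m Phih h x) (fun x => C x *m Phi x) ->
    \int[@leb R n]_(x in U)
      dot (Ah (s h) x *m Xgrad (Ch (s h)) U (uh h) x)
          (Ch (s h) x *m Phih h x) @[h --> \oo]
    --> \int[@leb R n]_(x in U) dot (A x *m Xgrad C U u x) (C x *m Phi x).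

Proof.
move=> /andP[m0 mn] oO bO lipCh lipC uni _ /andP[l0 lL] EAh EA Gam.
have n0 : (0 < n)%N by exact: leq_trans m0 mn.
have CO := lipschitz_in_bounds bO lipC.
have ChO h := lipschitz_in_bounds bO (lipCh h).
have Cuni e : 0 < e -> exists N, forall h, (N <= h)%N ->
    forall x j i, Omega x -> `|Ch h x j i - C x j i| <= e.
  move=> e0; have [N _ NP] := uniform_cvg_entries uni e0.
  by exists N => h Nh x j i Ox; exact: NP.
(* uniform convergence bounds the coefficients from some rank on *)
have [N0 N0P] := Cuni 1 ltr01.
have [L [M CL]] := CO; have [_ M0 _ CM] := CL.
have ChM h x j i : (N0 <= h)%N -> Omega x -> `|Ch h x j i| <= M + 1.
  move=> Nh Ox; rewrite -(subrK (C x j i) (Ch h x j i)) addrC.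
  by apply: le_trans (ler_normD _ _) _; apply: lerD; [exact: CM|exact: N0P].
(* the convergence holds along the whole sequence *)
exists id; split => // U u uh Phi Phih oU UO uL2 Wu rec PL2 PhL2 cP.
have M1 : 0 <= M + 1 by rewrite addr_ge0.
exact: (flux_cvg n0 oO bO CO ChO M1 ChM l0 lL EAh EA
  (fun V oV VO => (Gam V oV VO).1) oU UO uL2 Wu rec Cuni PL2 PhL2 cP).
Qed.
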